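(* Let $S^1\subset\mathbb{C}$ be the unit circle and let $\mu$ denote normalised Lebesgue measure on $S^1$. Let $T\colon S^1\to S^1$ be a real-analytic map satisfying $\inf_{z\in S^1}|T'(z)|>1$, let $U\subset\mathbb{C}$ be an open neighbourhood of $S^1$, and let $f\colon U\to\mathbb{C}$ be a holomorphic function such that $f=h\circ T-h$ $\mu$-a.e. (on $S^1$) for some measurable function $h\colon S^1\to\mathbb{C}$. Then there exist an open neighbourhood $V$ of $S^1$ in $\mathbb{C}$ and a holomorphic function $g\colon V\to\mathbb{C}$ such that $g=h$ $\mu$-a.e. (on $S^1$).
   Context: The quantity $|T'(z)|$ is the modulus of the derivative of $T$ at $z \in S^1$; it is the same whether computed with respect to arc length on $S^1$ or as the complex derivative of the holomorphic extension of $T$ to a neighbourhood of $S^1$. *)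

(* Defs.v *)
From HB Require Import structures.
From mathcomp Require Import all_boot all_order all_algebra.
From mathcomp Require Import complex.
From mathcomp Require Import all_classical all_reals all_analysis.
From mathcomp Require Import measurable_realfun.

Set Implicit Arguments.
Unset Strict Implicit.
Unset Printing Implicit Defensive.

Import Order.TTheory GRing.Theory Num.Theory.
Import numFieldTopology.Exports numFieldNormedType.Exports.

Local Open Scope classical_set_scope.
Local Open Scope ring_scope.
Local Open Scope complex_scope.

(* R[i] as a normed module over itself (so that [derivable f z 1] is complex
   differentiability) and as a measurable space with its Borel sets. *)
HB.instance Definition _ (R : realType) := NormedModule.copy R[i] R[i]^o.
HB.instance Definition _ (R : realType) :=
  Measurable.copy R[i] (g_sigma_algebraType (@open R[i])).

Definition unit_circle (R : realType) : set R[i] := [set z | `|z| = 1].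

Definition expi (R : realType) (t : R) : R[i] := cos t +i* sin t.

Definition holomorphic_on (R : realType) (U : set R[i]) (f : R[i] -> R[i]) :=
  forall z, U z -> derivable f z 1.

(* Maps of the circle are represented by total functions on R[i], of which only
   the values on the circle matter. Near z the circle is parametrised by the
   signed arc length s, as z * expi s; T is real-analytic if it is locally the
   sum of a power series in s (with complex coefficients, the target circle
   being a real-analytic submanifold of the plane). *)
Definition circle_analytic (R : realType) (T : R[i] -> R[i]) :=
  forall z, unit_circle z ->
  exists (a : nat -> R[i]) (r : R), 0 < r /\
    forall s : R, `|s| < r ->
      [series a n * s%:C ^+ n]_n @ \oo --> T (z * expi s).

Definition circle_derive (R : realType) (T : R[i] -> R[i]) (z : R[i]) : R[i] :=
  lim ((T (z * expi s) - T z) / s%:C @[s --> (0 : R)^']).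

(* |T'(z)|, as an element of R (the norm `|_| of R[i] takes values in R[i]). *)
Definition circle_speed (R : realType) (T : R[i] -> R[i]) (z : R[i]) : R :=
  ComplexField.Normc.normc (circle_derive T z).

Lemma continuous_real_complex (R : realType) :
  continuous (fun x : R => x%:C : R[i]).
Proof.
move=> x; apply/cvgrPdist_lt => e e0.
have := e0; rewrite ltcE /= => /andP[/eqP ime ree].
near=> y.
have -> : x%:C - y%:C = (x - y)%:C by rewrite rmorphB.
rewrite normc_def /= expr0n addr0 sqrtr_sqr ltcE /= -ime eqxx /=.
near: y; exact: (@cvgr_dist_lt _ _ _ (nbhs x) _ id x).
Unshelve. all: by end_near. Qed.

Lemma expiE (R : realType) (t : R) : expi t = (cos t)%:C + 'i * (sin t)%:C.
Proof. by rewrite /expi; simpc. Qed.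

Lemma continuous_expi (R : realType) : continuous (@expi R).
Proof.
have -> : @expi R = (fun t => (cos t)%:C + 'i * (sin t)%:C).
  by apply/funext => t; rewrite expiE.
move=> t; apply: cvgD; last apply: cvgMr.
- apply: (@continuous_comp _ _ _ (@cos R) (fun x : R => x%:C : R[i])).
    exact: continuous_cos.
  exact: continuous_real_complex.
- apply: (@continuous_comp _ _ _ (@sin R) (fun x : R => x%:C : R[i])).
    exact: continuous_sin.
  exact: continuous_real_complex.
Qed.

Lemma measurable_expi (R : realType) :
  measurable_fun [set: measurableTypeR R] (@expi R).
Proof.
apply: (@measurability _ _ (measurableTypeR R) R[i] setT (@expi R) open erefl).
move=> _ [A oA <-]; rewrite setTI; apply: open_measurable.
by apply: open_comp => // t _; exact: continuous_expi.
Qed.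

Definition expi_mfun (R : realType) : {mfun measurableTypeR R >-> R[i]} :=
  HB.pack (@expi R) (isMeasurableFun.Build _ _ (measurableTypeR R) R[i]
    (@expi R) (@measurable_expi R)).

Lemma twopi_gt0 (R : realType) : 0 < pi *+ 2 :> R.
Proof. by rewrite pmulrn_lgt0// pi_gt0. Qed.

(* Normalised Lebesgue measure on the circle, as a Borel probability on R[i]
   carried by the circle: the law of expi t for t uniform on [0, 2 pi]. *)
Definition circle_measure (R : realType) : probability R[i] R :=
  distribution (uniform_prob (twopi_gt0 R)) (expi_mfun R).

Lemma expi_circle (R : realType) (t : R) : unit_circle (expi t).
Proof. by rewrite /unit_circle/= normc_def /= cos2Dsin2 sqrtr1. Qed.

Lemma measurable_unit_circle (R : realType) : measurable (@unit_circle R).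
Proof.
rewrite -(setCK (@unit_circle R)); apply: measurableC; apply: sub_sigma_algebra.
change (open ((Num.norm : R[i] -> R[i]) @^-1` (~` [set 1]))).
apply: open_comp => [z _|]; first exact: norm_continuous.
by apply: closed_openC; exact/accessible_closed_set1/hausdorff_accessible/norm_hausdorff.
Qed.

Lemma circle_measure_unit_circle (R : realType) :
  circle_measure R (@unit_circle R) = 1%E.
Proof.
rewrite /circle_measure /distribution /= /pushforward.
rewrite (_ : @expi R @^-1` _ = setT) ?probability_setT//.
by apply/seteqP; split=> // t _; exact: expi_circle.
Qed.

(* The sigma-algebra of Lebesgue measurable sets, i.e. the completion of the
   Borel sets for circle_measure. *)
Definition circle_lebesgue (R : realType) :=
  g_sigma_algebraType (completed_algebra_gen (circle_measure R)).

Definition circle_measurable (R : realType) (h : R[i] -> R[i]) :=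
  @measurable_fun _ _ (circle_lebesgue R) R[i] (@unit_circle R) h.

(* [measurable_fun] has the measurability of the domain as a premise; it holds
   here. *)
Lemma circle_measurableP (R : realType) (h : R[i] -> R[i]) :
  circle_measurable h <->
  forall Y : set R[i], measurable Y ->
    (completed_algebra_gen (circle_measure R)).-sigma.-measurable
      (@unit_circle R `&` h @^-1` Y).
Proof.
split=> [mh Y mY|mh _ //]; apply: mh => //.
apply: sub_sigma_algebra; exists (@unit_circle R).
  exact: measurable_unit_circle.
by exists set0; [exact: negligible_set0|rewrite setU0].
Qed.

(* Main.v *)
Require Import Defs.
From mathcomp Require Import all_boot all_order all_algebra.
From mathcomp Require Import complex.
From mathcomp Require Import all_classical all_reals all_analysis.
From mathcomp Require Import measurable_realfun.
From mathcomp Require Import ring lra.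

Import Order.TTheory GRing.Theory Num.Theory.
Import numFieldTopology.Exports numFieldNormedType.Exports.

Local Open Scope classical_set_scope.
Local Open Scope ring_scope.
Local Open Scope complex_scope.

(** The problem is lifted to the line. Let [expi (F x) = T (expi x)]: the lift [F]
    is an expanding diffeomorphism of the line, and its inverse [psi] is a
    contraction, with a fixed point [p] ([lift_exists], [expanding_inverse],
    [contraction_fixpoint]). With [phi x = f (expi x)], iteration of the equation
    along the backward orbit of almost every [x] gives
      [h (expi x) = h (expi (iter n psi x)) + \sum_(k < n) phi (iter k.+1 psi x)].
    If [h] is regular near [p], then comparing two points and letting [n] tend to
    infinity shows that [h (expi x)] is, up to a constant, the sum of the series
    of the [phi (iter k.+1 psi x) - phi p] ([rigidity]).

    This sum is holomorphic. Since [T] is analytic, [psi] extends to holomorphic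
    contractions of discs of a uniform radius about the points of the line
    ([inverse_branches]); the terms of the series are then holomorphic functions
    with geometrically decreasing Lipschitz constants ([transfer_sum]).

    A merely measurable [h] is regular enough. A set where [h] is almost constant
    has a density point. Small intervals about this point are blown up by the
    iterates of [F] to a whole period with bounded distortion, hence without
    losing the proportion of the set, and the equation changes [h] only by
    functions that are Lipschitz uniformly in [n]. In the limit, [h] composed
    with [expi] is Lipschitz on a period about [p], off a null set
    ([bounded_distortion], [approximate_lipschitz], [lipschitz_window]).

    Back on the circle, the sum is periodic because [h] composed with [expi] is,
    and its local extensions agree on the line. By unique continuation they agree
    where they meet, and define a holomorphic function on an annulus ([glue]).

    Holomorphic functions are given as complex differentiable functions. The
    argument needs the bound of the derivative by the function
    ([cauchy_derivative]) and unique continuation from the real axis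
    ([vanish_near_axis]). Both follow from an estimate of the value at the centre
    of a square by the values on its boundary ([cauchy_center],
    [cauchy_symmetric]), for which Goursat's argument is applied to midpoint sums
    in place of integrals ([goursat]). *)

Set Implicit Arguments.
Unset Strict Implicit.
Unset Printing Implicit Defensive.

Local Notation cabs := ComplexField.Normc.normc.
Local Notation Re := complex.Re.
Local Notation Im := complex.Im.


(** * The modulus as a real number *)

Lemma cabs_def (R : realType) (z : R[i]) :
  cabs z = Num.sqrt (Re z ^+ 2 + Im z ^+ 2).
Proof. by case: z. Qed.

Lemma normE (R : realType) (z : R[i]) : `|z| = (cabs z)%:C.
Proof. by rewrite normc_def cabs_def. Qed.

Lemma cabs_ge0 (R : realType) (z : R[i]) : 0 <= cabs z.
Proof. by rewrite cabs_def sqrtr_ge0. Qed.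

Lemma cabsM (R : realType) (z w : R[i]) : cabs (z * w) = cabs z * cabs w.
Proof. exact: ComplexField.Normc.normcM. Qed.

Lemma cabsD (R : realType) (z w : R[i]) : cabs (z + w) <= cabs z + cabs w.
Proof. exact: le_normcD. Qed.

Lemma cabsN (R : realType) (z : R[i]) : cabs (- z) = cabs z.
Proof. exact: normcN. Qed.

Lemma cabsB (R : realType) (z w : R[i]) : cabs (z - w) <= cabs z + cabs w.
Proof. by rewrite -(cabsN w) cabsD. Qed.

Lemma cabsC (R : realType) (z w : R[i]) : cabs (z - w) = cabs (w - z).
Proof. by rewrite -cabsN opprB. Qed.

Lemma cabs_tri (R : realType) (u z w : R[i]) :
  cabs (z - w) <= cabs (z - u) + cabs (u - w).
Proof. by rewrite (le_trans _ (cabsD _ _))// addrA subrK. Qed.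

Lemma cabs0 (R : realType) : cabs (0 : R[i]) = 0.
Proof. exact: ComplexField.Normc.normc0. Qed.

Lemma cabs1 (R : realType) : cabs (1 : R[i]) = 1.
Proof. exact: ComplexField.Normc.normc1. Qed.

Lemma cabs0_eq0 (R : realType) (z : R[i]) : cabs z = 0 -> z = 0.
Proof. exact: ComplexField.Normc.eq0_normc. Qed.

Lemma cabs_gt0 (R : realType) (z : R[i]) : (0 < cabs z) = (z != 0).
Proof.
rewrite lt_neqAle cabs_ge0 andbT eq_sym; apply/idP/idP; apply: contraNneq.
  by move=> ->; rewrite cabs0.
by move=> /cabs0_eq0 ->.
Qed.

Lemma cabsV (R : realType) (z : R[i]) : cabs z^-1 = (cabs z)^-1.
Proof. exact: ComplexField.Normc.normcV. Qed.

Lemma cabsX (R : realType) (z : R[i]) n : cabs (z ^+ n) = cabs z ^+ n.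
Proof.
by elim: n => [|n IH]; rewrite ?expr0 ?cabs1// !exprS cabsM IH.
Qed.

Lemma cabs_real (R : realType) (x : R) : cabs x%:C = `|x|.
Proof. by rewrite cabs_def /= expr0n addr0 sqrtr_sqr. Qed.

Lemma cabsi (R : realType) : cabs ('i%C : R[i]) = 1.
Proof. by rewrite cabs_def /= expr0n add0r expr1n sqrtr1. Qed.

Lemma Re_le_cabs (R : realType) (z : R[i]) : `|Re z| <= cabs z.
Proof. by have := normc_ge_Re z; rewrite normE lecR. Qed.

Lemma Im_le_cabs (R : realType) (z : R[i]) : `|Im z| <= cabs z.
Proof.
by rewrite cabs_def -sqrtr_sqr ler_sqrt ?addr_ge0 ?sqr_ge0// lerDr sqr_ge0.
Qed.

Lemma cabs_le_ReIm (R : realType) (z : R[i]) : cabs z <= `|Re z| + `|Im z|.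
Proof.
rewrite {1}(complexE z) (le_trans (cabsD _ _))// cabsM cabsi mul1r.
by rewrite !cabs_real.
Qed.

Lemma cabs_small0 (R : realType) (z : R[i]) :
  (forall e, 0 < e -> cabs z <= e) -> z = 0.
Proof.
move=> H; apply: cabs0_eq0; apply/eqP; rewrite eq_le cabs_ge0 andbT.
by apply/ler_addgt0Pl => e e0; rewrite addr0 H.
Qed.

Lemma exp_small (R : realType) (q e : R) :
  0 <= q < 1 -> 0 < e -> exists n, q ^+ n < e.
Proof.
move=> q01 e0.
have /cvgr0Pnorm_lt/(_ _ e0)[n _ Hn] : (fun n => q ^+ n) @ \oo --> (0 : R).
  by apply: cvg_expr; rewrite ger0_norm; case/andP: q01.
by exists n; apply: le_lt_trans (Hn n (leqnn n)); rewrite ler_norm.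
Qed.

(** Adding to, or subtracting from, [x k] a suitable multiple of [q ^+ k] gives a
    nonincreasing, resp. nondecreasing sequence; the limit lies between them. *)
Lemma geometric_limit_real (R : realType) (x : nat -> R) (M q : R) :
  0 <= q < 1 -> (forall k, `|x k.+1 - x k| <= M * q ^+ k) ->
  exists l, forall k, `|x k - l| <= M / (1 - q) * q ^+ k.
Proof.
move=> /andP[q0 q1] Hx.
pose K := M / (1 - q).
have EM k : M * q ^+ k = K * q ^+ k - K * q ^+ k.+1.
  by rewrite /K exprS; field; lra.
pose lo k := x k - K * q ^+ k; pose up k := x k + K * q ^+ k.
have lo_up k : lo k <= up k.
  have M0 : 0 <= M by have := Hx 0%N; rewrite expr0 mulr1; apply: le_trans.
  have : 0 <= K * q ^+ k by rewrite mulr_ge0 ?exprn_ge0// divr_ge0//; lra.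
  by rewrite /lo /up; lra.
have lo_nd : {homo lo : m n / (m <= n)%N >-> m <= n}.
  apply/nondecreasing_seqP => k; rewrite /lo.
  by have := Hx k; rewrite EM ler_norml => /andP[]; lra.
have up_ni : {homo up : m n / (m <= n)%N >-> n <= m}.
  apply/nonincreasing_seqP => k; rewrite /up.
  by have := Hx k; rewrite EM ler_norml => /andP[]; lra.
have cross k m : lo k <= up m.
  apply: (@le_trans _ _ (lo (maxn k m))); first by rewrite lo_nd// leq_maxl.
  by rewrite (le_trans (lo_up _))// up_ni// leq_maxr.
exists (sup (range lo)) => k.
have H1 : lo k <= sup (range lo).
  apply: ub_le_sup; last by exists k.
  by exists (up 0%N) => _ [j _ <-].
have H2 : sup (range lo) <= up k.
  by apply: ge_sup; [exists (lo 0%N), 0%N | move=> _ [j _ <-]].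
by rewrite -/K ler_norml; move: H1 H2; rewrite /lo /up; lra.
Qed.

Lemma geometric_limit (R : realType) (a : nat -> R[i]) (M q : R) :
  0 <= q < 1 -> (forall k, cabs (a k.+1 - a k) <= M * q ^+ k) ->
  exists l, forall k, cabs (a k - l) <= 2 * (M / (1 - q)) * q ^+ k.
Proof.
move=> q01 Ha.
have [k|l1 H1] := @geometric_limit_real R (fun k => Re (a k)) M q q01.
  by apply: le_trans (Ha k); rewrite (le_trans _ (Re_le_cabs _))// raddfB.
have [k|l2 H2] := @geometric_limit_real R (fun k => Im (a k)) M q q01.
  by apply: le_trans (Ha k); rewrite (le_trans _ (Im_le_cabs _))// raddfB.
exists (l1 +i* l2) => k; apply: le_trans (cabs_le_ReIm _) _.
by rewrite !raddfB /= -mulrA mulrDl mul1r lerD.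
Qed.

(** * Complex differentiability *)

(** The derivative as a bound on the increment, with real radii and errors:
    the point itself needs no exception, and the order of the complex numbers
    does not appear. *)
Definition cderiv_at (R : realType) (f : R[i] -> R[i]) (z d : R[i]) :=
  forall e, 0 < e -> exists2 r, 0 < r & forall w, cabs (w - z) < r ->
    cabs (f w - f z - d * (w - z)) <= e * cabs (w - z).

Definition cdiff (R : realType) (f : R[i] -> R[i]) (z : R[i]) :=
  exists d, cderiv_at f z d.

Lemma cderiv_at_eq (R : realType) (f : R[i] -> R[i]) (z d d' : R[i]) :
  cderiv_at f z d -> d = d' -> cderiv_at f z d'.
Proof. by move=> ? <-. Qed.

Lemma cderiv_near (R : realType) (f g : R[i] -> R[i]) (z d : R[i]) r :
  0 < r -> (forall w, cabs (w - z) < r -> f w = g w) ->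
  cderiv_at f z d -> cderiv_at g z d.
Proof.
move=> r0 fg Hf e e0; have [s s0 Hs] := Hf e e0.
exists (Num.min r s); first by rewrite lt_min r0.
move=> w; rewrite lt_min => /andP[wr ws].
by rewrite -!fg ?Hs// subrr cabs0.
Qed.

Lemma cdiff_near (R : realType) (f g : R[i] -> R[i]) (z : R[i]) r :
  0 < r -> (forall w, cabs (w - z) < r -> f w = g w) -> cdiff f z -> cdiff g z.
Proof. by move=> r0 fg [d Hd]; exists d; exact: (cderiv_near r0 fg Hd). Qed.

Lemma cderiv_cst (R : realType) (c z : R[i]) : cderiv_at (fun=> c) z 0.
Proof.
by move=> e e0; exists 1 => // w _; rewrite subrr mul0r subrr cabs0 mulr_ge0 ?cabs_ge0// ltW.
Qed.

Lemma cderiv_id (R : realType) (z : R[i]) : cderiv_at id z 1.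
Proof.
by move=> e e0; exists 1 => // w _; rewrite mul1r subrr cabs0 mulr_ge0 ?cabs_ge0// ltW.
Qed.

Lemma cderivD (R : realType) (f g : R[i] -> R[i]) (z c d : R[i]) :
  cderiv_at f z c -> cderiv_at g z d -> cderiv_at (fun w => f w + g w) z (c + d).
Proof.
move=> Hf Hg e e0; have e2 : 0 < e / 2 by lra.
have [r r0 Hr] := Hf _ e2; have [s s0 Hs] := Hg _ e2.
exists (Num.min r s); first by rewrite lt_min r0.
move=> w; rewrite lt_min => /andP[/Hr{}Hr /Hs{}Hs].
have -> : f w + g w - (f z + g z) - (c + d) * (w - z) =
  (f w - f z - c * (w - z)) + (g w - g z - d * (w - z)) by ring.
by have := cabsD (f w - f z - c * (w - z)) (g w - g z - d * (w - z)); lra.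
Qed.

Lemma cderiv_lip (R : realType) (f : R[i] -> R[i]) (z c : R[i]) :
  cderiv_at f z c -> exists2 r, 0 < r & forall w, cabs (w - z) < r ->
    cabs (f w - f z) <= (cabs c + 1) * cabs (w - z).
Proof.
move=> /(_ 1 ltr01)[r r0 Hr]; exists r => // w /Hr.
have := cabsD (f w - f z - c * (w - z)) (c * (w - z)).
by rewrite subrK cabsM; lra.
Qed.

Lemma cdiff_cont (R : realType) (f : R[i] -> R[i]) (z : R[i]) :
  cdiff f z -> forall e, 0 < e -> exists2 r, 0 < r &
    forall w, cabs (w - z) < r -> cabs (f w - f z) < e.
Proof.
move=> [c /cderiv_lip[r r0 Hr]] e e0.
have c1 : 0 < cabs c + 1 by rewrite ltr_wpDl ?cabs_ge0.
exists (Num.min r (e / (cabs c + 1))); first by rewrite lt_min r0 divr_gt0.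
move=> w; rewrite lt_min ltr_pdivlMr// mulrC => /andP[/Hr]; exact: le_lt_trans.
Qed.

Lemma cderiv_comp (R : realType) (f g : R[i] -> R[i]) (z c d : R[i]) :
  cderiv_at f z c -> cderiv_at g (f z) d ->
  cderiv_at (fun w => g (f w)) z (d * c).
Proof.
move=> Hf Hg e e0.
have c1 : 0 < cabs c + 1 by rewrite ltr_wpDl ?cabs_ge0.
have d1 : 0 < cabs d + 1 by rewrite ltr_wpDl ?cabs_ge0.
have [r1 r10 H1] := cderiv_lip Hf.
have [r2 r20 H2] := Hf (e / 2 / (cabs d + 1)) ltac:(by rewrite !divr_gt0).
have [r3 r30 H3] := Hg (e / 2 / (cabs c + 1)) ltac:(by rewrite !divr_gt0).
have [r4 r40 H4] := cdiff_cont (ex_intro _ c Hf) r30.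
exists (Num.min (Num.min r1 r2) r4); first by rewrite !lt_min r10 r20.
move=> w; rewrite !lt_min => /andP[/andP[/H1{}H1 /H2{}H2] /H4/H3{}H3].
have -> : g (f w) - g (f z) - d * c * (w - z) =
  (g (f w) - g (f z) - d * (f w - f z)) + d * (f w - f z - c * (w - z)) by ring.
apply: le_trans (cabsD _ _) _; rewrite cabsM.
set A := cabs (w - z) in H1 H2 *.
have A0 : 0 <= A by exact: cabs_ge0.
apply: (@le_trans _ _ (e / 2 * A + e / 2 * A)); last by lra.
apply: lerD.
  apply: le_trans H3 _; rewrite mulrAC ler_pdivrMr//.
  by rewrite -[leRHS]mulrA; apply: ler_wpM2l; [lra | rewrite mulrC].
rewrite mulrAC ler_pdivlMr// in H2; apply: le_trans H2.
by rewrite mulrC ler_wpM2l ?cabs_ge0// lerDl.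
Qed.

Lemma cderivM (R : realType) (f g : R[i] -> R[i]) (z c d : R[i]) :
  cderiv_at f z c -> cderiv_at g z d ->
  cderiv_at (fun w => f w * g w) z (c * g z + f z * d).
Proof.
move=> Hf Hg e e0.
have c1 : 0 < cabs c + 1 by rewrite ltr_wpDl ?cabs_ge0.
have f1 : 0 < cabs (f z) + 1 by rewrite ltr_wpDl ?cabs_ge0.
have g1 : 0 < cabs (g z) + 1 by rewrite ltr_wpDl ?cabs_ge0.
have [r1 r10 H1] := cderiv_lip Hf.
have [r2 r20 H2] := Hf (e / 3 / (cabs (g z) + 1)) ltac:(by rewrite !divr_gt0).
have [r3 r30 H3] := Hg (e / 3 / (cabs (f z) + 1)) ltac:(by rewrite !divr_gt0).
have [r4 r40 H4] := @cdiff_cont _ _ _ (ex_intro _ d Hg) (e / 3 / (cabs c + 1))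
  ltac:(by rewrite !divr_gt0).
exists (Num.min (Num.min r1 r2) (Num.min r3 r4)).
  by rewrite !lt_min r10 r20 r30.
move=> w; rewrite !lt_min.
move=> /andP[/andP[/H1{}H1 /H2{}H2] /andP[/H3{}H3 /H4{}H4]].
have -> : f w * g w - f z * g z - (c * g z + f z * d) * (w - z) =
  (f w - f z) * (g w - g z) + (g z * (f w - f z - c * (w - z)) +
   f z * (g w - g z - d * (w - z))) by ring.
set A := cabs (w - z) in H1 H2 H3 *.
have A0 : 0 <= A by exact: cabs_ge0.
apply: (@le_trans _ _ (e / 3 * A + (e / 3 * A + e / 3 * A))); last by lra.
apply: le_trans (cabsD _ _) _; apply: lerD.
  rewrite cabsM; apply: (@le_trans _ _ ((cabs c + 1) * A * (e / 3 / (cabs c + 1)))).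
    by rewrite ler_pM ?cabs_ge0// ltW.
  by rewrite le_eqVlt; apply/orP; left; apply/eqP; field; lra.
apply: le_trans (cabsD _ _) _; rewrite !cabsM; apply: lerD.
  rewrite mulrAC ler_pdivlMr// in H2; apply: le_trans H2.
  by rewrite mulrC ler_wpM2l ?cabs_ge0// lerDl.
rewrite mulrAC ler_pdivlMr// in H3; apply: le_trans H3.
by rewrite mulrC ler_wpM2l ?cabs_ge0// lerDl.
Qed.

Lemma cderivV (R : realType) (z : R[i]) : z != 0 ->
  cderiv_at (fun w => w^-1) z (- z^-2).
Proof.
move=> z0 e e0; have Nz : 0 < cabs z by rewrite cabs_gt0.
exists (Num.min (cabs z / 2) (e * cabs z ^+ 3 / 2)).
  by rewrite lt_min !divr_gt0// mulr_gt0// exprn_gt0.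
move=> w; rewrite lt_min => /andP[w1 w2].
have Nw : cabs z / 2 <= cabs w.
  by have := cabs_tri w z 0; rewrite !subr0 cabsC; lra.
have w0 : w != 0 by rewrite -cabs_gt0; lra.
have -> : w^-1 - z^-1 - - z^-2 * (w - z) = (w - z) * ((w - z) / (w * z ^+ 2)).
  by field; rewrite z0 w0.
rewrite [leRHS]mulrC cabsM ler_wpM2l ?cabs_ge0// cabsM cabsV cabsM cabsX.
rewrite ler_pdivrMr ?mulr_gt0 ?exprn_gt0 ?cabs_gt0//.
apply: ltW; apply: lt_le_trans w2 _.
by rewrite -mulrA ler_wpM2l ?(ltW e0)// exprS mulrAC ler_wpM2r// exprn_ge0 ?cabs_ge0.
Qed.

Lemma cderivN (R : realType) (f : R[i] -> R[i]) (z c : R[i]) :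
  cderiv_at f z c -> cderiv_at (fun w => - f w) z (- c).
Proof.
move=> Hf e e0; have [r r0 Hr] := Hf e e0; exists r => // w /Hr.
have -> : - f w - - f z - - c * (w - z) = - (f w - f z - c * (w - z)) by ring.
by rewrite cabsN.
Qed.

Lemma cdiff_cst (R : realType) (c z : R[i]) : cdiff (fun=> c) z.
Proof. by exists 0; exact: cderiv_cst. Qed.

Lemma cdiff_id (R : realType) (z : R[i]) : cdiff id z.
Proof. by exists 1; exact: cderiv_id. Qed.

Lemma cdiffD (R : realType) (f g : R[i] -> R[i]) (z : R[i]) :
  cdiff f z -> cdiff g z -> cdiff (fun w => f w + g w) z.
Proof. by move=> [c Hc] [d Hd]; exists (c + d); exact: cderivD. Qed.

Lemma cdiffN (R : realType) (f : R[i] -> R[i]) (z : R[i]) :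
  cdiff f z -> cdiff (fun w => - f w) z.
Proof. by move=> [c Hc]; exists (- c); exact: cderivN. Qed.

Lemma cdiffB (R : realType) (f g : R[i] -> R[i]) (z : R[i]) :
  cdiff f z -> cdiff g z -> cdiff (fun w => f w - g w) z.
Proof. by move=> Hf Hg; apply: cdiffD => //; exact: cdiffN. Qed.

Lemma cdiffM (R : realType) (f g : R[i] -> R[i]) (z : R[i]) :
  cdiff f z -> cdiff g z -> cdiff (fun w => f w * g w) z.
Proof. by move=> [c Hc] [d Hd]; exists (c * g z + f z * d); exact: cderivM. Qed.

Lemma cdiff_comp (R : realType) (f g : R[i] -> R[i]) (z : R[i]) :
  cdiff f z -> cdiff g (f z) -> cdiff (fun w => g (f w)) z.
Proof. by move=> [c Hc] [d Hd]; exists (d * c); exact: cderiv_comp. Qed.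

Lemma cdiffV (R : realType) (z : R[i]) : z != 0 -> cdiff (fun w => w^-1) z.
Proof. by move=> z0; exists (- z^-2); exact: cderivV. Qed.

(** * Goursat's theorem for dyadic midpoint sums *)

(** The [n]-th dyadic midpoint sum for the integral of [f] along the segment
    from [a] to [b]. These sums are reversed exactly when the segment is, and
    are exact on affine functions, so that Goursat's argument applies to them
    without any theory of integration. *)
Fixpoint midsum (R : realType) (f : R[i] -> R[i]) (n : nat) (a b : R[i]) :=
  if n is n'.+1 then midsum f n' a ((a + b) / 2) + midsum f n' ((a + b) / 2) b
  else f ((a + b) / 2) * (b - a).

Lemma midsum_rev (R : realType) (f : R[i] -> R[i]) n (a b : R[i]) :
  midsum f n b a = - midsum f n a b.
Proof.
elim: n a b => [|n IH] a b /=; first by rewrite (addrC b) -mulrN opprB.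
by rewrite (addrC b) (IH _ b) (IH a); ring.
Qed.

Lemma midsumS (R : realType) (f : R[i] -> R[i]) n (a b : R[i]) :
  midsum f n.+1 a b =
  midsum f n a ((a + b) / 2) + midsum f n ((a + b) / 2) b.
Proof. by []. Qed.

Lemma midsum_affine (R : realType) (p q : R[i]) n (a b : R[i]) :
  midsum (fun z => p * z + q) n a b = p * (b ^+ 2 - a ^+ 2) / 2 + q * (b - a).
Proof. by elim: n a b => [|n IH] a b /=; rewrite ?IH; field. Qed.

Lemma midsumB (R : realType) (f g : R[i] -> R[i]) n (a b : R[i]) :
  midsum (fun z => f z - g z) n a b = midsum f n a b - midsum g n a b.
Proof.
elim: n a b => [|n IH] a b /=; first by rewrite mulrBl.
by rewrite !IH; ring.
Qed.

Definition midconvex (R : realType) (K : set R[i]) :=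
  forall a b, K a -> K b -> K ((a + b) / 2).

Lemma cabs_half (R : realType) (z : R[i]) : cabs (z / 2) = cabs z / 2.
Proof.
rewrite cabsM cabsV; congr (_ / _).
by have -> : (2 : R[i]) = (2 : R)%:C; rewrite ?cabs_real ?ger0_norm// rmorph_nat.
Qed.

Lemma midsum_bound (R : realType) (f : R[i] -> R[i]) (K : set R[i]) (M : R) n
    (a b : R[i]) :
  midconvex K -> (forall z, K z -> cabs (f z) <= M) -> K a -> K b ->
  cabs (midsum f n a b) <= M * cabs (b - a).
Proof.
move=> cK fM; elim: n a b => [|n IH] a b Ka Kb /=.
  by rewrite cabsM ler_wpM2r ?cabs_ge0// fM//; exact: cK.
apply: le_trans (cabsD _ _) _.
have := IH a _ Ka (cK _ _ Ka Kb); have := IH _ b (cK _ _ Ka Kb) Kb.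
have -> : b - (a + b) / 2 = (b - a) / 2 by field.
have -> : (a + b) / 2 - a = (b - a) / 2 by field.
by rewrite cabs_half; lra.
Qed.

Definition triangle_sum (R : realType) (f : R[i] -> R[i]) n (a b c : R[i]) :=
  midsum f n a b + midsum f n b c + midsum f n c a.

Definition perimeter (R : realType) (a b c : R[i]) :=
  cabs (b - a) + cabs (c - b) + cabs (a - c).

Lemma triangle_sumS (R : realType) (f : R[i] -> R[i]) n (a b c : R[i]) :
  let u := (a + b) / 2 in let v := (b + c) / 2 in let w := (c + a) / 2 in
  triangle_sum f n.+1 a b c = triangle_sum f n a u w + triangle_sum f n b v u +
    triangle_sum f n c w v + triangle_sum f n u v w.
Proof.
move=> u v w; rewrite /triangle_sum !midsumS -/u -/v -/w.
by rewrite (midsum_rev f n u w) (midsum_rev f n v u) (midsum_rev f n w v); ring.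
Qed.

(** The sum vanishes on the affine part of [f], and the rest is small compared
    with the distance to [z]. *)
Lemma triangle_sum_cdiff (R : realType) (f : R[i] -> R[i]) (z e : R[i]) (eps : R) :
  cdiff f z -> 0 < eps -> exists2 r, 0 < r & forall a b c n,
    cabs (a - z) + perimeter a b c < r ->
    cabs (triangle_sum f n a b c) <=
      eps * (cabs (a - z) + perimeter a b c) * perimeter a b c.
Proof.
move=> [d Hd] e0; have [r r0 Hr] := Hd _ e0; exists r => // a b c n.
set s := cabs (a - z) + perimeter a b c => sr.
pose g w := f w - (d * w + (f z - d * z)).
pose K := [set w | cabs (w - z) <= s].
have cK : midconvex K.
  move=> u v; rewrite /K /= => Ku Kv.
  have -> : (u + v) / 2 - z = (u - z) / 2 + (v - z) / 2 by field.
  by apply: le_trans (cabsD _ _) _; rewrite !cabs_half; lra.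
have gK w : K w -> cabs (g w) <= eps * s.
  rewrite /K /= => Kw; rewrite /g.
  have -> : f w - (d * w + (f z - d * z)) = f w - f z - d * (w - z) by ring.
  apply: le_trans (Hr w _) _; first exact: le_lt_trans sr.
  by rewrite ler_wpM2l// ltW.
have per0 : 0 <= perimeter a b c by rewrite !addr_ge0 ?cabs_ge0.
have Ka : K a by rewrite /K /= lerDl.
have Kb : K b.
  rewrite /K /= (le_trans (cabs_tri a _ _))// addrC lerD2l /perimeter -addrA.
  by rewrite lerDl addr_ge0 ?cabs_ge0.
have Kc : K c.
  rewrite /K /= (le_trans (cabs_tri a _ _))// addrC lerD2l /perimeter cabsC.
  by rewrite lerDr addr_ge0 ?cabs_ge0.
have -> : triangle_sum f n a b c = triangle_sum g n a b c.
  by rewrite /triangle_sum /g !midsumB !midsum_affine; ring.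
clearbody s; rewrite /perimeter !mulrDr; apply: le_trans (cabsD _ _) _; apply: lerD.
  apply: le_trans (cabsD _ _) _.
  apply: lerD; first exact: (midsum_bound n cK gK Ka Kb).
  exact: (midsum_bound n cK gK Kb Kc).
exact: (midsum_bound n cK gK Kc Ka).
Qed.

(** Bisect: if the sums around a triangle stay above [eps] infinitely often,
    then so do, with [eps / 4], those around one of its four halves; the
    triangles shrink to a point where [f] is differentiable, and there the sum
    is of smaller order than the square of the perimeter. Only the limit
    superior of the sums is compared, so that they need not converge. *)
Lemma goursat (R : realType) (f : R[i] -> R[i]) (K : set R[i]) (a b c : R[i])
    (eps : R) :
  midconvex K ->
  (forall z, (forall e, 0 < e -> exists2 w, K w & cabs (w - z) < e) -> K z) ->
  (forall z, K z -> cdiff f z) -> K a -> K b -> K c -> 0 < eps ->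
  exists n0, forall n, (n0 <= n)%N -> cabs (triangle_sum f n a b c) <= eps.
Proof.
move=> cK clK fK Ka Kb Kc eps0; apply: contrapT => noN.
pose bad (e : R) (t : R[i] * R[i] * R[i]) :=
  forall n0, exists2 n, (n0 <= n)%N & e < cabs (triangle_sum f n t.1.1 t.1.2 t.2).
pose in3 (t : R[i] * R[i] * R[i]) := [/\ K t.1.1, K t.1.2 & K t.2].
pose per (t : R[i] * R[i] * R[i]) := perimeter t.1.1 t.1.2 t.2.
have not_bad e t : ~ bad e t -> exists n0, forall n, (n0 <= n)%N ->
    cabs (triangle_sum f n t.1.1 t.1.2 t.2) <= e.
  move=> /existsNP[n0 Hn0]; exists n0 => n n0n; rewrite leNgt; apply/negP => ?.
  by apply: Hn0; exists n.
have bad0 : bad eps (a, b, c).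
  by apply: contrapT => /not_bad.
have step (et : R * (R[i] * R[i] * R[i])) : exists t', in3 et.2 -> bad et.1 et.2 ->
    [/\ in3 t', bad (et.1 / 4) t', per t' = per et.2 / 2 &
        cabs (t'.1.1 - et.2.1.1) <= per et.2].
  case: et => [e [[x y] z]] /=.
  have [[[Kx Ky Kz] bxyz]|H] := pselect (in3 (x, y, z) /\ bad e (x, y, z));
    last by exists (x, y, z) => ? ?; exfalso; exact: H.
  set u := (x + y) / 2; set v := (y + z) / 2; set w := (z + x) / 2.
  have [Ku Kv Kw] : [/\ K u, K v & K w] by split; exact: cK.
  suff [t' [H1 H2 H3 H4]] : exists t', [/\ in3 t', bad (e / 4) t',
     per t' = per (x, y, z) / 2 & cabs (t'.1.1 - x) <= per (x, y, z)].
    by exists t' => _ _; split.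
  have P0 : [/\ 0 <= cabs (y - x), 0 <= cabs (z - y) & 0 <= cabs (x - z)].
    by rewrite !cabs_ge0.
  have Eux : u - x = (y - x) / 2 by rewrite /u; field.
  have Ewu : w - u = (z - y) / 2 by rewrite /w /u; field.
  have Exw : x - w = (x - z) / 2 by rewrite /w; field.
  have Evy : v - y = (z - y) / 2 by rewrite /v; field.
  have Euv : u - v = (x - z) / 2 by rewrite /v /u; field.
  have Eyu : y - u = (y - x) / 2 by rewrite /u; field.
  have Ewz : w - z = (x - z) / 2 by rewrite /w; field.
  have Evw : v - w = (y - x) / 2 by rewrite /w /v; field.
  have Ezv : z - v = (z - y) / 2 by rewrite /v; field.
  have [B1|/not_bad[n1 /= N1]] := pselect (bad (e / 4) (x, u, w)).
    exists (x, u, w); split => //=.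
      by rewrite /per /perimeter /= Eux Ewu Exw !cabs_half; lra.
    by rewrite subrr cabs0 /per /perimeter !addr_ge0 ?cabs_ge0.
  have [B2|/not_bad[n2 /= N2]] := pselect (bad (e / 4) (y, v, u)).
    exists (y, v, u); split => //=.
      by rewrite /per /perimeter /= Evy Euv Eyu !cabs_half; lra.
    by rewrite /per /perimeter /=; case: P0; lra.
  have [B3|/not_bad[n3 /= N3]] := pselect (bad (e / 4) (z, w, v)).
    exists (z, w, v); split => //=.
      by rewrite /per /perimeter /= Ewz Evw Ezv !cabs_half; lra.
    by rewrite cabsC /per /perimeter /=; case: P0; lra.
  have [B4|/not_bad[n4 /= N4]] := pselect (bad (e / 4) (u, v, w)).
    exists (u, v, w); split => //=.
      rewrite /per /perimeter /= [cabs (v - u)]cabsC [cabs (w - v)]cabsC.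
      rewrite [cabs (u - w)]cabsC Ewu Evw Euv !cabs_half; lra.
    by rewrite Eux cabs_half /per /perimeter /=; case: P0; lra.
  exfalso.
  have [[//|n] nn /=] := bxyz (maxn (maxn n1 n2) (maxn n3 n4)).+1.
  rewrite ltnS !geq_max in nn; case/andP: nn => /andP[l1 l2] /andP[l3 l4].
  rewrite triangle_sumS -/u -/v -/w; apply/negP; rewrite -leNgt.
  have := cabsD (triangle_sum f n x u w + triangle_sum f n y v u + triangle_sum f n z w v)
    (triangle_sum f n u v w).
  have := cabsD (triangle_sum f n x u w + triangle_sum f n y v u) (triangle_sum f n z w v).
  have := cabsD (triangle_sum f n x u w) (triangle_sum f n y v u).
  move: (N1 n l1) (N2 n l2) (N3 n l3) (N4 n l4); lra.
have [next Hnext] := choice step.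
pose T := fix T k : R[i] * R[i] * R[i] :=
  if k is k'.+1 then next (eps / 4 ^+ k', T k') else (a, b, c).
have HT k : [/\ in3 (T k), bad (eps / 4 ^+ k) (T k) &
    per (T k) = per (a, b, c) * 2^-1 ^+ k].
  elim: k => [|k [I B P]]; first by rewrite !expr0 divr1 mulr1.
  have [] := Hnext (eps / 4 ^+ k, T k) I B; rewrite -/(T k.+1) /= => I' B' P' _.
  split => //; first by rewrite exprSr invfM mulrA.
  by rewrite P' P exprSr mulrA.
have Tstep k : cabs ((T k.+1).1.1 - (T k).1.1) <= per (a, b, c) * 2^-1 ^+ k.
  have [I B P] := HT k.
  by have [_ _ _] := Hnext (eps / 4 ^+ k, T k) I B; rewrite /= P.
have h01 : 0 <= (2^-1 : R) < 1 by lra.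
have [z Hz] := geometric_limit h01 Tstep.
have per0 : 0 <= per (a, b, c) by rewrite !addr_ge0 ?cabs_ge0.
set p := per (a, b, c) in Hz per0 HT.
have Hz4 k : cabs ((T k).1.1 - z) <= 4 * p * 2^-1 ^+ k.
  apply: le_trans (Hz k) _; rewrite le_eqVlt; apply/orP; left; apply/eqP.
  by field.
have p1 : 0 < 5 * p + 1 by lra.
have Kz : K z.
  apply: clK => e e0.
  have [n Hn] := @exp_small _ 2^-1 (e / (5 * p + 1)) h01 ltac:(by rewrite divr_gt0).
  exists (T n).1.1; first by have [[]] := HT n.
  rewrite ltr_pdivlMr// in Hn; apply: le_lt_trans (Hz4 n) _.
  apply: le_lt_trans Hn; rewrite mulrC ler_wpM2l ?exprn_ge0//; lra.
(* The [k]-th triangle lies within [5 * p * 2^-1 ^+ k] of [z], and its perimeter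
   is [p * 2^-1 ^+ k]; the sum must stay below [eps / 4 ^+ k]. *)
pose eta := eps / (5 * (p + 1) ^+ 2).
have eta0 : 0 < eta by rewrite divr_gt0// mulr_gt0// exprn_gt0//; lra.
have [r r0 Hr] := triangle_sum_cdiff z (fK z Kz) eta0.
have [k Hk] := @exp_small _ 2^-1 (r / (5 * p + 1)) h01 ltac:(by rewrite divr_gt0).
have [_ B P] := HT k; have [n _] := B 0%N; apply/negP; rewrite -leNgt.
set q := 2^-1 ^+ k in Hk P.
have q0 : 0 <= q by rewrite exprn_ge0.
have S5 : cabs ((T k).1.1 - z) + per (T k) <= 5 * p * q.
  by rewrite P; have := Hz4 k; rewrite -/q; lra.
have Sr : cabs ((T k).1.1 - z) + per (T k) < r.
  apply: le_lt_trans S5 _; rewrite ltr_pdivlMr// in Hk; apply: le_lt_trans Hk.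
  by rewrite mulrC ler_wpM2l//; lra.
apply: le_trans (Hr _ _ _ n Sr) _; rewrite -/(per (T k)) P.
have -> : eps / 4 ^+ k = eta * (5 * (p + 1) ^+ 2) * (q * q).
  rewrite /eta divfK; last by rewrite mulf_neq0// expf_neq0//; lra.
  congr (_ * _); rewrite /q -exprMn -exprVn; by congr (_ ^+ _); field.
clearbody eta; rewrite -!mulrA ler_wpM2l ?(ltW eta0)//.
apply: (@le_trans _ _ (5 * p * q * (p * q))).
  rewrite ler_wpM2r ?mulr_ge0//; by move: S5; rewrite P.
nra.
Qed.

(** * Cauchy estimates and unique continuation *)

Lemma midsumZ (R : realType) (f : R[i] -> R[i]) (c : R[i]) n (a b : R[i]) :
  midsum (fun z => c * f z) n a b = c * midsum f n a b.
Proof. by elim: n a b => [|n IH] a b /=; rewrite ?IH; ring. Qed.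

Lemma mulii (R : realType) : 'i%C * 'i%C = -1 :> R[i].
Proof. by rewrite -expr2 sqr_i. Qed.

Lemma midsum_rot (R : realType) (f : R[i] -> R[i]) n (a b : R[i]) :
  (forall z, f ('i%C * z) * 'i%C = f z) ->
  midsum f n ('i%C * a) ('i%C * b) = midsum f n a b.
Proof.
move=> fi; elim: n a b => [|n IH] a b /=.
  have -> : ('i%C * a + 'i%C * b) / 2 = 'i%C * ((a + b) / 2) by rewrite -mulrDr mulrA.
  by rewrite -mulrBr -[f ((a + b) / 2)]fi -[RHS]mulrA.
have -> : ('i%C * a + 'i%C * b) / 2 = 'i%C * ((a + b) / 2) by rewrite -mulrDr mulrA.
by rewrite !IH.
Qed.

Lemma Re_half (R : realType) (z : R[i]) : Re (z / 2) = Re z / 2.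
Proof.
have -> : z / 2 = (2^-1 : R)%:C * z by rewrite rmorphV ?unitfE//= rmorph_nat mulrC.
by case: z => x y /=; rewrite mul0r subr0 mulrC.
Qed.

Lemma Im_half (R : realType) (z : R[i]) : Im (z / 2) = Im z / 2.
Proof.
have -> : z / 2 = (2^-1 : R)%:C * z by rewrite rmorphV ?unitfE//= rmorph_nat mulrC.
by case: z => x y /=; rewrite mul0r addr0 mulrC.
Qed.

(** The integral of [1 / z] along a vertical segment has a sizeable imaginary
    part: this is the part of the index of a square about [0] contributed by
    its right side. *)
Lemma midsum_inv_Im (R : realType) (r : R) n (s t : R) : 0 < r ->
  - r <= s -> s <= t -> t <= r ->
  (t - s) / (2 * r) <= Im (midsum (fun z => z^-1) n (r +i* s) (r +i* t)).
Proof.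
move=> r0; elim: n s t => [|n IH] s t rs st tr.
  rewrite /midsum.
  have -> : (r +i* t) - (r +i* s) = 0 +i* (t - s).
    by apply/eqP; rewrite eq_complex /= subrr !eqxx.
  have -> : ((r +i* s) + (r +i* t)) / 2 = r +i* ((s + t) / 2).
    apply/eqP; rewrite eq_complex Re_half Im_half /= eqxx andbT.
    by apply/eqP; field.
  set u := (s + t) / 2.
  have ur : u ^+ 2 <= r ^+ 2.
    by rewrite -ler_sqrt ?sqr_ge0// !sqrtr_sqr (gtr0_norm r0) ler_norml /u; lra.
  have d0 : 0 < r ^+ 2 + u ^+ 2 by rewrite ltr_wpDr ?sqr_ge0// exprn_gt0.
  rewrite /= mulr0 addr0 ler_pdivrMr; last by lra.
  have -> : r / (r ^+ 2 + u ^+ 2) * (t - s) * (2 * r) =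
    (t - s) * ((2 * r ^+ 2) / (r ^+ 2 + u ^+ 2)) by field; lra.
  rewrite ler_peMr//; first by lra.
  by rewrite ler_pdivlMr//; lra.
rewrite midsumS.
have -> : ((r +i* s) + (r +i* t)) / 2 = r +i* ((s + t) / 2).
  apply/eqP; rewrite eq_complex Re_half Im_half /= eqxx andbT.
  by apply/eqP; field.
rewrite raddfD /=.
have := IH s ((s + t) / 2) rs ltac:(lra) ltac:(lra).
have := IH ((s + t) / 2) t ltac:(lra) ltac:(lra) tr.
set A := Im _; set B := Im _ => hA hB.
have -> : (t - s) / (2 * r) = ((s + t) / 2 - s) / (2 * r) + (t - (s + t) / 2) / (2 * r).
  by field; lra.
lra.
Qed.

(** For a function with the symmetry of the square, the four sides of a square
    contribute equally and the parts of the diagonals cancel in pairs: hence the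
    right sides alone carry Cauchy's argument, and Goursat's theorem shows that
    the integral of [S z / z] does not change as the square shrinks to [0]. *)
Lemma midsum_shrink (R : realType) (S : R[i] -> R[i]) (t eps : R) :
  (forall z, S ('i%C * z) = S z) -> 0 < t ->
  (forall z, 0 < Re z -> Re z <= t -> `|Im z| <= t -> cdiff S z) -> 0 < eps ->
  exists n0, forall n, (n0 <= n)%N ->
    cabs (midsum (fun z => S z / z) n (t -i* t) (t +i* t) -
          midsum (fun z => S z / z) n ((t / 2) -i* (t / 2)) ((t / 2) +i* (t / 2)))
    <= eps.
Proof.
move=> Si t0 Sd eps0.
pose g z := S z / z.
pose K := [set z : R[i] | [/\ t / 2 <= Re z, Re z <= t, - t <= Im z & Im z <= t]].
have cK : midconvex K.
  move=> a b [a1 a2 a3 a4] [b1 b2 b3 b4]; rewrite /K /= Re_half Im_half !raddfD.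
  by split; lra.
have clK z : (forall e, 0 < e -> exists2 w, K w & cabs (w - z) < e) -> K z.
  move=> H; have hyp (x y : R) : (forall e, 0 < e -> x <= y + e) -> x <= y.
    by move=> ?; apply/ler_addgt0Pr.
  have H' e : 0 < e -> exists2 w, K w & `|Re w - Re z| <= e /\ `|Im w - Im z| <= e.
    move=> e0; have [w Kw we] := H e e0; exists w => //.
    have := Re_le_cabs (w - z); have := Im_le_cabs (w - z).
    by rewrite !raddfB /=; split; lra.
  by split; apply: hyp => e /H'[w [k1 k2 k3 k4]]; rewrite !ler_norml; lra.
have gK z : K z -> cdiff g z.
  move=> [k1 k2 k3 k4]; have z0 : z != 0.
    by apply/eqP => E; move: k1; rewrite E /=; lra.
  apply: cdiffM; last exact: cdiffV.
  by apply: Sd; rewrite ?ler_norml; lra.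
have gi z : g ('i%C * z) * 'i%C = g z.
  rewrite /g Si invfM [_^-1 * _]mulrC mulrA divfK//.
  by rewrite -cabs_gt0 cabsi.
have e2 : 0 < eps / 2 by lra.
have K1 : K (t -i* t) by split => /=; lra.
have K2 : K (t +i* t) by split => /=; lra.
have K3 : K ((t / 2) +i* (t / 2)) by split => /=; lra.
have K4 : K ((t / 2) -i* (t / 2)) by split => /=; lra.
have [n1 N1] := goursat cK clK gK K1 K2 K3 e2.
have [n2 N2] := goursat cK clK gK K1 K3 K4 e2.
exists (maxn n1 n2) => n; rewrite geq_max => /andP[/N1{}N1 /N2{}N2].
suff E : midsum g n (t -i* t) (t +i* t) -
   midsum g n ((t / 2) -i* (t / 2)) ((t / 2) +i* (t / 2)) =
   triangle_sum g n (t -i* t) (t +i* t) ((t / 2) +i* (t / 2)) +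
   triangle_sum g n (t -i* t) ((t / 2) +i* (t / 2)) ((t / 2) -i* (t / 2)).
  by rewrite E; apply: le_trans (cabsD _ _) _; lra.
have R1 : t +i* t = 'i%C * (t -i* t).
  by apply/eqP; rewrite eq_complex /=; apply/andP; split; apply/eqP; ring.
have R2 : (t / 2) +i* (t / 2) = 'i%C * ((t / 2) -i* (t / 2)).
  by apply/eqP; rewrite eq_complex /=; apply/andP; split; apply/eqP; ring.
have E : midsum g n ((t / 2) +i* (t / 2)) (t +i* t) =
    midsum g n ((t / 2) -i* (t / 2)) (t -i* t).
  by rewrite [in LHS]R1 [in LHS]R2 midsum_rot.
rewrite /triangle_sum.
rewrite (midsum_rev g n ((t / 2) +i* (t / 2)) (t +i* t)) E.
rewrite (midsum_rev g n ((t / 2) +i* (t / 2)) ((t / 2) -i* (t / 2))).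
rewrite (midsum_rev g n (t -i* t) ((t / 2) +i* (t / 2))).
by ring.
Qed.

(** On a small square [S] is almost constant, so that the sums of [S z / z] are
    close to [S 0] times the index of the square; on the large one they are
    bounded by the maximum of [S]. *)
Lemma cauchy_symmetric (R : realType) (S : R[i] -> R[i]) (r M : R) :
  (forall z, S ('i%C * z) = S z) -> 0 < r ->
  (forall z, 0 < Re z -> Re z <= r -> `|Im z| <= r -> cdiff S z) ->
  (forall e, 0 < e -> exists2 d, 0 < d &
    forall w, cabs w < d -> cabs (S w - S 0) <= e) ->
  (forall z, Re z = r -> `|Im z| <= r -> cabs (S z) <= M) ->
  cabs (S 0) <= 2 * M.
Proof.
move=> Si r0 Sd Sc SM.
pose A n t := midsum (fun z => S z / z) n (t -i* t) (t +i* t).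
have side_convex (t : R) : midconvex [set z : R[i] | Re z = t /\ `|Im z| <= t].
  move=> a b /= [a1 a2] [b1 b2]; rewrite Re_half Im_half !raddfD /=.
  by split; [lra | move: a2 b2; rewrite !ler_norml; lra].
have sides (t : R) : 0 < t -> [set z : R[i] | Re z = t /\ `|Im z| <= t] (t -i* t) /\
    [set z : R[i] | Re z = t /\ `|Im z| <= t] (t +i* t).
  by move=> t0 /=; rewrite normrN ger0_norm// ltW.
have side_len (t : R) : 0 < t -> cabs ((t +i* t) - (t -i* t)) = 2 * t.
  move=> t0; have -> : (t +i* t) - (t -i* t) = 'i%C * (2 * t)%:C.
    apply/eqP; rewrite eq_complex /=; apply/andP; split; apply/eqP; ring.
  by rewrite cabsM cabsi mul1r cabs_real ger0_norm//; lra.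
have side_ge (t : R) z : 0 < t -> Re z = t -> t <= cabs z.
  by move=> t0 <-; exact: le_trans (ler_norm _) (Re_le_cabs _).
have AM n : cabs (A n r) <= 2 * M.
  have -> : 2 * M = M / r * (2 * r) by field; lra.
  rewrite -side_len//; have [s1 s2] := sides r r0.
  apply: (midsum_bound n (@side_convex r)) => // z /= [z1 z2].
  rewrite cabsM cabsV ler_pM ?invr_ge0 ?cabs_ge0 ?SM//.
  by rewrite lef_pV2 ?posrE ?side_ge//; apply: lt_le_trans (side_ge _ _ r0 z1).
have shrink m : forall e, 0 < e -> exists n0, forall n, (n0 <= n)%N ->
    cabs (A n r - A n (r / 2 ^+ m)) <= e.
  elim: m => [|m IH] e e0.
    by exists 0%N => n _; rewrite expr0 divr1 subrr cabs0 ltW.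
  have e2 : 0 < e / 2 by lra.
  have [n1 N1] := IH _ e2.
  have tr : r / 2 ^+ m <= r.
    by rewrite ler_pdivrMr ?exprn_gt0// ler_peMr ?exprn_ege1 ?ler1n// ltW.
  have [||n2 N2] := @midsum_shrink _ S (r / 2 ^+ m) (e / 2) Si _ _ e2.
  - by rewrite divr_gt0// exprn_gt0.
  - by move=> z z0 z1 z2; apply: Sd => //; apply: le_trans tr.
  exists (maxn n1 n2) => n; rewrite geq_max => /andP[/N1{}N1 /N2{}N2].
  have -> : r / 2 ^+ m.+1 = r / 2 ^+ m / 2 by rewrite exprSr invfM mulrA.
  by have := cabs_tri (A n (r / 2 ^+ m)) (A n r) (A n (r / 2 ^+ m / 2)); lra.
apply/ler_addgt0Pr => e e0; have e3 : 0 < e / 3 by lra.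
have [d d0 Hd] := Sc _ e3.
have [m Hm] := @exp_small _ 2^-1 (d / (3 * r)) ltac:(lra)
  ltac:(by rewrite divr_gt0// mulr_gt0).
have [n Hn] := shrink m _ e3.
have := Hn n (leqnn n); set t := r / 2 ^+ m => Hnt.
have t0 : 0 < t by rewrite divr_gt0// exprn_gt0.
have td : 3 * t < d.
  by move: Hm; rewrite ltr_pdivlMr ?mulr_gt0// /t exprVn; lra.
pose kappa := midsum (fun z : R[i] => z^-1) n (t -i* t) (t +i* t).
have Hk : 1 <= cabs kappa.
  apply: le_trans (Im_le_cabs _); apply: le_trans (ler_norm _).
  have := @midsum_inv_Im _ t n (- t) t t0 ltac:(lra) ltac:(lra) ltac:(lra).
  by apply: le_trans; rewrite ler_pdivlMr; lra.
have Hdiff : cabs (A n t - S 0 * kappa) <= 2 * (e / 3).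
  rewrite /A /kappa -midsumZ -midsumB.
  have -> : 2 * (e / 3) = e / 3 / t * (2 * t) by field; lra.
  rewrite -side_len//; have [s1 s2] := sides t t0.
  apply: (midsum_bound n (@side_convex t)) => // z /= [z1 z2].
  rewrite -mulrBl cabsM cabsV ler_pM ?invr_ge0 ?cabs_ge0//.
    apply: Hd; apply: le_lt_trans (cabs_le_ReIm _) _.
    by rewrite z1 ger0_norm; lra.
  by rewrite lef_pV2 ?posrE ?side_ge//; apply: lt_le_trans (side_ge _ _ t0 z1).
have : cabs (S 0) <= cabs (S 0 * kappa) by rewrite cabsM ler_peMr ?cabs_ge0.
have := cabs_tri (A n t) (S 0 * kappa) 0; rewrite !subr0 cabsC.
have := cabs_tri (A n r) (A n t) 0; rewrite !subr0 cabsC.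
by have := AM n; lra.
Qed.

(** Average [P] over the four rotations of the square. *)
Lemma cauchy_center (R : realType) (P : R[i] -> R[i]) (c : R[i]) (r M : R) :
  0 < r ->
  (forall z, z != c -> `|Re (z - c)| <= r -> `|Im (z - c)| <= r -> cdiff P z) ->
  (forall e, 0 < e -> exists2 d, 0 < d &
    forall w, cabs (w - c) < d -> cabs (P w - P c) <= e) ->
  (forall z, r <= cabs (z - c) -> `|Re (z - c)| <= r -> `|Im (z - c)| <= r ->
    cabs (P z) <= M) ->
  cabs (P c) <= 2 * M.
Proof.
move=> r0 Pd Pc PM.
pose S z := P (c + z) + P (c + 'i%C * z) + P (c - z) + P (c - 'i%C * z).
have ii z : 'i%C * ('i%C * z) = - z :> R[i] by rewrite mulrA mulii mulN1r.
have ri z : Re ('i%C * z) = - Im z by case: z => x y /=; rewrite mul0r mul1r add0r.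
have im z : Im ('i%C * z) = Re z by case: z => x y /=; rewrite mul0r mul1r add0r.
have cabsiM (z : R[i]) : cabs ('i%C * z) = cabs z by rewrite cabsM cabsi mul1r.
have NRe (z : R[i]) : Re (- z) = - Re z by rewrite raddfN.
have NIm (z : R[i]) : Im (- z) = - Im z by rewrite raddfN.
have E0 : S 0 = 4 * P c by rewrite /S mulr0 !subr0 addr0; ring.
have Si z : S ('i%C * z) = S z by rewrite /S ii opprK; ring.
have cadd z : (c + z) - c = z by rewrite addrC addKr.
suff : cabs (S 0) <= 2 * (4 * M).
  rewrite E0 cabsM; have -> : (4 : R[i]) = (4 : R)%:C by rewrite rmorph_nat.
  by rewrite cabs_real ger0_norm//; lra.
apply: (@cauchy_symmetric _ S r) => //.
- move=> z z0 z1 z2.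
  have nz : z != 0 by apply/eqP => E; move: z0; rewrite E /=; lra.
  have z3 : `|Re z| <= r by rewrite ger0_norm// ltW.
  have nE w : w != 0 -> c + w != c.
    by move=> w0; rewrite -subr_eq0 cadd.
  have niz : 'i%C * z != 0 by rewrite -cabs_gt0 cabsiM cabs_gt0.
  rewrite /S; apply: cdiffD; [apply: cdiffD; [apply: cdiffD|]|].
  + apply: (@cdiff_comp _ (fun w => c + w) P).
      by apply: cdiffD; [exact: cdiff_cst | exact: cdiff_id].
    by apply: Pd; rewrite ?nE ?cadd.
  + apply: (@cdiff_comp _ (fun w => c + 'i%C * w) P).
      apply: cdiffD; first exact: cdiff_cst.
      by apply: cdiffM; [exact: cdiff_cst | exact: cdiff_id].
    by apply: Pd; rewrite ?nE ?cadd ?ri ?im ?normrN.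
  + apply: (@cdiff_comp _ (fun w => c - w) P).
      by apply: cdiffB; [exact: cdiff_cst | exact: cdiff_id].
    by apply: Pd; rewrite ?nE ?oppr_eq0 ?cadd ?NRe ?NIm ?normrN.
  + apply: (@cdiff_comp _ (fun w => c - 'i%C * w) P).
      apply: cdiffB; first exact: cdiff_cst.
      by apply: cdiffM; [exact: cdiff_cst | exact: cdiff_id].
    by apply: Pd; rewrite ?nE ?oppr_eq0 ?cadd ?NRe ?NIm ?ri ?im ?normrN.
- move=> e e0; have e4 : 0 < e / 4 by lra.
  have [d d0 Hd] := Pc _ e4; exists d => // w wd.
  have -> : S w - S 0 = (P (c + w) - P c) + (P (c + 'i%C * w) - P c) +
     (P (c - w) - P c) + (P (c - 'i%C * w) - P c) by rewrite E0 /S; ring.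
  have h1 := Hd (c + w) ltac:(by rewrite cadd).
  have h2 := Hd (c + 'i%C * w) ltac:(by rewrite cadd cabsiM).
  have h3 := Hd (c - w) ltac:(by rewrite cadd cabsN).
  have h4 := Hd (c - 'i%C * w) ltac:(by rewrite cadd cabsN cabsiM).
  apply: le_trans (cabsD _ _) _; apply: le_trans (lerD (cabsD _ _) h4) _.
  by have := cabsD (P (c + w) - P c) (P (c + 'i%C * w) - P c); lra.
- move=> z z1 z2; rewrite /S.
  have z3 : `|Re z| <= r by rewrite z1 ger0_norm// ltW.
  have z4 : r <= cabs z by rewrite -z1; exact: le_trans (ler_norm _) (Re_le_cabs _).
  have h1 := PM (c + z) ltac:(by rewrite cadd) ltac:(by rewrite cadd) ltac:(by rewrite cadd).
  have h2 := PM (c + 'i%C * z) ltac:(by rewrite cadd cabsiM)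
    ltac:(by rewrite cadd ri normrN) ltac:(by rewrite cadd im).
  have h3 := PM (c - z) ltac:(by rewrite cadd cabsN)
    ltac:(by rewrite cadd NRe normrN) ltac:(by rewrite cadd NIm normrN).
  have h4 := PM (c - 'i%C * z) ltac:(by rewrite cadd cabsN cabsiM)
    ltac:(by rewrite cadd NRe ri !normrN) ltac:(by rewrite cadd NIm im normrN).
  apply: le_trans (cabsD _ _) _; apply: le_trans (lerD (cabsD _ _) h4) _.
  by have := cabsD (P (c + z)) (P (c + 'i%C * z)); lra.
Qed.

(** Apply the estimate at the centre to the difference quotient, which is
    continuous there with value the derivative. *)
Lemma cauchy_derivative (R : realType) (f : R[i] -> R[i]) (c d : R[i]) (r M : R) :
  0 < r -> (forall z, cabs (z - c) <= 2 * r -> cdiff f z) ->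
  (forall z, cabs (z - c) <= 2 * r -> cabs (f z) <= M) ->
  cderiv_at f c d -> cabs d <= 4 * M / r.
Proof.
move=> r0 fd fM Hd.
pose p z := if z == c then d else (f z - f c) / (z - c).
have sq z : `|Re (z - c)| <= r -> `|Im (z - c)| <= r -> cabs (z - c) <= 2 * r.
  by move=> h1 h2; apply: le_trans (cabs_le_ReIm _) _; lra.
have -> : d = p c by rewrite /p eqxx.
have -> : 4 * M / r = 2 * (2 * M / r) by field; lra.
apply: (@cauchy_center _ p c r) => //.
- move=> z zc z1 z2.
  apply: (@cdiff_near _ (fun z => (f z - f c) / (z - c)) _ _ (cabs (z - c))).
  + by rewrite cabs_gt0 subr_eq0.
  + move=> w wz; rewrite /p; case: eqP => // wc; move: wz.
    by rewrite wc cabsC ltxx.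
  + apply: cdiffM.
      by apply: cdiffB; [exact: fd (sq _ z1 z2) | exact: cdiff_cst].
    apply: (@cdiff_comp _ (fun w => w - c) (fun w => w^-1)).
      by apply: cdiffB; [exact: cdiff_id | exact: cdiff_cst].
    by apply: cdiffV; rewrite subr_eq0.
- move=> e e0; have [s s0 Hs] := Hd e e0; exists s => // w ws.
  rewrite /p eqxx; case: eqP => [_|/eqP wc]; first by rewrite subrr cabs0 ltW.
  have wc0 : w - c != 0 by rewrite subr_eq0.
  have -> : (f w - f c) / (w - c) - d = (f w - f c - d * (w - c)) / (w - c).
    by field.
  by rewrite cabsM cabsV ler_pdivrMr ?cabs_gt0// Hs.
- move=> z z0 z1 z2; rewrite /p; case: eqP => [E|_].
    by move: z0; rewrite E subrr cabs0; lra.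
  rewrite cabsM cabsV ler_pM ?invr_ge0 ?cabs_ge0//.
    apply: le_trans (cabsB _ _) _; have := fM _ (sq _ z1 z2).
    by have := fM c; rewrite subrr cabs0 => /(_ ltac:(lra)); lra.
  by rewrite lef_pV2 ?posrE//; apply: lt_le_trans z0.
Qed.

(** By bisection: the half on which the increment is larger violates the bound
    again, and the halves shrink to a point whose derivative is too large. *)
Lemma mean_value_bound (R : realType) (f : R[i] -> R[i]) (K : set R[i]) (L : R)
    (a b : R[i]) :
  midconvex K ->
  (forall z, (forall e, 0 < e -> exists2 w, K w & cabs (w - z) < e) -> K z) ->
  (forall z, K z -> exists2 d, cderiv_at f z d & cabs d <= L) -> K a -> K b ->
  cabs (f b - f a) <= L * cabs (b - a).
Proof.
move=> cK clK fK Ka Kb; have [->|ab] := eqVneq a b.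
  by rewrite !subrr cabs0 mulr0.
have Nab : 0 < cabs (b - a) by rewrite cabs_gt0 subr_eq0 eq_sym.
rewrite -ler_pdivrMr//; apply/ler_addgt0Pr => eps eps0; rewrite ler_pdivrMr//.
rewrite leNgt; apply/negP => bad0.
set L' := L + eps in bad0.
pose bad (t : R[i] * R[i]) := L' * cabs (t.2 - t.1) < cabs (f t.2 - f t.1).
have step (t : R[i] * R[i]) : exists t', K t.1 -> K t.2 -> bad t ->
    [/\ K t'.1, K t'.2, bad t', cabs (t'.2 - t'.1) = cabs (t.2 - t.1) / 2 &
      cabs (t'.1 - t.1) <= cabs (t.2 - t.1)].
  case: t => x y /=; have [[Kx Ky bxy]|H] := pselect [/\ K x, K y & bad (x, y)];
    last by exists (x, y) => ? ? ?; exfalso; exact: H.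
  set u := (x + y) / 2; have Ku : K u by exact: cK.
  have E1 : u - x = (y - x) / 2 by rewrite /u; field.
  have E2 : y - u = (y - x) / 2 by rewrite /u; field.
  have N0 := cabs_ge0 (y - x).
  have [B1|B1] := pselect (bad (x, u)).
    by exists (x, u) => _ _ _; split => //=; rewrite ?E1 ?cabs_half// subrr cabs0.
  exists (u, y) => _ _ _; split => //=; last 2 first.
  - by rewrite E2 cabs_half.
  - by rewrite E1 cabs_half; lra.
  move: bxy; rewrite /bad /= E2 cabs_half.
  move/negP: B1; rewrite -leNgt /bad /= E1 cabs_half.
  have := cabs_tri (f u) (f y) (f x); lra.
have [next Hnext] := choice step.
pose T := fix T k : R[i] * R[i] := if k is k'.+1 then next (T k') else (a, b).
have HT k : [/\ K (T k).1, K (T k).2, bad (T k) &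
    cabs ((T k).2 - (T k).1) = cabs (b - a) * 2^-1 ^+ k].
  elim: k => [|k [K1 K2 B P]]; first by rewrite expr0 mulr1.
  have [K1' K2' B' P' _] := Hnext _ K1 K2 B; split => //=.
  by rewrite P' P exprSr mulrA.
have Tstep k : cabs ((T k.+1).1 - (T k).1) <= cabs (b - a) * 2^-1 ^+ k.
  by have [K1 K2 B P] := HT k; have [_ _ _ _] := Hnext _ K1 K2 B; rewrite P.
have h01 : 0 <= (2^-1 : R) < 1 by lra.
have [z Hz] := geometric_limit h01 Tstep.
set p := cabs (b - a) in Hz Nab HT.
have Hz4 k : cabs ((T k).1 - z) <= 4 * p * 2^-1 ^+ k.
  apply: le_trans (Hz k) _; rewrite le_eqVlt; apply/orP; left; apply/eqP.
  by field.
have Kz : K z.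
  apply: clK => e e0.
  have [n Hn] := @exp_small _ 2^-1 (e / (4 * p)) h01
    ltac:(by rewrite divr_gt0// mulr_gt0).
  exists (T n).1; first by have [] := HT n.
  rewrite ltr_pdivlMr ?mulr_gt0// in Hn; apply: le_lt_trans (Hz4 n) _.
  by rewrite mulrC.
have [d Hd dL] := fK z Kz.
have [r r0 Hr] := Hd (eps / 10) ltac:(lra).
have [k Hk] := @exp_small _ 2^-1 (r / (5 * p)) h01
  ltac:(by rewrite divr_gt0// mulr_gt0).
have [_ _ B P] := HT k; have := Hz4 k; move: B; rewrite /bad P.
rewrite ltr_pdivlMr ?mulr_gt0// in Hk.
set q := 2^-1 ^+ k in Hk P *; have q0 : 0 < q by rewrite exprn_gt0.
set x := (T k).1 in P *; set y := (T k).2 in P * => B zx.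
have pq : 0 < p * q by rewrite mulr_gt0.
have zy : cabs (y - z) <= 5 * p * q by have := cabs_tri x y z; lra.
have rx := Hr x ltac:(lra); have ry := Hr y ltac:(lra).
have : cabs (f y - f x) <= eps / 10 * (5 * p * q) + eps / 10 * (4 * p * q) + L * (p * q).
  have -> : f y - f x = (f y - f z - d * (y - z)) - (f x - f z - d * (x - z)) +
     d * (y - x) by ring.
  apply: le_trans (cabsD _ _) _; apply: lerD.
    apply: le_trans (cabsB _ _) _; apply: lerD.
      by apply: le_trans ry _; rewrite ler_wpM2l//; lra.
    by apply: le_trans rx _; rewrite ler_wpM2l//; lra.
  by rewrite cabsM P ler_wpM2r// ltW.
have : 0 < eps * (p * q) by rewrite mulr_gt0.
by rewrite /L' in B; lra.
Qed.

Lemma midconvex_ball (R : realType) (c : R[i]) (r : R) :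
  midconvex [set z | cabs (z - c) <= r].
Proof.
move=> u v /= Ku Kv.
have -> : (u + v) / 2 - c = (u - c) / 2 + (v - c) / 2 by field.
by apply: le_trans (cabsD _ _) _; rewrite !cabs_half; lra.
Qed.

Lemma closed_cball (R : realType) (c : R[i]) (r : R) (z : R[i]) :
  (forall e, 0 < e -> exists2 w, [set z | cabs (z - c) <= r] w & cabs (w - z) < e) ->
  cabs (z - c) <= r.
Proof.
move=> H; apply/ler_addgt0Pr => e /H[w /= wr wz].
by have := cabs_tri w z c; rewrite (cabsC z w); lra.
Qed.

Lemma bounded_holomorphic_lip (R : realType) (f : R[i] -> R[i]) (c : R[i]) (r M : R) :
  0 < r -> (forall z, cabs (z - c) <= 3 * r -> cdiff f z) ->
  (forall z, cabs (z - c) <= 3 * r -> cabs (f z) <= M) ->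
  forall z w, cabs (z - c) <= r -> cabs (w - c) <= r ->
    cabs (f z - f w) <= 4 * M / r * cabs (z - w).
Proof.
move=> r0 fd fM z w zr wr.
apply: (mean_value_bound (midconvex_ball (c := c) (r := r))) => //.
  by move=> u; exact: closed_cball.
move=> u /= ur; have [d Hd] := fd u ltac:(lra); exists d => //.
apply: (@cauchy_derivative _ f u) => // v uv;
  [apply: fd | apply: fM]; have := cabs_tri u v c; lra.
Qed.

(** A function vanishing on the real axis may be replaced by [0] below the axis.
    On each side of a square whose bottom lies on the axis, one of the four
    rotated copies of the function about the centre vanishes; so does their
    product, and hence its value at the centre. *)
Lemma vanish_above (R : realType) (D : R[i] -> R[i]) (rho y : R) :
  (forall z, cabs z < rho -> cdiff D z) ->
  (forall x : R, `|x| < rho -> D x%:C = 0) ->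
  0 < y -> 3 * y < rho -> D (0 +i* y) = 0.
Proof.
move=> Dd D0 y0 yrho.
pose E z := if Im z <= 0 then 0 else D z.
have Ed z : cabs z < rho -> cdiff E z.
  move=> zr; have [z0|z0|z0] := ltgtP (Im z) 0.
  - apply: (@cdiff_near _ (fun=> 0) _ _ (- Im z)); last exact: cdiff_cst.
      by lra.
    move=> w wz; rewrite /E ifT//; have := Im_le_cabs (w - z).
    by rewrite raddfB /= ler_norml; lra.
  - apply: (@cdiff_near _ D _ _ (Im z)) => //; last exact: Dd.
    move=> w wz; rewrite /E ifF//; apply/negbTE; rewrite -ltNge.
    by have := Im_le_cabs (w - z); rewrite raddfB /= ler_norml; lra.
  - have [d Hd] := Dd z zr.
    have zE : z = (Re z)%:C by case: (z) z0 => a b /= ->.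
    have Dz : D z = 0.
      by rewrite zE D0//; apply: le_lt_trans (Re_le_cabs _) zr.
    have d0 : d = 0.
      apply: cabs_small0 => e e0; have [r r0 Hr] := Hd e e0.
      pose s := Num.min r (rho - cabs z) / 2.
      have [s0 [sr srho]] : 0 < s /\ (s < r /\ s < rho - cabs z).
        have : 0 < Num.min r (rho - cabs z) by rewrite lt_min r0 subr_gt0.
        have := ge_min r r (rho - cabs z); rewrite lexx /=.
        have := ge_min (rho - cabs z) r (rho - cabs z); rewrite lexx orbT.
        by rewrite /s; lra.
      have ss : cabs s%:C = s by rewrite cabs_real ger0_norm// ltW.
      have := Hr (z + s%:C); rewrite addrC addKr ss => /(_ sr).
      have -> : D (z + s%:C) = 0.
        rewrite zE -rmorphD D0//; have := Re_le_cabs (z + s%:C).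
        rewrite raddfD /=; have := cabsD z s%:C; rewrite ss; lra.
      by rewrite Dz subrr sub0r cabsN cabsM ss ler_pM2r.
    exists 0 => e e0; rewrite d0 in Hd; have [r r0 Hr] := Hd e e0.
    exists r => // w wr; have := Hr w wr; rewrite Dz /E z0 lexx.
    by case: ifP => // _ _; rewrite mul0r !subr0 cabs0 mulr_ge0 ?cabs_ge0// ltW.
(* The centre [0 +i* y] and the half side [y] put the bottom of the square on the
   axis. *)
pose c : R[i] := 0 +i* y.
pose S z := E (c + z) * E (c + 'i%C * z) * E (c - z) * E (c - 'i%C * z).
have ii z : 'i%C * ('i%C * z) = - z :> R[i] by rewrite mulrA mulii mulN1r.
have Si z : S ('i%C * z) = S z by rewrite /S ii opprK; ring.
have cabsiM (z : R[i]) : cabs ('i%C * z) = cabs z by rewrite cabsM cabsi mul1r.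
have cy : cabs c = y.
  rewrite (_ : c = 'i%C * y%:C); first by rewrite cabsiM cabs_real ger0_norm// ltW.
  by apply/eqP; rewrite eq_complex /= !mul0r !mul1r subrr add0r !eqxx.
have Sd z : cabs z <= 2 * y -> cdiff S z.
  move=> zy; rewrite /S.
  have near w : cabs w = cabs z -> cabs (c + w) < rho.
    by move=> wz; apply: le_lt_trans (cabsD _ _) _; rewrite cy wz; lra.
  apply: cdiffM; [apply: cdiffM; [apply: cdiffM|]|].
  + apply: (@cdiff_comp _ (fun w => c + w) E); last exact: Ed (near _ _).
    by apply: cdiffD; [exact: cdiff_cst | exact: cdiff_id].
  + apply: (@cdiff_comp _ (fun w => c + 'i%C * w) E); last exact: Ed (near _ _).
    apply: cdiffD; first exact: cdiff_cst.
    by apply: cdiffM; [exact: cdiff_cst | exact: cdiff_id].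
  + apply: (@cdiff_comp _ (fun w => c - w) E);
      last by apply: Ed; apply: near; rewrite cabsN.
    by apply: cdiffB; [exact: cdiff_cst | exact: cdiff_id].
  + apply: (@cdiff_comp _ (fun w => c - 'i%C * w) E);
      last by apply: Ed; apply: near; rewrite cabsN.
    apply: cdiffB; first exact: cdiff_cst.
    by apply: cdiffM; [exact: cdiff_cst | exact: cdiff_id].
have : cabs (S 0) <= 2 * 0.
  apply: (@cauchy_symmetric _ S y) => //.
  - move=> z z1 z2 z3; apply: Sd; apply: le_trans (cabs_le_ReIm _) _.
    by rewrite ger0_norm ?(ltW z1)//; lra.
  - move=> e e0.
    have [d d0 Hd] := cdiff_cont (Sd 0 ltac:(by rewrite cabs0; lra)) e0.
    by exists d => // w wd; apply: ltW; apply: Hd; rewrite subr0.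
  - move=> z zy _; rewrite /S [E (c - 'i%C * z)]/E ifT ?mulr0 ?cabs0//.
    rewrite raddfB /=; case: z zy => a b /= ->; rewrite mul0r mul1r add0r; lra.
rewrite mulr0 => S0; have {S0} : S 0 = 0.
  by apply: cabs0_eq0; apply/eqP; rewrite eq_le S0 cabs_ge0.
rewrite /S mulr0 addr0 subr0 /E /= leNgt y0 /= => /eqP.
by rewrite !mulf_eq0 !orbb => /eqP.
Qed.

Lemma vanish_near_axis (R : realType) (D : R[i] -> R[i]) (rho y : R) :
  (forall z, cabs z < rho -> cdiff D z) ->
  (forall x : R, `|x| < rho -> D x%:C = 0) ->
  3 * `|y| < rho -> D (0 +i* y) = 0.
Proof.
move=> Dd D0 yrho; have [y0|y0|y0] := ltgtP y 0.
- have -> : 0 +i* y = - (0 +i* (- y)).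
    by apply/eqP; rewrite eq_complex /= oppr0 opprK !eqxx.
  apply: (@vanish_above _ (fun z => D (- z)) rho).
  + move=> z zr; apply: (@cdiff_comp _ (fun w => - w) D).
      by apply: cdiffN; exact: cdiff_id.
    by apply: Dd; rewrite cabsN.
  + by move=> x xr; rewrite -rmorphN D0// normrN.
  + by lra.
  + by move: yrho; rewrite ltr0_norm.
- by apply: (@vanish_above _ D rho) => //; move: yrho; rewrite gtr0_norm.
- rewrite y0; apply: (D0 0); rewrite normr0; apply: le_lt_trans yrho.
  by rewrite mulr_ge0.
Qed.

(** * Series of functions *)

Definition sums_to (R : realType) (u : nat -> R[i]) (l : R[i]) :=
  forall e : R, 0 < e -> exists n0, forall n, (n0 <= n)%N ->
    cabs (\sum_(i < n) u i - l) <= e.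

Lemma cabs_sum (R : realType) n (u : 'I_n -> R[i]) :
  cabs (\sum_(i < n) u i) <= \sum_(i < n) cabs (u i).
Proof.
elim/big_ind2: _ => //; first by rewrite cabs0.
by move=> x a y b xa yb; apply: le_trans (cabsD _ _) _; exact: lerD.
Qed.

Lemma sums_to_uniq (R : realType) (u : nat -> R[i]) (l l' : R[i]) :
  sums_to u l -> sums_to u l' -> l = l'.
Proof.
move=> H H'; apply/eqP; rewrite -subr_eq0; apply/eqP; apply: cabs_small0 => e e0.
have e2 : 0 < e / 2 by lra.
have [n N] := H _ e2; have [m M] := H' _ e2.
have := N _ (leq_maxl n m); have := M _ (leq_maxr n m).
by set s := \sum_(i < _) _; have := cabs_tri s l l'; rewrite (cabsC l s); lra.
Qed.

Lemma geometric_tail (R : realType) (M q : R) n m :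
  0 <= M -> 0 <= q < 1 ->
  \sum_(i < m) M * q ^+ (n + i) <= M / (1 - q) * q ^+ n.
Proof.
move=> M0 /andP[q0 q1]; have Q0 : 0 <= M / (1 - q) by rewrite divr_ge0//; lra.
suff -> : \sum_(i < m) M * q ^+ (n + i) =
    M / (1 - q) * q ^+ n - M / (1 - q) * q ^+ (n + m).
  by rewrite gerBl mulr_ge0 ?exprn_ge0.
elim: m => [|m IH]; first by rewrite big_ord0 addn0 subrr.
by rewrite big_ord_recr /= IH addnS exprS; field; lra.
Qed.

Lemma sums_to_tail (R : realType) (u : nat -> R[i]) (l : R[i]) (M q : R) n :
  0 <= M -> 0 <= q < 1 -> (forall k, cabs (u k) <= M * q ^+ k) ->
  sums_to u l -> cabs (\sum_(i < n) u i - l) <= M / (1 - q) * q ^+ n.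
Proof.
move=> M0 q01 uM ul; apply/ler_addgt0Pr => e e0; have [m Hm] := ul e e0.
have := Hm (n + m)%N (leq_addl _ _); rewrite big_split_ord /=.
set s := \sum_(i < n) _; set t := \sum_(i < m) _ => stl.
have tb : cabs t <= M / (1 - q) * q ^+ n.
  apply: le_trans (cabs_sum _) _; apply: le_trans (geometric_tail n m M0 q01).
  by apply: ler_sum => i _; exact: uM.
have -> : s - l = (s + t - l) - t by ring.
by apply: le_trans (cabsB _ _) _; lra.
Qed.

Lemma geometric_sums_to (R : realType) (u : nat -> R[i]) (M q : R) :
  0 <= q < 1 -> (forall k, cabs (u k) <= M * q ^+ k) ->
  exists l, sums_to u l.
Proof.
move=> q01 uM; have [k|l Hl] := @geometric_limit _ (fun n => \sum_(i < n) u i) M q q01.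
  by rewrite big_ord_recr /= addrAC subrr add0r.
exists l => e e0; set K := 2 * (M / (1 - q)) in Hl.
have M0 : 0 <= M by have := uM 0%N; rewrite expr0 mulr1; apply/le_trans/cabs_ge0.
have K0 : 0 <= K by rewrite mulr_ge0// divr_ge0//; lra.
have K1 : 0 < K + 1 by lra.
have [n0 Hn] := @exp_small _ q (e / (K + 1)) q01 ltac:(by rewrite divr_gt0).
exists n0 => n nn; apply: le_trans (Hl n) _.
move: Hn; rewrite ltr_pdivlMr// => Hn.
have q1 : q ^+ n <= q ^+ n0 by apply: ler_wiXn2l => //; lra.
have q2 : 0 <= q ^+ n by rewrite exprn_ge0//; lra.
apply: le_trans (ltW Hn); rewrite mulrC; apply: ler_pM => //; lra.
Qed.

Lemma sums_toB (R : realType) (u v : nat -> R[i]) (k l : R[i]) :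
  sums_to u k -> sums_to v l -> sums_to (fun n => u n - v n) (k - l).
Proof.
move=> H1 H2 e e0; have e2 : 0 < e / 2 by lra.
have [n N] := H1 _ e2; have [m M] := H2 _ e2; exists (maxn n m) => p.
rewrite geq_max => /andP[/N{}N /M{}M].
rewrite sumrB; set s := \sum_(i < p) _ in N *; set t := \sum_(i < p) _ in M *.
have -> : s - t - (k - l) = (s - k) - (t - l) by ring.
by apply: le_trans (cabsB _ _) _; lra.
Qed.

Lemma cderiv_le_lip (R : realType) (f : R[i] -> R[i]) (c d : R[i]) (r L : R) :
  0 < r -> (forall w, cabs (w - c) < r -> cabs (f w - f c) <= L * cabs (w - c)) ->
  cderiv_at f c d -> cabs d <= L.
Proof.
move=> r0 fL Hd; apply/ler_addgt0Pr => e e0; have [s s0 Hs] := Hd e e0.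
pose t := Num.min r s / 2.
have m0 : 0 < Num.min r s by rewrite lt_min r0.
have t0 : 0 < t by rewrite /t; lra.
have tr : t < r by have := ge_min r r s; rewrite lexx /= /t; lra.
have ts : t < s by have := ge_min s r s; rewrite lexx orbT /t; lra.
have Nt : cabs t%:C = t by rewrite cabs_real gtr0_norm.
have Et : (c + t%:C) - c = t%:C by rewrite addrC addKr.
have := Hs (c + t%:C); rewrite Et Nt => /(_ ts) H1.
have := fL (c + t%:C); rewrite Et Nt => /(_ tr) H2.
have : cabs (d * t%:C) <= (L + e) * t.
  have -> : d * t%:C = (f (c + t%:C) - f c) - (f (c + t%:C) - f c - d * t%:C) by ring.
  by apply: le_trans (cabsB _ _) _; lra.
by rewrite cabsM Nt ler_pM2r.
Qed.

Lemma cderiv_sum (R : realType) (u : nat -> R[i] -> R[i]) (d : nat -> R[i])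
    (c : R[i]) n :
  (forall k, cderiv_at (u k) c (d k)) ->
  cderiv_at (fun z => \sum_(i < n) u i z) c (\sum_(i < n) d i).
Proof.
move=> H; elim: n => [|n IH].
  rewrite big_ord0; apply: (@cderiv_near _ (fun=> 0) _ _ _ 1) => //.
    by move=> w _; rewrite big_ord0.
  exact: cderiv_cst.
rewrite big_ord_recr /=.
apply: (@cderiv_near _ (fun z => \sum_(i < n) u i z + u n z) _ _ _ 1) => //.
  by move=> w _; rewrite big_ord_recr.
exact: cderivD.
Qed.

Lemma sums_to_lip (R : realType) (u : nat -> R[i] -> R[i]) (F : R[i] -> R[i])
    (z w : R[i]) (M q : R) :
  0 <= M -> 0 <= q < 1 ->
  (forall k, cabs (u k z - u k w) <= M * q ^+ k * cabs (z - w)) ->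
  sums_to (u^~ z) (F z) -> sums_to (u^~ w) (F w) ->
  cabs (F z - F w) <= M / (1 - q) * cabs (z - w).
Proof.
move=> M0 q01 uM Fz Fw.
have := @sums_to_tail _ _ _ (M * cabs (z - w)) q 0 _ q01 _ (sums_toB Fz Fw).
rewrite big_ord0 sub0r cabsN expr0 mulr1 mulrAC; apply.
  by rewrite mulr_ge0 ?cabs_ge0.
by move=> k; rewrite mulrAC.
Qed.

(** Dominated convergence of the difference quotients: each of them is bounded
    by the Lipschitz constant of the corresponding term. *)
Lemma sums_to_cdiff (R : realType) (u : nat -> R[i] -> R[i]) (F : R[i] -> R[i])
    (c : R[i]) (r M q : R) :
  0 < r -> 0 <= M -> 0 <= q < 1 ->
  (forall k w, cabs (w - c) < r ->
    cabs (u k w - u k c) <= M * q ^+ k * cabs (w - c)) ->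
  (forall k, cdiff (u k) c) ->
  (forall w, cabs (w - c) < r -> sums_to (u^~ w) (F w)) ->
  cdiff F c.
Proof.
move=> r0 M0 q01 uM ud uF.
have [d Hd] := choice ud.
have dM k : cabs (d k) <= M * q ^+ k.
  by apply: (cderiv_le_lip r0 _ (Hd k)) => w wr; exact: uM.
have [D HD] := geometric_sums_to q01 dM.
exists D => e e0; set K := M / (1 - q).
have K0 : 0 <= K by rewrite divr_ge0//; lra.
have [n Hn] := @exp_small _ q (e / 4 / (K + 1)) q01 ltac:(by rewrite !divr_gt0//; lra).
have {}Hn : K * q ^+ n <= e / 4.
  rewrite ltr_pdivlMr in Hn; last by lra.
  apply: le_trans (ltW Hn); rewrite mulrC ler_wpM2l ?exprn_ge0//; lra.
have [s s0 Hs] := cderiv_sum n Hd (ltac:(lra) : 0 < e / 2).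
exists (Num.min r s); first by rewrite lt_min r0.
move=> w; rewrite lt_min => /andP[wr ws].
have c_r : cabs (c - c) < r by rewrite subrr cabs0.
have T1 : cabs (\sum_(i < n) (u i w - u i c) - (F w - F c)) <= e / 4 * cabs (w - c).
  have := @sums_to_tail _ _ _ (M * cabs (w - c)) q n _ q01 _
    (sums_toB (uF w wr) (uF c c_r)).
  have -> : M * cabs (w - c) / (1 - q) * q ^+ n = K * q ^+ n * cabs (w - c).
    by rewrite /K; ring.
  move=> T; apply: le_trans (T _ _) _.
  - by rewrite mulr_ge0 ?cabs_ge0.
  - by move=> k; rewrite mulrAC; exact: uM.
  - by apply: ler_wpM2r; rewrite ?cabs_ge0.
have T2 : cabs (\sum_(i < n) d i - D) <= e / 4.
  by apply: le_trans (sums_to_tail n M0 q01 dM HD) _.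
have := Hs w ws; rewrite /= => T3.
set A := \sum_(i < n) u i w in T3; set B := \sum_(i < n) u i c in T3.
rewrite sumrB -/A -/B in T1; set dn := \sum_(i < n) d i in T2 T3.
have -> : F w - F c - D * (w - c) = (A - B - dn * (w - c)) -
   (A - B - (F w - F c)) + (dn - D) * (w - c) by ring.
have T4 : cabs ((dn - D) * (w - c)) <= e / 4 * cabs (w - c).
  by rewrite cabsM ler_wpM2r ?cabs_ge0.
apply: le_trans (cabsD _ _) _; apply: le_trans (lerD (cabsB _ _) T4) _.
by lra.
Qed.

Lemma cabs_subX (R : realType) (z w : R[i]) (r : R) n :
  cabs z <= r -> cabs w <= r ->
  cabs (z ^+ n.+1 - w ^+ n.+1) <= n.+1%:R * r ^+ n * cabs (z - w).
Proof.
move=> zr wr; have r0 : 0 <= r := le_trans (cabs_ge0 z) zr.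
elim: n => [|n IH]; first by rewrite !expr1 expr0 !mul1r.
have -> : z ^+ n.+2 - w ^+ n.+2 = z * (z ^+ n.+1 - w ^+ n.+1) + (z - w) * w ^+ n.+1.
  by rewrite !(exprS _ n.+1); ring.
apply: le_trans (cabsD _ _) _; rewrite !cabsM cabsX.
have -> : n.+2%:R * r ^+ n.+1 * cabs (z - w) =
    r * (n.+1%:R * r ^+ n * cabs (z - w)) + cabs (z - w) * r ^+ n.+1.
  by rewrite exprS -[n.+2]addn1 natrD; ring.
apply: lerD; first by apply: ler_pM => //; rewrite cabs_ge0.
by rewrite ler_wpM2l ?cabs_ge0// lerXn2r ?nnegrE ?cabs_ge0.
Qed.

(** Convergence at one real point bounds the coefficients. On a disc of a quarter
    of that radius the [n]-th term then has a Lipschitz constant of order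
    [2^-1 ^+ n], which is what differentiation of the sum requires. *)
Lemma power_series (R : realType) (a : nat -> R[i]) (r : R) (S : R -> R[i]) :
  0 < r -> (forall s, `|s| < r -> sums_to (fun n => a n * s%:C ^+ n) (S s)) ->
  exists (rho M : R) (t : R[i] -> R[i]), [/\ 0 < rho,
    forall z, cabs z < rho -> cdiff t z,
    forall z, cabs z < rho -> cabs (t z) <= M &
    forall s : R, `|s| < rho -> t s%:C = S s].
Proof.
move=> r0 aS; pose s := r / 2.
have s0 : 0 < s by rewrite /s; lra.
have sr : `|s| < r by rewrite gtr0_norm// /s; lra.
have [n0 Hn0] := aS s sr 1 ltr01.
have b1 n : (n0 <= n)%N -> cabs (a n * s%:C ^+ n) <= 2.
  move=> nn; have := Hn0 n nn; have := Hn0 n.+1 (leqW nn); rewrite big_ord_recr /=.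
  set x := \sum_(i < n) _; set y := _ * _ => h1 h2.
  have -> : y = (x + y - S s) - (x - S s) by ring.
  by apply: le_trans (cabsB _ _) _; lra.
pose M0 := 2 + \sum_(i < n0) cabs (a i * s%:C ^+ i).
have sum0 : 0 <= \sum_(i < n0) cabs (a i * s%:C ^+ i).
  by apply: sumr_ge0 => i _; exact: cabs_ge0.
have M00 : 0 <= M0 by rewrite /M0; lra.
have aM n : cabs (a n) * s ^+ n <= M0.
  have -> : cabs (a n) * s ^+ n = cabs (a n * s%:C ^+ n).
    by rewrite cabsM cabsX cabs_real gtr0_norm.
  have [/b1 h|nn] := leqP n0 n; first by rewrite /M0; lra.
  rewrite /M0 (bigD1 (Ordinal nn)) //=.
  have : 0 <= \sum_(i < n0 | i != Ordinal nn) cabs (a i * s%:C ^+ i).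
    by apply: sumr_ge0 => i _; exact: cabs_ge0.
  by lra.
pose rho := s / 4; have rho0 : 0 < rho by rewrite /rho; lra.
pose u n z := a n * z ^+ n.
pose L := 4 * M0 / s.
have L0 : 0 <= L by rewrite /L divr_ge0 ?(ltW s0)//; lra.
have h01 : 0 <= (2^-1 : R) < 1 by lra.
have uL k z w : cabs z <= rho -> cabs w <= rho ->
    cabs (u k z - u k w) <= L * 2^-1 ^+ k * cabs (z - w).
  move=> zr wr; rewrite /u -mulrBr cabsM; case: k => [|k].
    rewrite !expr0 subrr cabs0 mulr0 !mulr_ge0 ?cabs_ge0 ?invr_ge0 ?(ltW s0)//.
  apply: le_trans (ler_wpM2l (cabs_ge0 _) (cabs_subX k zr wr)) _.
  rewrite mulrA ler_wpM2r ?cabs_ge0//.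
  have -> : rho ^+ k = s ^+ k.+1 * (4^-1 ^+ k / s).
    rewrite /rho exprMn exprS; field; lra.
  have -> : cabs (a k.+1) * (k.+1%:R * (s ^+ k.+1 * (4^-1 ^+ k / s))) =
     cabs (a k.+1) * s ^+ k.+1 * (k.+1%:R * (4^-1 ^+ k / s)) by ring.
  have k2 : (k.+1%:R : R) <= 2 ^+ k.+1 by rewrite -natrX ler_nat ltnW// ltn_expl.
  apply: le_trans (ler_wpM2r _ (aM k.+1)) _.
    by rewrite mulr_ge0// divr_ge0 ?exprn_ge0// ltW.
  have -> : L * 2^-1 ^+ k.+1 = M0 * (2 ^+ k.+1 * (4^-1 ^+ k / s)).
    rewrite /L; have -> : (4^-1 : R) = 2^-1 * 2^-1 by field.
    rewrite exprMn !exprS; have E : (2 : R) ^+ k * 2^-1 ^+ k = 1.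
      by rewrite -exprMn divff// expr1n.
    have -> : M0 * (2 * 2 ^+ k * (2^-1 ^+ k * 2^-1 ^+ k / s)) =
      M0 * (2 * (2 ^+ k * 2^-1 ^+ k) * (2^-1 ^+ k / s)) by ring.
    by rewrite E; field; lra.
  rewrite ler_wpM2l// ler_wpM2r// divr_ge0 ?exprn_ge0//; lra.
have sum_ex z : exists l, cabs z <= rho -> sums_to (u^~ z) l.
  have [zr|zr] := pselect (cabs z <= rho); last by exists 0.
  have [|l Hl] := @geometric_sums_to _ (fun k => u k z - u k 0) (L * cabs z) 2^-1 h01.
    by move=> k; rewrite mulrAC -{2}(subr0 z) uL// cabs0 ltW.
  have H0 := aS 0 ltac:(by rewrite normr0).
  exists (l - - S 0) => _; have H0' : sums_to (fun k => - u k 0) (- S 0).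
    move=> e e0; have [n N] := H0 e e0; exists n => m /N.
    by rewrite sumrN -opprD cabsN.
  move=> e e0; have [n N] := sums_toB Hl H0' e0; exists n => m /N.
  by under eq_bigr => i _ do rewrite opprK subrK.
have [t Ht] := choice sum_ex.
have tL z w : cabs z <= rho -> cabs w <= rho ->
    cabs (t z - t w) <= L / (1 - 2^-1) * cabs (z - w).
  move=> zr wr; apply: (@sums_to_lip _ u) => //; last 2 first.
  - exact: Ht.
  - exact: Ht.
  by move=> k; exact: uL.
exists rho, (cabs (t 0) + L / (1 - 2^-1) * rho), t; split => //.
- move=> z zr; apply: (@sums_to_cdiff _ u t z (rho - cabs z) L 2^-1) => //.
  + by rewrite subr_gt0.
  + move=> k w wr; apply: uL; last exact: ltW.
    by have := cabs_tri z w 0; rewrite !subr0; lra.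
  + move=> k; rewrite /u; apply: cdiffM; first exact: cdiff_cst.
    elim: k => [|k IH].
      by apply: (@cdiff_near _ (fun=> 1) _ _ 1) => //; exact: cdiff_cst.
    apply: (@cdiff_near _ (fun w => w * w ^+ k) _ _ 1) => //.
      by move=> w _; rewrite exprS.
    by apply: cdiffM => //; exact: cdiff_id.
  + move=> w wr; apply: Ht.
    by have := cabs_tri z w 0; rewrite !subr0; lra.
- move=> z zr; have := tL z 0 (ltW zr) ltac:(by rewrite cabs0 ltW).
  rewrite subr0 => h; have := cabsD (t z - t 0) (t 0); rewrite subrK => h'.
  apply: le_trans h' _; rewrite addrC lerD2l; apply: le_trans h _.
  by rewrite ler_wpM2l ?(ltW zr)// divr_ge0//; lra.
- move=> x xr; have Nx : cabs x%:C <= rho by rewrite cabs_real ltW.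
  apply: (sums_to_uniq (Ht _ Nx)); apply: aS.
  by apply: lt_trans xr _; rewrite /rho /s; lra.
Qed.

(** The Cauchy estimate, applied to the increments of [f], turns the Lipschitz
    bound on [f] into one on its derivative. *)
Lemma derivative_lip (R : realType) (f : R[i] -> R[i]) (c : R[i]) (r M : R) :
  0 < r -> (forall z, cabs (z - c) <= 12 * r -> cdiff f z) ->
  (forall z, cabs (z - c) <= 12 * r -> cabs (f z) <= M) ->
  forall z w d d', cabs (z - c) <= r -> cabs (w - c) <= r ->
    cderiv_at f z d -> cderiv_at f w d' ->
    cabs (d - d') <= 4 * M / r ^+ 2 * cabs (z - w).
Proof.
move=> r0 fd fM z w d d' zr wr Hd Hd'.
have fL : forall z w, cabs (z - c) <= 4 * r -> cabs (w - c) <= 4 * r ->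
    cabs (f z - f w) <= M / r * cabs (z - w).
  have -> : M / r = 4 * M / (4 * r) by field; lra.
  apply: (@bounded_holomorphic_lip _ f c); first by lra.
    by move=> u ur; apply: fd; lra.
  by move=> u ur; apply: fM; lra.
apply/ler_addgt0Pr => e e0; have e2 : 0 < e / 2 by lra.
have [s1 s10 H1] := Hd _ e2; have [s2 s20 H2] := Hd' _ e2.
pose m := Num.min r (Num.min s1 s2); pose t := m / 2.
have m0 : 0 < m by rewrite !lt_min r0 s10.
have : m <= m by []. rewrite {2}/m !le_min => /andP[mr /andP[ms1 ms2]].
have Nt : cabs t%:C = t by rewrite cabs_real gtr0_norm// /t; lra.
have tri x : cabs (x + t%:C - c) <= cabs (x - c) + t.
  by rewrite addrAC; have := cabsD (x - c) t%:C; rewrite Nt.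
have lipD : cabs ((f (z + t%:C) - f z) - (f (w + t%:C) - f w)) <=
    4 * (M / r * t) / r * cabs (z - w).
  apply: (@bounded_holomorphic_lip _ (fun x => f (x + t%:C) - f x) c) => //.
  - move=> x xr; apply: cdiffB; last by apply: fd; lra.
    apply: (@cdiff_comp _ (fun x => x + t%:C) f).
      by apply: cdiffD; [exact: cdiff_id | exact: cdiff_cst].
    by apply: fd; have := tri x; rewrite /t; lra.
  - move=> x xr; have := tri x => htri.
    apply: le_trans (fL _ _ _ _) _; [by rewrite /t in htri *; lra | by lra |].
    by rewrite addrC addKr Nt.
have Et x : x + t%:C - x = t%:C by rewrite addrC addKr.
have := H1 (z + t%:C); rewrite Et Nt => /(_ ltac:(rewrite /t; lra)) h1.
have := H2 (w + t%:C); rewrite Et Nt => /(_ ltac:(rewrite /t; lra)) h2.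
have : cabs ((d - d') * t%:C) <= (4 * M / r ^+ 2 * cabs (z - w) + e) * t.
  have -> : (d - d') * t%:C = ((f (z + t%:C) - f z) - (f (w + t%:C) - f w)) -
     ((f (z + t%:C) - f z - d * t%:C) - (f (w + t%:C) - f w - d' * t%:C)) by ring.
  apply: le_trans (cabsB _ _) _.
  have -> : (4 * M / r ^+ 2 * cabs (z - w) + e) * t =
     4 * (M / r * t) / r * cabs (z - w) + (e / 2 * t + e / 2 * t) by field; lra.
  apply: lerD => //; apply: le_trans (cabsB _ _) _; exact: lerD.
by rewrite cabsM Nt ler_pM2r// /t; lra.
Qed.

(** The mean value bound for [fun z => f z - d * z]. *)
Lemma strict_derivative (R : realType) (f : R[i] -> R[i]) (c d : R[i]) (r K : R) :
  0 <= K -> cderiv_at f c d ->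
  (forall z, cabs (z - c) <= r -> exists2 d', cderiv_at f z d' &
     cabs (d' - d) <= K) ->
  forall z w, cabs (z - c) <= r -> cabs (w - c) <= r ->
    cabs (f z - f w - d * (z - w)) <= K * cabs (z - w).
Proof.
move=> K0 Hd fK z w zr wr.
have -> : f z - f w - d * (z - w) = (f z - d * z) - (f w - d * w) by ring.
apply: (mean_value_bound (f := fun z => f z - d * z)
  (midconvex_ball (c := c) (r := r))) => //.
  by move=> u; exact: closed_cball.
move=> u /= /fK[d' Hd' d'K]; exists (d' - d) => //.
have -> : d' - d = d' + - (0 * u + d * 1) by rewrite mul0r add0r mulr1.
apply: cderivD => //; apply: cderivN.
by apply: (@cderivM _ (fun=> d) id); [exact: cderiv_cst | exact: cderiv_id].
Qed.

(** * Translations between filters and inequalities *)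

Lemma real_pos_complex (R : realType) (e : R[i]) : 0 < e -> exists2 r : R, 0 < r & e = r%:C.
Proof.
case: e => a b; rewrite ltcE /= => /andP[/eqP b0 a0]; exists a => //.
by rewrite b0.
Qed.

Lemma nbhs_cabs (R : realType) (z : R[i]) (P : R[i] -> Prop) :
  (\forall w \near z, P w) <->
  exists2 r : R, 0 < r & forall w, cabs (w - z) < r -> P w.
Proof.
split.
  move=> /nbhs_normP[e /= /real_pos_complex[r r0 ->] H]; exists r => // w wr.
  by apply: H; rewrite /= normE ltcR cabsC.
move=> [r r0 H]; apply/nbhs_normP; exists r%:C; first by rewrite /= ltcR.
by move=> w /=; rewrite normE ltcR cabsC => /H.
Qed.

Lemma derivable_cdiff (R : realType) (f : R[i] -> R[i]) (z : R[i]) :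
  derivable f z 1 <-> cdiff f z.
Proof.
split.
  move=> fz; exists ('D_1 f z) => e e0; set d := 'D_1 f z.
  have Hd : h^-1 *: ((f \o shift z) (h *: 1) - f z) @[h --> 0^'] --> d := fz.
  move/cvgrPdist_lt : Hd => /(_ e%:C); rewrite ltcR => /(_ e0).
  move=> /nbhs_ballP[r' /= /real_pos_complex[r r0 ->]] Hr.
  exists r => // w wr; have [->|wz] := eqVneq w z.
    by rewrite !subrr mulr0 subrr cabs0 mulr0.
  have wz0 : w - z != 0 by rewrite subr_eq0.
  have := Hr (w - z); rewrite /ball /= sub0r normrN normE ltcR => /(_ wr wz0).
  have -> : (w - z) *: (1 : R[i]) + z = w by rewrite /GRing.scale /= mulr1 subrK.
  rewrite normE ltcR => /ltW; rewrite cabsC.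
  have -> : (w - z)^-1 *: (f w - f z) - d = (f w - f z - d * (w - z)) / (w - z).
    by rewrite /GRing.scale /=; field.
  by rewrite cabsM cabsV ler_pdivrMr ?cabs_gt0.
move=> [d Hd].
suff Hc : h^-1 *: ((f \o shift z) (h *: 1) - f z) @[h --> 0^'] --> d.
  exact: (cvgP _ Hc).
apply/cvgrPdist_lt => e' /real_pos_complex[e e0 ->].
have [r r0 Hr] := Hd (e / 2) ltac:(lra).
apply/nbhs_ballP; exists r%:C; rewrite /= ?ltcR// => h.
rewrite /ball /= sub0r normrN normE ltcR => hr h0.
have -> : h *: (1 : R[i]) + z = z + h by rewrite /GRing.scale /= mulr1 addrC.
have := Hr (z + h); have -> : z + h - z = h by rewrite addrAC subrr add0r.
move=> /(_ hr) H; rewrite normE ltcR cabsC.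
have -> : h^-1 *: (f (z + h) - f z) - d = (f (z + h) - f z - d * h) / h.
  by rewrite /GRing.scale /=; field.
have hpos : 0 < cabs h by rewrite cabs_gt0.
rewrite cabsM cabsV ltr_pdivrMr//; apply: le_lt_trans H _.
by rewrite ltr_pM2r//; lra.
Qed.

Lemma cvg_sums_to (R : realType) (u : nat -> R[i]) (l : R[i]) :
  [series u n]_n @ \oo --> l -> sums_to u l.
Proof.
move=> /cvgrPdist_lt H e e0; have := H e%:C; rewrite ltcR => /(_ e0)[n0 _ Hn].
exists n0 => n nn; have := Hn n nn; rewrite /= normE ltcR cabsC => /ltW.
by rewrite /series /= big_mkord.
Qed.

Lemma is_derive_eps (R : realType) (f : R -> R) (x d : R) :
  is_derive x 1 f d <-> forall e, 0 < e -> exists2 r, 0 < r &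
    forall y, `|y - x| < r -> `|f y - f x - d * (y - x)| <= e * `|y - x|.
Proof.
split.
  move=> [fx D] e e0.
  have Hl : h^-1 *: ((f \o shift x) (h *: 1) - f x) @[h --> 0^'] --> d.
    by rewrite -D; exact: fx.
  move/cvgrPdist_lt : Hl => /(_ e e0)/nbhs_ballP[r /= r0 Hr].
  exists r => // y yr; have [->|yx] := eqVneq y x.
    by rewrite !subrr mulr0 subrr normr0 mulr0.
  have yx0 : y - x != 0 by rewrite subr_eq0.
  have := Hr (y - x); rewrite /ball /= sub0r normrN => /(_ yr yx0).
  have -> : (y - x) *: (1 : R) + x = y by rewrite /GRing.scale /= mulr1 subrK.
  rewrite distrC => /ltW.
  have -> : (y - x)^-1 *: (f y - f x) - d = (f y - f x - d * (y - x)) / (y - x).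
    by rewrite /GRing.scale /=; field.
  by rewrite normrM normfV ler_pdivrMr ?normr_gt0.
move=> H.
have Hc : h^-1 *: ((f \o shift x) (h *: 1) - f x) @[h --> 0^'] --> d.
  apply/cvgrPdist_lt => e e0; have [r r0 Hr] := H (e / 2) ltac:(lra).
  apply/nbhs_ballP; exists r => // h; rewrite /ball /= sub0r normrN => hr h0.
  have -> : h *: (1 : R) + x = x + h by rewrite /GRing.scale /= mulr1 addrC.
  have := Hr (x + h); have -> : x + h - x = h by rewrite addrAC subrr add0r.
  move=> /(_ hr) Hh; rewrite distrC.
  have -> : h^-1 *: (f (x + h) - f x) - d = (f (x + h) - f x - d * h) / h.
    by rewrite /GRing.scale /=; field.
  rewrite normrM normfV ltr_pdivrMr ?normr_gt0//; apply: le_lt_trans Hh _.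
  by rewrite ltr_pM2r ?normr_gt0//; lra.
split; first exact: (cvgP _ Hc).
exact: cvg_lim Hc.
Qed.

(** * The complex exponential and local inverses *)

Definition cexp (R : realType) (z : R[i]) : R[i] := (expR (Re z))%:C * expi (Im z).

Lemma expiD (R : realType) (x y : R) : expi (x + y) = expi x * expi y.
Proof. by rewrite /expi cosD sinD; simpc; congr (_ +i* _); ring. Qed.

Lemma expi0 (R : realType) : expi (0 : R) = 1.
Proof. by rewrite /expi cos0 sin0. Qed.

Lemma cabs_expi (R : realType) (x : R) : cabs (expi x) = 1.
Proof. by rewrite cabs_def /= cos2Dsin2 sqrtr1. Qed.

Lemma cexpD (R : realType) (z w : R[i]) : cexp (z + w) = cexp z * cexp w.
Proof. by rewrite /cexp !raddfD /= expRD expiD rmorphM; ring. Qed.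

Lemma cexp_i (R : realType) (x : R) : cexp ('i%C * x%:C) = expi x.
Proof.
by rewrite /cexp /= !mul0r mul1r mul1r subr0 add0r expR0 mul1r.
Qed.

Lemma cexp0 (R : realType) : cexp (0 : R[i]) = 1.
Proof. by rewrite /cexp /= expR0 expi0 mulr1. Qed.

Lemma expi_near0 (R : realType) (e : R) : 0 < e -> exists2 r, 0 < r &
  forall y, `|y| < r -> cabs (expi y - 1 - 'i%C * y%:C) <= e * `|y|.
Proof.
move=> e0; have e2 : 0 < e / 2 by lra.
have /is_derive_eps/(_ _ e2)[r r0 Hr] := is_derive_cos (0 : R).
have /is_derive_eps/(_ _ e2)[s s0 Hs] := is_derive_sin (0 : R).
exists (Num.min r s); first by rewrite lt_min r0.
move=> y; rewrite lt_min => /andP[yr ys]; apply: le_trans (cabs_le_ReIm _) _.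
have := Hr y; rewrite subr0 => /(_ yr); have := Hs y; rewrite subr0 => /(_ ys).
rewrite sin0 cos0 oppr0 !mul0r !subr0 mul1r /=.
by rewrite !mul0r !mul1r !subr0 !add0r !addr0; lra.
Qed.

Lemma cexp_deriv0 (R : realType) : cderiv_at (@cexp R) 0 1.
Proof.
move=> e e0; pose e' := Num.min 1 (e / 8).
have e'0 : 0 < e' by rewrite lt_min ltr01 /=; lra.
have [e'1 e'8] : e' <= 1 /\ e' <= e / 8.
  by apply/andP; rewrite -le_min.
clearbody e'.
have H1 : is_derive (0 : R) 1 (@expR R) (expR 0) by exact: is_derive_expR.
have /is_derive_eps/(_ _ e'0)[r r0 Hr] := H1.
have [s s0 Hs] := expi_near0 e'0.
exists (Num.min e' (Num.min r s)); first by rewrite !lt_min e'0 r0.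
move=> z; rewrite subr0 !lt_min => /andP[ze /andP[zr zs]]; rewrite cexp0 mul1r.
have Rez := Re_le_cabs z; have Imz := Im_le_cabs z.
have := Hr (Re z); rewrite subr0 expR0 mul1r => /(_ ltac:(lra)) h1.
have := Hs (Im z) ltac:(lra) => h2.
set x := Re z in h1 Rez *; set y := Im z in h2 Imz *.
set al := expR x - 1 - x in h1; set be := expi y - 1 - 'i%C * y%:C in h2.
have -> : cexp z - 1 - z = al%:C + be + (x + al)%:C * ('i%C * y%:C + be).
  rewrite /cexp -/x -/y {1}(complexE z) -/x -/y.
  have -> : expi y = 1 + 'i%C * y%:C + be by rewrite /be; ring.
  have -> : expR x = 1 + x + al by rewrite /al; ring.
  clearbody al be; rewrite !rmorphD /= rmorph1; ring.
have N0 := cabs_ge0 z.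
have b0 : e' * cabs z <= 1 * cabs z by rewrite ler_wpM2r.
have b1 : `|al| <= e' * cabs z by apply: le_trans h1 _; rewrite ler_wpM2l// ltW.
have b2 : cabs be <= e' * cabs z by apply: le_trans h2 _; rewrite ler_wpM2l// ltW.
have b3 : cabs (x + al)%:C <= 2 * e'.
  rewrite cabs_real; apply: le_trans (ler_normD _ _) _.
  by lra.
have b4 : cabs ('i%C * y%:C + be) <= 2 * cabs z.
  apply: le_trans (cabsD _ _) _; rewrite cabsM cabsi mul1r cabs_real.
  by lra.
apply: le_trans (cabsD _ _) _; rewrite (cabsM (x + al)%:C).
apply: le_trans (lerD (cabsD _ _) (ler_pM (cabs_ge0 _) (cabs_ge0 _) b3 b4)) _.
rewrite cabs_real; apply: (@le_trans _ _ (8 * e' * cabs z)); last first.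
  by rewrite ler_wpM2r//; lra.
have : 0 <= e' * cabs z by rewrite mulr_ge0// ltW.
lra.
Qed.

Lemma cexp_deriv (R : realType) (z : R[i]) : cderiv_at (@cexp R) z (cexp z).
Proof.
apply: (@cderiv_near _ (fun w => cexp z * cexp (w - z)) _ _ _ 1) => //.
  by move=> w _; rewrite -cexpD addrC subrK.
have H1 : cderiv_at (fun w => w - z) z (1 + - 0).
  by apply: cderivD; [exact: cderiv_id | apply: cderivN; exact: cderiv_cst].
have H2 : cderiv_at (@cexp R) (z - z) 1 by rewrite subrr; exact: cexp_deriv0.
have := cderivM (cderiv_cst (cexp z) z) (cderiv_comp H1 H2).
by move=> H; apply: (cderiv_at_eq H); rewrite mul0r oppr0 addr0 !mulr1 add0r.
Qed.

Lemma cexp_cdiff (R : realType) (z : R[i]) : cdiff (@cexp R) z.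
Proof. by exists (cexp z); exact: cexp_deriv. Qed.

(** If [t] is close to the linear map [a], Newton's iteration with the fixed
    slope [a] solves [t w = v]. *)
Lemma local_surjective (R : realType) (t : R[i] -> R[i]) (a v : R[i]) (rho k : R) :
  0 < rho -> 0 <= k -> k < cabs a ->
  (forall z w, cabs z <= rho -> cabs w <= rho ->
    cabs (t z - t w - a * (z - w)) <= k * cabs (z - w)) ->
  cabs (v - t 0) <= (cabs a - k) * rho ->
  exists2 w, cabs w <= rho & t w = v.
Proof.
move=> rho0 k0 ka tk vt; have a0 : 0 < cabs a by lra.
have an0 : a != 0 by rewrite -cabs_gt0.
pose q := k / cabs a.
have q0 : 0 <= q by rewrite /q divr_ge0// ltW.
have q1 : q < 1 by rewrite /q ltr_pdivrMr// mul1r.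
have q01 : 0 <= q < 1 by rewrite q0 q1.
pose step w := w - (t w - v) / a.
pose x n := iter n step 0.
have x1 : cabs (step 0 - 0) <= (1 - q) * rho.
  rewrite /step subr0 sub0r cabsN cabsM cabsV cabsC ler_pdivrMr//.
  apply: le_trans vt _; rewrite le_eqVlt; apply/orP; left; apply/eqP.
  by rewrite /q; field; lra.
have stepq z w : cabs z <= rho -> cabs w <= rho ->
    cabs (step z - step w) <= q * cabs (z - w).
  move=> zr wr; have -> : step z - step w = - ((t z - t w - a * (z - w)) / a).
    by rewrite /step; field.
  by rewrite cabsN cabsM cabsV /q mulrAC ler_pM2r ?invr_gt0// tk.
have xS n : [/\ cabs (x n) <= (1 - q ^+ n) * rho,
     cabs (x n.+1) <= (1 - q ^+ n.+1) * rho &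
     cabs (x n.+1 - x n) <= (1 - q) * rho * q ^+ n].
  have qr n' : (1 - q ^+ n') * rho <= rho.
    by rewrite -{2}(mul1r rho) ler_wpM2r ?(ltW rho0)// gerBl exprn_ge0.
  elim: n => [|n [IH1 IH2 IH3]].
    have -> : x 0%N = 0 by []; have -> : x 1%N = step 0 by [].
    rewrite expr0 expr1 subrr mul0r mulr1 cabs0; split => //.
    by move: x1; rewrite subr0.
  have h : cabs (x n.+2 - x n.+1) <= (1 - q) * rho * q ^+ n.+1.
    rewrite /x !iterS -!/(x _).
    apply: le_trans (stepq _ _ (le_trans IH2 (qr _)) (le_trans IH1 (qr _))) _.
    by rewrite exprS mulrCA; apply: ler_wpM2l.
  split => //; have := cabsD (x n.+2 - x n.+1) (x n.+1); rewrite subrK => h'.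
  apply: le_trans h' _; apply: le_trans (lerD h IH2) _.
  by rewrite (exprS q n.+1) le_eqVlt; apply/orP; left; apply/eqP; ring.
have [l Hl] : exists l, forall n, cabs (x n - l) <= 2 * ((1 - q) * rho / (1 - q)) * q ^+ n.
  by apply: geometric_limit => // n; have [] := xS n.
have E : 2 * ((1 - q) * rho / (1 - q)) = 2 * rho by field; lra.
rewrite E in Hl.
have lr : cabs l <= rho.
  apply/ler_addgt0Pr => e e0.
  have [n Hn] := @exp_small _ q (e / (2 * rho)) q01 ltac:(by rewrite divr_gt0// mulr_gt0).
  rewrite ltr_pdivlMr ?mulr_gt0// in Hn.
  have [h _ _] := xS n; have h' := Hl n.
  have := cabs_tri (x n) l 0; rewrite !subr0 (cabsC l).
  have : 0 <= q ^+ n * rho by rewrite mulr_ge0 ?exprn_ge0// ltW.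
  by lra.
exists l => //; apply/eqP; rewrite -subr_eq0; apply/eqP; apply: cabs_small0 => e e0.
pose K := (k + 2 * cabs a) * (2 * rho) + cabs a * rho.
have K0 : 0 < K by rewrite /K ltr_wpDl ?mulr_gt0// mulr_ge0//; lra.
have [n Hn] := @exp_small _ q (e / K) q01 ltac:(by rewrite divr_gt0).
rewrite ltr_pdivlMr// in Hn.
have [h1 h2 h3] := xS n; have h' := Hl n.
have qn0 : 0 <= q ^+ n by rewrite exprn_ge0.
have xr : cabs (x n) <= rho.
  by apply: le_trans h1 _; rewrite -{2}(mul1r rho) ler_wpM2r ?(ltW rho0)// gerBl.
have Et : t (x n) - v = - (a * (x n.+1 - x n)).
  by rewrite /x iterS -/(x n) /step; field.
have -> : t l - v = (t l - t (x n) - a * (l - x n)) + (a * (l - x n) + (t (x n) - v)).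
  by ring.
rewrite Et; apply: le_trans (cabsD _ _) _.
apply: le_trans (lerD (tk _ _ lr xr) (cabsB _ _)) _; rewrite !cabsM (cabsC l).
apply: le_trans (ltW Hn); rewrite /K.
have g1 : k * cabs (x n - l) <= k * (2 * rho * q ^+ n) by rewrite ler_wpM2l.
have g2 : cabs a * cabs (x n - l) <= cabs a * (2 * rho * q ^+ n).
  by rewrite ler_wpM2l// ltW.
have g3 : cabs a * cabs (x n.+1 - x n) <= cabs a * (rho * q ^+ n).
  rewrite ler_wpM2l ?(ltW a0)//; apply: le_trans h3 _; rewrite ler_wpM2r//.
  by rewrite -{2}(mul1r rho) ler_wpM2r ?(ltW rho0)// gerBl.
have g4 : 0 <= cabs a * (2 * rho * q ^+ n).
  by rewrite !mulr_ge0// ltW.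
have -> : q ^+ n * ((k + 2 * cabs a) * (2 * rho) + cabs a * rho) =
  k * (2 * rho * q ^+ n) + 2 * (cabs a * (2 * rho * q ^+ n)) + cabs a * (rho * q ^+ n).
  by ring.
lra.
Qed.

Lemma strict_lower (R : realType) (t : R[i] -> R[i]) (a z w : R[i]) (k : R) :
  cabs (t z - t w - a * (z - w)) <= k * cabs (z - w) ->
  (cabs a - k) * cabs (z - w) <= cabs (t z - t w).
Proof.
move=> H; have := cabsB (t z - t w) (t z - t w - a * (z - w)).
have -> : t z - t w - (t z - t w - a * (z - w)) = a * (z - w) by ring.
by rewrite cabsM; lra.
Qed.

(** The lower bound [m] on the distortion of [t] makes its derivative at [s v]
    nonzero, and turns the error of the expansion of [t] into one for [s]. *)
Lemma cdiff_inverse (R : realType) (t s : R[i] -> R[i]) (v : R[i]) (r m : R) :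
  0 < r -> 0 < m -> (forall w, cabs (w - v) < r -> t (s w) = w) ->
  (forall w, cabs (w - v) < r -> m * cabs (s w - s v) <= cabs (w - v)) ->
  (exists2 r', 0 < r' & forall z, cabs (z - s v) < r' ->
    m * cabs (z - s v) <= cabs (t z - t (s v))) ->
  cdiff t (s v) -> cdiff s v.
Proof.
move=> r0 m0 ts sm [r' r'0 low] [d Hd].
have dm : m <= cabs d.
  apply/ler_addgt0Pr => e e0; have [s' s'0 Hs] := Hd _ e0.
  pose u := Num.min r' s' / 2.
  have mm : 0 < Num.min r' s' by rewrite lt_min r'0.
  have : Num.min r' s' <= Num.min r' s' by [].
  rewrite {2}/Num.min -/(Num.min r' s') le_min => /andP[ur us].
  have u0 : 0 < u by rewrite /u; lra.
  have Nu : cabs u%:C = u by rewrite cabs_real gtr0_norm.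
  have Eu : s v + u%:C - s v = u%:C by rewrite addrAC subrr add0r.
  have := low (s v + u%:C); rewrite Eu Nu => /(_ ltac:(rewrite /u; lra)) h1.
  have := Hs (s v + u%:C); rewrite Eu Nu => /(_ ltac:(rewrite /u; lra)) h2.
  have := cabsD (t (s v + u%:C) - t (s v) - d * u%:C) (d * u%:C).
  rewrite subrK cabsM Nu => h3.
  by rewrite -(ler_pM2r u0); lra.
have d0 : d != 0 by rewrite -cabs_gt0; lra.
exists d^-1 => e e0; have [s' s'0 Hs] := Hd (e * m * m) ltac:(by rewrite !mulr_gt0).
exists (Num.min r (s' * m)); first by rewrite lt_min r0 mulr_gt0.
move=> w; rewrite lt_min => /andP[wr ws].
have vr : cabs (v - v) < r by rewrite subrr cabs0.
have sw : cabs (s w - s v) <= cabs (w - v) / m.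
  by rewrite ler_pdivlMr// mulrC; exact: sm.
have := Hs (s w); rewrite !ts// => /(_ _) h.
have {}h : cabs (w - v - d * (s w - s v)) <= e * m * m * cabs (s w - s v).
  by apply: h; apply: le_lt_trans sw _; rewrite ltr_pdivrMr.
have -> : s w - s v - d^-1 * (w - v) = - ((w - v - d * (s w - s v)) / d) by field.
rewrite cabsN cabsM cabsV ler_pdivrMr; last by lra.
apply: le_trans h _.
have {}sw : m * cabs (s w - s v) <= cabs (w - v) by exact: sm.
have em : 0 <= e * m by rewrite mulr_ge0// ltW.
apply: (@le_trans _ _ (e * m * cabs (w - v))).
  by rewrite -mulrA; apply: ler_wpM2l.
by rewrite mulrAC; apply: ler_wpM2l => //; rewrite mulr_ge0 ?cabs_ge0// ltW.
Qed.

(** The derivative of the exponential at [0] is [1], so that it can be inverted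
    there; the function obtained is a branch of the logarithm. *)
Lemma local_log (R : realType) (eps : R) : 0 < eps -> exists (r : R) (L : R[i] -> R[i]), [/\ 0 < r,
  forall w, cabs (w - 1) < r -> cexp (L w) = w,
  forall w, cabs (w - 1) < r -> cdiff L w,
  forall w, cabs (w - 1) < r -> cabs (L w) <= 2 * cabs (w - 1) &
  forall w, cabs (w - 1) < r -> cabs (L w) < eps].
Proof.
move=> eps0.
have M2 (z : R[i]) : cabs z <= 1 -> cabs (cexp z) <= expR 1.
  move=> z1; rewrite /cexp cabsM cabs_expi mulr1 cabs_real ger0_norm ?expR_ge0//.
  by rewrite ler_expR; apply: le_trans (ler_norm _) (le_trans (Re_le_cabs _) z1).
pose r := (1 / 12 : R); have r0 : 0 < r by rewrite /r; lra.
pose K := 4 * expR 1 / r ^+ 2.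
have K0 : 0 < K by rewrite divr_gt0 ?exprn_gt0// mulr_gt0// expR_gt0.
have lip (z w : R[i]) : cabs z <= r -> cabs w <= r ->
    cabs (cexp z - cexp w) <= K * cabs (z - w).
  move=> zr wr.
  apply: (@derivative_lip R (@cexp R) 0 r (expR 1) r0 _ _ z w) => //.
  - by move=> u _; exact: cexp_cdiff.
  - by move=> u; rewrite subr0 => ur; apply: M2; move: ur; rewrite /r; lra.
  - by rewrite subr0.
  - by rewrite subr0.
  - exact: cexp_deriv.
  - exact: cexp_deriv.
pose rho := Num.min (Num.min r (eps / 2)) (1 / (2 * K)).
have rho0 : 0 < rho by rewrite !lt_min r0 !divr_gt0// mulr_gt0.
have : rho <= rho by []. rewrite {2}/rho !le_min => /andP[/andP[rr re] rK].
have strict : forall z w : R[i], cabs z <= rho -> cabs w <= rho ->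
    cabs (cexp z - cexp w - 1 * (z - w)) <= 1 / 2 * cabs (z - w).
  move=> z w zr wr.
  apply: (@strict_derivative _ _ 0 _ rho); rewrite ?subr0//.
    exact: cexp_deriv0.
  move=> u; rewrite subr0 => ur; exists (cexp u); first exact: cexp_deriv.
  rewrite -(cexp0 R); apply: le_trans (lip u 0 _ _) _; rewrite ?cabs0; [lra|lra|].
  rewrite subr0; apply: (@le_trans _ _ (K * rho)); first by rewrite ler_wpM2l// ltW.
  by move: rK; rewrite ler_pdivlMr; lra.
have ex w : exists l, cabs (w - 1) < rho / 2 -> cabs l <= rho /\ cexp l = w.
  have [wr|] := pselect (cabs (w - 1) < rho / 2); last by exists 0.
  have [|||l lr lw] := @local_surjective _ (@cexp R) 1 w rho (1 / 2) rho0 _ _ strict.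
  - by lra.
  - by rewrite cabs1; lra.
  - by rewrite cexp0 cabs1; lra.
  - by exists l.
have [L HL] := choice ex.
have L1 : L 1 = 0.
  have [l1 l2] := HL 1 ltac:(by rewrite subrr cabs0; lra).
  have := strict_lower (strict (L 1) 0 l1 ltac:(by rewrite cabs0 ltW)).
  rewrite l2 cexp0 subrr cabs0 cabs1 subr0 => h; apply: cabs0_eq0.
  by apply/eqP; rewrite eq_le cabs_ge0 andbT; lra.
have Lw z w : cabs (z - 1) < rho / 2 -> cabs (w - 1) < rho / 2 ->
    1 / 2 * cabs (L z - L w) <= cabs (z - w).
  move=> /HL[z1 z2] /HL[w1 w2]; have := strict_lower (strict _ _ z1 w1).
  by rewrite z2 w2 cabs1; lra.
exists (rho / 4), L; split.
- by lra.
- by move=> w wr; have [] := HL w ltac:(lra).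
- move=> w wr; have w2 : cabs (w - 1) < rho / 2 by lra.
  apply: (@cdiff_inverse _ (@cexp R) L w (rho / 4) (1 / 2)); [lra|lra| | | |].
  + by move=> u ur; have [] := HL u ltac:(have := cabs_tri w u 1; lra).
  + by move=> u ur; apply: Lw; have := cabs_tri w u 1; lra.
  + have [w1 w3] := HL w w2; exists (rho / 4); first by lra.
    move=> z zr; have Lwr : cabs (L w) <= rho / 2.
      have := Lw w 1 w2 ltac:(by rewrite subrr cabs0; lra).
      by rewrite L1 subr0; lra.
    have := strict_lower (strict z (L w) _ w1); rewrite cabs1 => h.
    apply: le_trans (h _); first by lra.
    by have := cabs_tri (L w) z 0; rewrite !subr0; lra.
  + exact: cexp_cdiff.
- move=> w wr; have := Lw w 1 ltac:(lra) ltac:(by rewrite subrr cabs0; lra).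
  by rewrite L1 subr0; lra.
- by move=> w wr; have [] := HL w ltac:(lra); lra.
Qed.

(** * Lifting the circle map to the line *)

Lemma mean_value_right (R : realType) (f df : R -> R) (a x y : R) :
  (forall z, a < z -> is_derive z 1 f (df z)) -> a < x -> a < y ->
  exists c, [/\ Num.min x y <= c, c <= Num.max x y & f y - f x = df c * (y - x)].
Proof.
move=> fd; have fc : {in `]a, +oo[, forall z, derivable f z 1}.
  by move=> z; rewrite in_itv /= andbT => /fd[].
have main u v : a < u -> u <= v ->
    exists c, [/\ u <= c, c <= v & f v - f u = df c * (v - u)].
  move=> au uv; have [||c] := @MVT_segment R f df u v uv.
  - by move=> z; rewrite in_itv /= => /andP[uz _]; apply: fd; exact: lt_trans uz.
  - apply: derivable_within_continuous => z; rewrite in_itv /= => /andP[uz _].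
    by apply: fc; rewrite in_itv /= andbT; exact: lt_le_trans uz.
  - by rewrite in_itv /= => /andP[uc cv] E; exists c.
move=> ax ay; case: (leP x y) => [xy|/ltW yx].
  by have [c [c1 c2 c3]] := main x y ax xy; exists c.
have [c [c1 c2 c3]] := main y x ay yx; exists c; split => //.
by rewrite -opprB c3 -mulrN opprB.
Qed.

Lemma mean_value (R : realType) (f df : R -> R) (x y : R) :
  (forall z : R, is_derive z 1 f (df z)) ->
  exists c, [/\ Num.min x y <= c, c <= Num.max x y & f y - f x = df c * (y - x)].
Proof.
move=> fd; have : Num.min x y - 1 < Num.min x y by lra.
rewrite lt_min => /andP[h1 h2].
by apply: (@mean_value_right R f df (Num.min x y - 1)) => // z _.
Qed.

(** The integrals from [- n], normalised at [0], agree where they are defined,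
    since their difference has zero derivative. *)
Lemma primitive (R : realType) (k : R -> R) (v : R) : continuous k ->
  exists2 F : R -> R, F 0 = v & forall x : R, is_derive x 1 F (k x).
Proof.
move=> kc; pose J n (x : R) := (\int[@lebesgue_measure R]_(t in `[(- n.+1%:R), x]) k t)%R.
have HJ n (x : R) : - n.+1%:R < x -> is_derive x 1 (J n) (k x).
  move=> nx; have [||||d E] := @continuous_FTC1_closed R k (- n.+1%:R) x (x + 1).
  - by lra.
  - apply: continuous_compact_integrable; first exact: segment_compact.
    exact: continuous_subspaceT.
  - exact: nx.
  - exact: kc.
  - by split; [exact: d | rewrite -derive1E].
have JE n m (x : R) : (n <= m)%N -> - n.+1%:R < x -> J n x - J n 0 = J m x - J m 0.
  move=> nm nx.
  have nm' : - (m.+1%:R : R) <= - n.+1%:R by rewrite lerN2 ler_nat ltnS.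
  have n0 : - (n.+1%:R : R) < 0 by rewrite oppr_lt0 ltr0n.
  have H (z : R) : - n.+1%:R < z -> is_derive z 1 (fun x => J n x - J m x) 0.
    move=> nz; have h1 := HJ n z nz; have h2 := HJ m z (le_lt_trans nm' nz).
    by have := is_deriveB h1 h2; rewrite subrr.
  have [c [_ _]] := @mean_value_right _ _ (fun=> 0) _ 0 x H n0 nx.
  by rewrite mul0r => /eqP; rewrite subr_eq0 => /eqP E; lra.
pose N (x : R) := Num.truncn (`|x| + 1).
have NP x : `|x| + 1 < (N x).+1%:R by rewrite truncnS_gt.
exists (fun x => J (N x) x - J (N x) 0 + v); first by rewrite subrr add0r.
move=> x; apply/is_derive_eps => e e0.
have Nx : - (N x).+1%:R < x.
  by have := NP x; have := ler_norm (- x); rewrite normrN; lra.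
have /is_derive_eps/(_ e e0)[r r0 Hr] := HJ (N x) x Nx.
exists (Num.min r 1); first by rewrite lt_min r0 ltr01.
move=> y; rewrite lt_min => /andP[yr y1].
have xy : - (N x).+1%:R < y.
  have := NP x; have := ler_norm (- x); rewrite normrN.
  by move: y1; rewrite ltr_norml; lra.
have Ny : - (N y).+1%:R < y.
  by have := NP y; have := ler_norm (- y); rewrite normrN; lra.
have -> : J (N y) y - J (N y) 0 = J (N x) y - J (N x) 0.
  have [h|/ltnW h] := leqP (N y) (N x); first exact: JE.
  by apply/esym/JE.
have -> : J (N x) y - J (N x) 0 + v - (J (N x) x - J (N x) 0 + v) =
  J (N x) y - J (N x) x by ring.
exact: Hr.
Qed.

Lemma expi_surj (R : realType) (z : R[i]) : cabs z = 1 -> exists x, expi x = z.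
Proof.
case: z => a b z1; have ab : a ^+ 2 + b ^+ 2 = 1.
  have h : 0 <= a ^+ 2 + b ^+ 2 by rewrite addr_ge0 ?sqr_ge0.
  by rewrite -(sqr_sqrtr h); move: z1; rewrite cabs_def /= => ->; rewrite expr1n.
have a1 : -1 <= a <= 1.
  have := sqr_ge0 b => b0; apply/andP; split; nra.
have s : sin (acos a) = `|b|.
  by rewrite sin_acos// -ab addrAC subrr add0r sqrtr_sqr.
have c : cos (acos a) = a by rewrite acosK// in_itv.
have [b0|b0] := leP 0 b.
  by exists (acos a); rewrite /expi c s ger0_norm.
by exists (- acos a); rewrite /expi cosN sinN c s ltr0_norm// opprK.
Qed.

Lemma expi_periodic (R : realType) (x : R) : expi (x + pi *+ 2) = expi x.
Proof. by rewrite /expi cosD2pi sinD2pi. Qed.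

Lemma periodic_int (R : realType) (A : Type) (f : R -> A) (p : R) :
  (forall x, f (x + p) = f x) -> forall (j : int) x, f (x + j%:~R * p) = f x.
Proof.
move=> fp; have fn (n : nat) x : f (x + n%:R * p) = f x.
  elim: n => [|n IH]; first by rewrite mul0r addr0.
  by rewrite -[n.+1]addn1 natrD mulrDl mul1r addrA fp.
move=> [n|n] x; first exact: fn.
by rewrite NegzE mulrNz mulNr -(fn n.+1) subrK.
Qed.

(** Compactness of a period makes a radius, found at each point and inherited
    by nearby points, uniform. *)
Lemma uniform_radius (R : realType) (Q : R -> R -> Prop) :
  (forall y, exists2 rho, 0 < rho & Q rho y) ->
  (forall rho y y', 0 < rho -> Q rho y -> `|y' - y| <= rho / 2 -> Q (rho / 2) y') ->
  (forall rho rho' y, 0 < rho' -> rho' <= rho -> Q rho y -> Q rho' y) ->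
  (forall rho y, Q rho (y + pi *+ 2) = Q rho y) ->
  exists2 rho, 0 < rho & forall y, Q rho y.
Proof.
move=> Qex Qnear Qmon Qper.
have K : near_covering `[0, (pi *+ 2 : R)] by apply/compact_near_coveringP/segment_compact.
have := K _ (0 : R)^'+ Q _ => /(_ _)[].
  move=> x _; have [rho rho0 Hx] := Qex x.
  exists (ball x (rho / 2), [set r | 0 < r < rho / 2]) => /=.
    split; first by apply: nbhsx_ballx; lra.
    near=> r => /=; apply/andP; split; near: r.
      exact: nbhs_right_gt.
    by apply: nbhs_right_lt; lra.
  move=> [y r] /= [yx /andP[r0 rr]].
  apply: (@Qmon (rho / 2)) => //; first exact: ltW.
  by apply: (Qnear _ x) => //; rewrite distrC ltW.
move=> e /= e0 He; exists (e / 2); first lra.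
have He2 : `[0, pi *+ 2] `<=` Q (e / 2).
  apply: He => /=; last by lra.
  by rewrite sub0r normrN gtr0_norm; lra.
move=> y.
have p0 : 0 < pi *+ 2 :> R by exact: twopi_gt0.
pose j := Num.floor (y / (pi *+ 2)).
rewrite -(periodic_int (Qper (e / 2)) (- j)).
apply: He2; rewrite /= in_itv /=.
have /andP[j1 j2] := floor_itv (y / (pi *+ 2)).
rewrite mulrNz mulNr; move: j1 j2; rewrite -/j ler_pdivlMr// ltr_pdivrMr//.
by rewrite intrD mulrDl mul1r; lra.
Unshelve. all: by end_near. Qed.

(** The function [tau] of a real variable extends to a holomorphic function on
    the disc of radius [rho] about [y], with a bounded Lipschitz derivative. A
    single parameter serves as radius and as inverse bound, so that the
    condition weakens as the parameter decreases. *)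
Definition extends_at (R : realType) (tau : R -> R[i]) (rho y : R) :=
  exists t : R[i] -> R[i], [/\ forall z, cabs z <= rho -> cdiff t z,
    forall z d, cabs z <= rho -> cderiv_at t z d -> cabs d <= rho^-1,
    forall z w d d', cabs z <= rho -> cabs w <= rho ->
      cderiv_at t z d -> cderiv_at t w d' ->
      cabs (d - d') <= rho^-1 * cabs (z - w) &
    forall s : R, `|s| <= rho -> t s%:C = tau (y + s)].

Lemma holomorphic_extends_at (R : realType) (tau : R -> R[i]) (y : R)
    (t : R[i] -> R[i]) (r M : R) :
  0 < r -> (forall z, cabs z < r -> cdiff t z) ->
  (forall z, cabs z < r -> cabs (t z) <= M) ->
  (forall s : R, `|s| < r -> t s%:C = tau (y + s)) ->
  exists2 rho, 0 < rho & extends_at tau rho y.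
Proof.
(* The estimates on the disc of radius [q] use that of radius [12 * q]. *)
move=> r0 td tM ts; pose q := r / 24; have q0 : 0 < q by rewrite /q; lra.
have M0 : 0 <= M by apply: le_trans (tM 0 _); rewrite ?cabs_ge0 ?cabs0.
have A0 : 0 <= 4 * M / q by rewrite divr_ge0 ?(ltW q0)//; lra.
have B0 : 0 <= 4 * M / q ^+ 2 by rewrite divr_ge0 ?exprn_ge0 ?(ltW q0)//; lra.
pose rho := Num.min q ((4 * M / q + 4 * M / q ^+ 2 + 1)^-1).
have rho0 : 0 < rho by rewrite lt_min q0 invr_gt0; lra.
have : rho <= rho by []. rewrite {2}/rho le_min => /andP[rq rV].
have {}rV : 4 * M / q + 4 * M / q ^+ 2 + 1 <= rho^-1.
  by rewrite -[leLHS]invrK lef_pV2// posrE invr_gt0; lra.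
exists rho => //; exists t; split.
- by move=> z zr; apply: td; rewrite /q in rq; lra.
- move=> z d zr Hd; apply: (@le_trans _ _ (4 * M / q)); last by lra.
  have near u : cabs (u - z) <= 2 * q -> cabs u < r.
    by have := cabs_tri z u 0; rewrite !subr0 /q in rq *; lra.
  by apply: cauchy_derivative Hd => // u /near; [exact: td | exact: tM].
- move=> z w d d' zr wr Hd Hd'; apply: (@le_trans _ _ (4 * M / q ^+ 2 * cabs (z - w))).
    have near u : cabs (u - 0) <= 12 * q -> cabs u < r.
      by rewrite subr0 /q; lra.
    apply: (@derivative_lip _ t 0 q M q0 _ _ z w) => //; rewrite ?subr0; try lra.
      by move=> u /near; exact: td.
    by move=> u /near; exact: tM.
  by rewrite ler_wpM2r ?cabs_ge0//; lra.
- by move=> s sr; apply: ts; rewrite /q in rq; lra.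
Qed.

Lemma extends_at_le (R : realType) (tau : R -> R[i]) (rho rho' y : R) :
  0 < rho' -> rho' <= rho -> extends_at tau rho y -> extends_at tau rho' y.
Proof.
move=> r0 rr [t [t1 t2 t3 t4]]; exists t.
have rV : rho^-1 <= rho'^-1 by rewrite lef_pV2// posrE; lra.
split.
- by move=> z zr; apply: t1; lra.
- by move=> z d zr Hd; apply: le_trans (t2 z d _ Hd) rV; lra.
- move=> z w d d' zr wr Hd Hd'; apply: le_trans (t3 z w d d' _ _ Hd Hd') _; try lra.
  by rewrite ler_wpM2r ?cabs_ge0.
- by move=> s sr; apply: t4; lra.
Qed.

Lemma cderiv_shift (R : realType) (t : R[i] -> R[i]) (u z d : R[i]) :
  cderiv_at (fun w => t (w + u)) z d <-> cderiv_at t (z + u) d.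
Proof.
split=> H e e0; have [r r0 Hr] := H e e0; exists r => // w wr.
  have := Hr (w - u); rewrite subrK.
  by have -> : w - u - z = w - (z + u); [ring | exact].
have := Hr (w + u); have -> : w + u - (z + u) = w - z by ring.
exact.
Qed.

Lemma extends_at_near (R : realType) (tau : R -> R[i]) (rho y y' : R) :
  0 < rho -> extends_at tau rho y -> `|y' - y| <= rho / 2 ->
  extends_at tau (rho / 2) y'.
Proof.
move=> r0 [t [t1 t2 t3 t4]] yy; exists (fun z => t (z + (y' - y)%:C)).
have rV : rho^-1 <= (rho / 2)^-1 by rewrite lef_pV2 ?posrE; lra.
have near z : cabs z <= rho / 2 -> cabs (z + (y' - y)%:C) <= rho.
  by move=> zr; have := cabsD z (y' - y)%:C; rewrite cabs_real; lra.
split.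
- by move=> z /near/t1[d Hd]; exists d; apply/cderiv_shift.
- move=> z d /near zr /cderiv_shift Hd; exact: le_trans (t2 _ _ zr Hd) rV.
- move=> z w d d' /near zr /near wr /cderiv_shift Hd /cderiv_shift Hd'.
  apply: le_trans (t3 _ _ _ _ zr wr Hd Hd') _.
  have -> : z + (y' - y)%:C - (w + (y' - y)%:C) = z - w by ring.
  by rewrite ler_wpM2r ?cabs_ge0.
- move=> s sr; rewrite -rmorphD t4; first by congr tau; ring.
  by apply: le_trans (ler_normD _ _) _; lra.
Qed.

Lemma extends_uniform (R : realType) (tau : R -> R[i]) :
  (forall x, tau (x + pi *+ 2) = tau x) ->
  (forall y, exists2 rho, 0 < rho & extends_at tau rho y) ->
  exists2 rho, 0 < rho & forall y, extends_at tau rho y.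
Proof.
move=> tp H; apply: uniform_radius => //.
- by move=> rho y y' r0 Hy; exact: extends_at_near.
- by move=> rho rho' y r0 rr; exact: extends_at_le.
- move=> rho y; apply/propext; split=> -[t [t1 t2 t3 t4]]; exists t; split => // s /t4 ->.
    by rewrite addrAC tp.
  by rewrite addrAC tp.
Qed.

Lemma circle_analytic_extends (R : realType) (T : R[i] -> R[i]) :
  circle_analytic T ->
  exists2 rho, 0 < rho & forall y, extends_at (fun x => T (expi x)) rho y.
Proof.
move=> Ta; apply: extends_uniform; first by move=> x; rewrite expi_periodic.
move=> y; have [a [r [r0 Hr]]] := Ta (expi y) (expi_circle y).
have aS s : `|s| < r -> sums_to (fun n => a n * s%:C ^+ n) (T (expi y * expi s)).
  by move=> /Hr; exact: cvg_sums_to.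
have [rho [M [t [rho0 t1 t2 t3]]]] := power_series r0 aS.
by apply: (holomorphic_extends_at rho0 t1 t2) => s /t3 ->; rewrite expiD.
Qed.

Definition rderiv_at (R : realType) (tau : R -> R[i]) (y : R) (d : R[i]) :=
  forall e, 0 < e -> exists2 r, 0 < r & forall x, `|x - y| < r ->
    cabs (tau x - tau y - d * (x - y)%:C) <= e * `|x - y|.

Lemma rderiv_unique (R : realType) (tau : R -> R[i]) (y : R) (d d' : R[i]) :
  rderiv_at tau y d -> rderiv_at tau y d' -> d = d'.
Proof.
move=> H H'; apply/eqP; rewrite -subr_eq0; apply/eqP; apply: cabs_small0 => e e0.
have e2 : 0 < e / 2 by lra.
have [r r0 Hr] := H _ e2; have [s s0 Hs] := H' _ e2.
pose m := Num.min r s; pose u := m / 2.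
have m0 : 0 < m by rewrite lt_min r0.
have : m <= m by []. rewrite {2}/m le_min => /andP[mr ms].
have u0 : 0 < u by rewrite /u; lra.
have Nu : `|u| = u by rewrite gtr0_norm.
have Eu : y + u - y = u by ring.
have := Hr (y + u); rewrite Eu Nu => /(_ ltac:(rewrite /u; lra)) h1.
have := Hs (y + u); rewrite Eu Nu => /(_ ltac:(rewrite /u; lra)) h2.
rewrite -(ler_pM2r u0) -{1}Nu -cabs_real -cabsM.
set A := tau (y + u) - tau y in h1 h2.
have -> : (d - d') * u%:C = (A - d' * u%:C) - (A - d * u%:C) by ring.
by apply: le_trans (cabsB _ _) _; lra.
Qed.

Lemma extension_rderiv (R : realType) (tau : R -> R[i]) (rho y s : R)
    (t : R[i] -> R[i]) (d : R[i]) :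
  (forall s : R, `|s| <= rho -> t s%:C = tau (y + s)) -> `|s| < rho ->
  cderiv_at t s%:C d -> rderiv_at tau (y + s) d.
Proof.
move=> ts sr Hd e e0; have [r r0 Hr] := Hd e e0.
exists (Num.min r (rho - `|s|)); first by rewrite lt_min r0 subr_gt0.
move=> x; rewrite lt_min => /andP[xr xs].
have xyr : `|x - y| <= rho.
  have -> : x - y = (x - (y + s)) + s by ring.
  by apply: le_trans (ler_normD _ _) _; lra.
have := Hr (x - y)%:C; rewrite -rmorphB (_ : x - y - s = x - (y + s)); last by ring.
rewrite cabs_real => /(_ xr); rewrite !ts//; last exact: ltW.
by have -> : y + (x - y) = x by ring.
Qed.

Lemma rderiv_Re (R : realType) (tau : R -> R[i]) (y : R) (d : R[i]) :
  rderiv_at tau y d -> is_derive y 1 (fun x => Re (tau x)) (Re d).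
Proof.
move=> H; apply/is_derive_eps => e /H[r r0 Hr]; exists r => // x /Hr.
apply: le_trans; apply: le_trans (Re_le_cabs _).
rewrite !raddfB /=; case: d {H Hr} => a b /=.
by rewrite subrr mulr0 subr0.
Qed.

Lemma rderiv_Im (R : realType) (tau : R -> R[i]) (y : R) (d : R[i]) :
  rderiv_at tau y d -> is_derive y 1 (fun x => Im (tau x)) (Im d).
Proof.
move=> H; apply/is_derive_eps => e /H[r r0 Hr]; exists r => // x /Hr.
apply: le_trans; apply: le_trans (Im_le_cabs _).
rewrite !raddfB /=; case: d {H Hr} => a b /=.
by rewrite subrr mulr0 add0r.
Qed.

Lemma rderiv_circle_derive (R : realType) (T : R[i] -> R[i]) (y : R) (d : R[i]) :
  rderiv_at (fun x => T (expi x)) y d -> circle_derive T (expi y) = d.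
Proof.
move=> H; apply: cvg_lim; first exact: norm_hausdorff.
apply/cvgrPdist_lt => e' /real_pos_complex[e e0 ->].
have [r r0 Hr] := H (e / 2) ltac:(lra).
apply/nbhs_ballP; exists r => // s; rewrite /ball /= sub0r normrN => sr s0.
have sC : s%:C != 0 :> R[i] by rewrite -cabs_gt0 cabs_real normr_gt0.
have := Hr (y + s); rewrite expiD (_ : y + s - y = s); last by ring.
move=> /(_ sr) h; rewrite normE ltcR cabsC.
have -> : (T (expi y * expi s) - T (expi y)) / s%:C - d =
  (T (expi y * expi s) - T (expi y) - d * s%:C) / s%:C by field.
rewrite cabsM cabsV cabs_real ltr_pdivrMr ?normr_gt0//.
by apply: le_lt_trans h _; rewrite ltr_pM2r ?normr_gt0//; lra.
Qed.

(** A curve on the circle has a velocity orthogonal to its position. *)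
Lemma circle_map_rotation (R : realType) (tau : R -> R[i]) (y : R) (d : R[i]) :
  (forall x, cabs (tau x) = 1) -> rderiv_at tau y d ->
  d = (0 +i* (Re (tau y) * Im d - Im (tau y) * Re d)) * tau y.
Proof.
move=> t1 Hd; have hc := rderiv_Re Hd; have hs := rderiv_Im Hd.
have sq x : Re (tau x) * Re (tau x) + Im (tau x) * Im (tau x) = 1.
  rewrite -!expr2 -[LHS]sqr_sqrtr ?addr_ge0 ?sqr_ge0// -cabs_def t1.
  by rewrite expr1n.
have E : Re (tau y) * Re d + Im (tau y) * Im d = 0.
  have h := is_deriveD (is_deriveM hc hc) (is_deriveM hs hs).
  have E : ((fun x => Re (tau x)) * (fun x => Re (tau x)) +
     (fun x => Im (tau x)) * (fun x => Im (tau x)))%R = cst 1.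
    by apply/funext => x; exact: sq.
  rewrite E in h; have := @derive_val _ _ _ _ _ _ _ h; rewrite derive_cst /GRing.scale /=.
  by lra.
have S := sq y; case: (tau y) d E S {Hd hc hs sq t1} => a b [u v] /= E S.
apply/eqP; rewrite eq_complex /=; apply/andP; split; apply/eqP.
  have -> : 0 * a - (a * v - b * u) * b = u * (a * a + b * b) - a * (a * u + b * v) by ring.
  by rewrite S E; ring.
have -> : 0 * b + (a * v - b * u) * a = v * (a * a + b * b) - b * (a * u + b * v) by ring.
by rewrite S E; ring.
Qed.

(** An angle for [tau] is a primitive of its angular speed: rotating [tau] back
    by that angle gives a function with zero derivative. *)
Lemma angle_lift (R : realType) (tau dtau : R -> R[i]) :
  (forall x, cabs (tau x) = 1) -> (forall y, rderiv_at tau y (dtau y)) ->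
  let k y := Re (tau y) * Im (dtau y) - Im (tau y) * Re (dtau y) in
  continuous k ->
  exists2 F : R -> R, (forall x, expi (F x) = tau x) &
    forall x : R, is_derive x 1 F (k x).
Proof.
move=> t1 td k kc; have [v Hv] := expi_surj (t1 0).
have [F F0 Fd] := primitive v kc; exists F => // x.
pose c x := Re (tau x); pose s x := Im (tau x).
have dE y : dtau y = (0 +i* k y) * tau y by exact: circle_map_rotation.
have cd (y : R) : is_derive y 1 c (- (k y * s y)).
  have := rderiv_Re (td y); rewrite {1}dE /c /s; case: (tau y) => a b /=.
  by rewrite mul0r add0r.
have sd (y : R) : is_derive y 1 s (k y * c y).
  have := rderiv_Im (td y); rewrite {1}dE /c /s; case: (tau y) => a b /=.
  by rewrite mul0r add0r.
have sq : c x * c x + s x * s x = 1.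
  rewrite -!expr2 -[LHS]sqr_sqrtr ?addr_ge0 ?sqr_ge0// -cabs_def t1.
  by rewrite expr1n.
pose E y := cos (F y) * c y + sin (F y) * s y.
have E1 : E x = 1.
  have -> : 1 = E 0.
    rewrite /E F0 /c /s -Hv /=; have := cos2Dsin2 v; rewrite !expr2; lra.
  apply: is_derive_0_is_cst => y.
  have Hcos : is_derive y 1 (cos \o F) (- sin (F y) * k y).
    by apply: is_derive1_comp; exact: Fd.
  have Hsin : is_derive y 1 (sin \o F) (cos (F y) * k y).
    by apply: is_derive1_comp; exact: Fd.
  have := is_deriveD (is_deriveM Hcos (cd y)) (is_deriveM Hsin (sd y)).
  rewrite /GRing.scale /= => h; apply: (is_derive_eq h); ring.
have cs := cos2Dsin2 (F x); rewrite !expr2 in cs.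
pose G := sin (F x) * c x - cos (F x) * s x.
have G0 : G = 0.
  have : G * G = (cos (F x) * cos (F x) + sin (F x) * sin (F x)) * (c x * c x + s x * s x)
     - E x * E x by rewrite /G /E; ring.
  by rewrite cs sq E1 !mulr1 subrr => /eqP; rewrite mulf_eq0 orbb => /eqP.
rewrite /expi (complexE (tau x)) -/(c x) -/(s x); apply/eqP.
rewrite eq_complex /=.
apply/andP; split; apply/eqP.
  have -> : cos (F x) = c x * E x + s x * (- G) * 1 + cos (F x) * (1 - (c x * c x + s x * s x)).
    by rewrite /E /G; ring.
  by rewrite sq E1 G0; ring.
have -> : sin (F x) = s x * E x + c x * G + sin (F x) * (1 - (c x * c x + s x * s x)).
  by rewrite /E /G; ring.
by rewrite sq E1 G0; ring.
Qed.

Lemma extends_rderiv (R : realType) (tau : R -> R[i]) (rho : R) :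
  0 < rho -> (forall y, extends_at tau rho y) ->
  exists dtau : R -> R[i], [/\ forall y, rderiv_at tau y (dtau y),
    forall y, cabs (dtau y) <= rho^-1 &
    forall x y, `|x - y| < rho -> cabs (dtau x - dtau y) <= rho^-1 * `|x - y|].
Proof.
move=> r0 H.
have ex y : exists d, rderiv_at tau y d.
  have [t [t1 _ _ t4]] := H y; have [d Hd] := t1 0 ltac:(by rewrite cabs0 ltW).
  exists d; rewrite -[y]addr0; apply: (extension_rderiv t4) => //.
  by rewrite normr0.
have [dtau Hd] := choice ex; exists dtau.
have along y t : (forall z : R[i], cabs z <= rho -> cdiff t z) ->
    (forall s : R, `|s| <= rho -> t s%:C = tau (y + s)) ->
    forall s : R, `|s| < rho -> cderiv_at t s%:C (dtau (y + s)).
  move=> t1 t4 s sr; have [d dE] := t1 s%:C ltac:(by rewrite cabs_real ltW).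
  by rewrite -(rderiv_unique (extension_rderiv t4 sr dE) (Hd (y + s))).
split => //.
- move=> y; have [t [t1 t2 t3 t4]] := H y; rewrite -[y]addr0.
  apply: (t2 0); first by rewrite cabs0 ltW.
  by apply: (along y t) => //; rewrite normr0.
- move=> x y xy; have [t [t1 t2 t3 t4]] := H y.
  have hy : cderiv_at t (0 : R)%:C (dtau (y + 0)) by apply: along; rewrite ?normr0.
  have hx : cderiv_at t (x - y)%:C (dtau (y + (x - y))) by exact: along.
  rewrite addr0 in hy; rewrite (_ : y + (x - y) = x) in hx; last by ring.
  apply: le_trans (t3 _ _ _ _ _ _ hx hy) _; rewrite ?cabs_real ?normr0 ?(ltW xy) ?(ltW r0)//.
  by rewrite -rmorphB subr0 cabs_real.
Qed.

Lemma rderiv_lip (R : realType) (tau dtau : R -> R[i]) (L : R) :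
  (forall y, rderiv_at tau y (dtau y)) -> (forall y, cabs (dtau y) <= L) ->
  forall x y, cabs (tau x - tau y) <= 2 * L * `|x - y|.
Proof.
move=> Hd HL x y.
have [c1 [_ _ E1]] := @mean_value _ _ _ y x (fun y => rderiv_Re (Hd y)).
have [c2 [_ _ E2]] := @mean_value _ _ _ y x (fun y => rderiv_Im (Hd y)).
apply: le_trans (cabs_le_ReIm _) _; rewrite !raddfB /= E1 E2 !normrM.
rewrite -mulrDl ler_wpM2r//.
have := le_trans (Re_le_cabs _) (HL c1); have := le_trans (Im_le_cabs _) (HL c2).
by lra.
Qed.

Lemma lip_continuous (R : realType) (k : R -> R) (B : R) :
  (forall x y, `|k x - k y| <= B * `|x - y|) -> continuous k.
Proof.
move=> kB x; apply/cvgrPdist_lt => e e0.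
have B0 : 0 < `|B| + 1 by rewrite ltr_wpDl.
exists (e / (`|B| + 1)); first by rewrite /= divr_gt0.
move=> y /=; rewrite ltr_pdivlMr// => xy; apply: le_lt_trans (kB x y) _.
apply: le_lt_trans xy; rewrite mulrC ler_wpM2l//.
by apply: le_trans (ler_norm B) _; rewrite lerDl.
Qed.

(** The speed of [T] is the modulus of the derivative of [F], which is therefore
    bounded below by the infimum, and above by the uniform bounds of the local
    extensions. *)
Lemma lift_exists (R : realType) (T : R[i] -> R[i]) (rho : R) :
  (forall z, unit_circle z -> unit_circle (T z)) ->
  1 < inf [set circle_speed T z | z in @unit_circle R] ->
  0 < rho -> (forall y, extends_at (fun x => T (expi x)) rho y) ->
  exists (F k : R -> R) (lam B : R), [/\ 1 < lam, 0 < B,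
    forall x, expi (F x) = T (expi x),
    forall x : R, is_derive x 1 F (k x) &
    [/\ forall x, lam <= `|k x|, forall x, `|k x| <= B,
      forall x y, `|k x - k y| <= B * `|x - y| &
      forall y d, rderiv_at (fun x => T (expi x)) y d -> lam <= cabs d]].
Proof.
move=> Tc Tinf r0 Te.
have [dtau [d1 d2 d3]] := extends_rderiv r0 Te.
pose tau x := T (expi x).
have t1 x : cabs (tau x) = 1.
  have := Tc _ (expi_circle x); rewrite /unit_circle /= normE => h.
  by have := congr1 (@complex.Re R) h.
pose k y := Re (tau y) * Im (dtau y) - Im (tau y) * Re (dtau y).
have dE y : dtau y = (0 +i* k y) * tau y by exact: circle_map_rotation.
have cabs_im (a : R) : cabs (0 +i* a) = `|a|.
  by rewrite cabs_def /= expr0n add0r sqrtr_sqr.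
have kd y : `|k y| = cabs (dtau y) by rewrite dE cabsM t1 mulr1 cabs_im.
have tL := rderiv_lip d1 d2.
have rV : 0 < rho^-1 by rewrite invr_gt0.
pose B := rho^-1 + 2 * rho^-1 ^+ 2.
have B0 : rho^-1 <= B by rewrite /B lerDl mulr_ge0 ?exprn_ge0// ltW.
have kB x y : `|k x - k y| <= B * `|x - y|.
  have [xy|xy] := ltP `|x - y| rho.
    have -> : `|k x - k y| = cabs ((0 +i* (k x - k y)) * tau x).
      by rewrite cabsM t1 mulr1 cabs_im.
    have -> : (0 +i* (k x - k y)) * tau x = (dtau x - dtau y) -
        (0 +i* k y) * (tau x - tau y).
      rewrite !dE; have -> : 0 +i* (k x - k y) = (0 +i* k x) - (0 +i* k y).
        by apply/eqP; rewrite eq_complex /= subrr !eqxx.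
      by ring.
    apply: le_trans (cabsB _ _) _; rewrite cabsM cabs_im kd /B mulrDl.
    apply: lerD; first exact: d3.
    apply: le_trans (ler_pM (cabs_ge0 _) (cabs_ge0 _) (d2 y) (tL x y)) _.
    by rewrite le_eqVlt; apply/orP; left; apply/eqP; ring.
  apply: (@le_trans _ _ (2 * rho^-1)).
    by apply: le_trans (ler_normB _ _) _; have := d2 x; have := d2 y; rewrite -!kd; lra.
  apply: (@le_trans _ _ (2 * rho^-1 ^+ 2 * rho)).
    rewrite expr2 -!mulrA mulVf ?mulr1 ?lt0r_neq0//.
  apply: ler_pM => //; rewrite ?mulr_ge0 ?exprn_ge0 ?(ltW rV) ?(ltW r0)//.
  by rewrite /B lerDr ltW.
have [F F1 F2] := angle_lift t1 d1 (lip_continuous kB).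
exists F, k, (inf [set circle_speed T z | z in @unit_circle R]), B.
have low y : inf [set circle_speed T z | z in @unit_circle R] <= cabs (dtau y).
  rewrite -(rderiv_circle_derive (d1 y)).
  apply: ge_inf; last by exists (expi y); first exact: expi_circle.
  by exists 0 => _ [z _ <-]; exact: cabs_ge0.
split => //; first exact: lt_le_trans B0.
split => //.
- by move=> x; rewrite kd.
- by move=> x; rewrite kd; exact: le_trans B0.
- by move=> y d Hd; rewrite (rderiv_unique Hd (d1 y)).
Qed.

(** * The inverse of the lifted map *)

(** The derivative of [F] keeps its sign, so that [F] reaches every value by
    moving far enough in both directions. *)
Lemma expanding_surjective (R : realType) (F k : R -> R) (lam B : R) :
  0 < lam -> (forall x : R, is_derive x 1 F (k x)) -> (forall x, lam <= `|k x|) ->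
  (forall x y, `|k x - k y| <= B * `|x - y|) -> forall v, exists x, F x = v.
Proof.
move=> l0 Fd kl kB v; have kc := lip_continuous kB.
have Fc : continuous F.
  by move=> x; have [+ _] := Fd x => /derivable1_diffP/differentiable_continuous.
pose r := `|v - F 0| / lam.
have r0 : 0 <= r by rewrite divr_ge0// ltW.
have rl : r * lam = `|v - F 0| by rewrite divfK// gt_eqF.
have [c [_ _ E]] := @mean_value _ _ _ 0 r Fd; rewrite subr0 in E.
have [c' [_ _ E']] := @mean_value _ _ _ 0 (- r) Fd; rewrite subr0 in E'.
have same a b : 0 < k a -> k b < 0 -> False.
  move=> ka kb; have [|||x _ kx] := @IVT R k (Num.min a b) (Num.max a b) 0.
  - by rewrite ge_min !le_max !lexx.
  - exact: continuous_subspaceT.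
  - case: (leP a b) => ab; rewrite ?(ge_min _ (k a)) ?(ge_min _ (k b)) le_max;
      by rewrite (ltW ka) (ltW kb) ?orbT.
  by have := kl x; rewrite kx normr0; lra.
have [|||x _ Fx] := @IVT R F (- r) r v; last by exists x.
- by lra.
- exact: continuous_subspaceT.
- have := kl c; have := kl c'; have := @same c c'; have := @same c' c.
  have b1 : v - F 0 <= r * lam by rewrite rl ler_norm.
  have b2 : - (v - F 0) <= r * lam by rewrite rl -normrN ler_norm.
  have [k1|k1|k1] := ltgtP (k c) 0; have [k2|k2|k2] := ltgtP (k c') 0.
  + move=> _ _ h2 h1; rewrite ltr0_norm// in h1; rewrite ltr0_norm// in h2.
    have m1 : r * lam <= r * - k c by apply: ler_wpM2l.
    have m2 : r * lam <= r * - k c' by apply: ler_wpM2l.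
    by rewrite ge_min le_max; apply/andP; split; apply/orP; [right|left]; lra.
  + by move=> /(_ isT isT).
  + by rewrite k2 normr0; lra.
  + by move=> _ /(_ isT isT).
  + move=> _ _ h2 h1; rewrite gtr0_norm// in h1; rewrite gtr0_norm// in h2.
    have m1 : r * lam <= r * k c by apply: ler_wpM2l.
    have m2 : r * lam <= r * k c' by apply: ler_wpM2l.
    by rewrite ge_min le_max; apply/andP; split; apply/orP; [left|right]; lra.
  + by rewrite k2 normr0; lra.
  + by rewrite k1 normr0; lra.
  + by rewrite k1 normr0; lra.
  + by rewrite k1 normr0; lra.
Qed.

Lemma expanding_inverse (R : realType) (F k : R -> R) (lam B : R) :
  1 < lam -> (forall x : R, is_derive x 1 F (k x)) -> (forall x, lam <= `|k x|) ->
  (forall x y, `|k x - k y| <= B * `|x - y|) ->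
  exists psi : R -> R, [/\ cancel psi F, cancel F psi &
    forall x y, `|psi x - psi y| <= lam^-1 * `|x - y|].
Proof.
move=> l1 Fd kl kB; have l0 : 0 < lam by lra.
have [psi Hpsi] := choice (expanding_surjective l0 Fd kl kB).
have low x y : lam * `|x - y| <= `|F x - F y|.
  by have [c [_ _ ->]] := @mean_value _ _ _ y x Fd; rewrite normrM ler_wpM2r.
exists psi; split => //.
- move=> x; have := low (psi (F x)) x; rewrite Hpsi subrr normr0.
  move=> h; apply/eqP; rewrite -subr_eq0 -normr_le0.
  by rewrite -(pmulr_rle0 _ l0).
- by move=> x y; have := low (psi x) (psi y); rewrite !Hpsi ler_pdivlMl.
Qed.

Lemma contraction_fixpoint (R : realType) (psi : R -> R) (q : R) :
  0 <= q < 1 -> (forall x y, `|psi x - psi y| <= q * `|x - y|) ->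
  exists p, psi p = p.
Proof.
move=> q01 Hp; have [q0 q1] := andP q01.
have step n : `|iter n.+1 psi 0 - iter n psi 0| <= `|psi 0| * q ^+ n.
  elim: n => [|n IH]; first by rewrite /= subr0 expr0 mulr1.
  rewrite [iter n.+2 _ _]iterS {2}iterS; apply: le_trans (Hp _ _) _.
  by rewrite exprS mulrCA ler_wpM2l.
have [p Hl] := geometric_limit_real q01 step; exists p.
set K := `|psi 0| / (1 - q) in Hl.
have K0 : 0 <= K by rewrite divr_ge0//; lra.
apply/eqP; rewrite -subr_eq0 -normr_le0; apply/ler_addgt0Pr => e e0; rewrite add0r.
have K1 : 0 < 2 * K + 1 by lra.
have [n Hn] := @exp_small _ q (e / (2 * K + 1)) q01 ltac:(by rewrite divr_gt0).
rewrite ltr_pdivlMr// in Hn.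
have qn : 0 <= q ^+ n by rewrite exprn_ge0.
have h1 := Hl n.+1; have h2 : `|psi p - iter n.+1 psi 0| <= q * (K * q ^+ n).
  rewrite iterS; apply: le_trans (Hp _ _) _; rewrite ler_wpM2l// distrC; exact: Hl.
have -> : psi p - p = (psi p - iter n.+1 psi 0) + (iter n.+1 psi 0 - p) by ring.
apply: le_trans (ler_normD _ _) _; rewrite exprS in h1.
have : q * (K * q ^+ n) <= K * q ^+ n by apply: ler_piMl; [exact: mulr_ge0 | exact: ltW].
by lra.
Qed.

Lemma iter_contraction (R : realType) (psi : R -> R) (q : R) n (x y : R) :
  0 <= q -> (forall x y, `|psi x - psi y| <= q * `|x - y|) ->
  `|iter n psi x - iter n psi y| <= q ^+ n * `|x - y|.
Proof.
move=> q0 Hp; elim: n => [|n IH]; first by rewrite expr0 mul1r.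
by rewrite !iterS; apply: le_trans (Hp _ _) _; rewrite exprS -mulrA ler_wpM2l.
Qed.

Lemma dist_between (R : realType) (x y c : R) :
  Num.min y x <= c -> c <= Num.max y x -> `|c - x| <= `|x - y|.
Proof.
case: (leP y x) => [yx yc cx|/ltW xy xc cy].
  by rewrite distrC !ger0_norm ?subr_ge0//; lra.
by rewrite ger0_norm ?ler0_norm ?subr_ge0 ?subr_le0//; lra.
Qed.

(** Each application of [psi] distorts ratios of distances by a factor
    [1 + O(d)] on a set of diameter [d], and the diameters decrease
    geometrically. *)
Lemma bounded_distortion (R : realType) (F k psi : R -> R) (lam B d : R) :
  1 < lam -> 0 < B -> 0 <= d ->
  (forall x : R, is_derive x 1 F (k x)) -> (forall x, lam <= `|k x|) ->
  (forall x y, `|k x - k y| <= B * `|x - y|) -> cancel psi F ->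
  (forall x y, `|psi x - psi y| <= lam^-1 * `|x - y|) ->
  exists2 D, 0 < D & forall n x x' u v, `|x - x'| <= d -> `|x - u| <= d ->
    `|u - v| <= d ->
    `|iter n psi x - iter n psi x'| * `|u - v| <=
      D * `|iter n psi u - iter n psi v| * `|x - x'|.
Proof.
move=> l1 B0 d0 Fd kl kB Fpsi psiL.
have l0 : 0 < lam by lra.
have q01 : 0 <= lam^-1 < 1.
  by rewrite invr_ge0 (ltW l0) invf_lt1.
have [q0 q1] := andP q01; set q := lam^-1 in q01 q0 q1 psiL.
have step e x x' u v : `|x - x'| <= e -> `|x - u| <= e -> `|u - v| <= e ->
    `|F x - F x'| * `|u - v| <= (1 + 3 * B * e) * `|F u - F v| * `|x - x'|.
  move=> h1 h2 h3.
  have [c [c1 c2 ->]] := @mean_value _ _ _ x' x Fd.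
  have [c' [c1' c2' ->]] := @mean_value _ _ _ v u Fd.
  have cc : `|c - c'| <= 3 * e.
    have -> : c - c' = (c - x) + (x - u) + (u - c') by ring.
    have b1 := le_trans (dist_between c1 c2) h1.
    have b2 := le_trans (dist_between c1' c2') h3.
    have := ler_normD (c - x + (x - u)) (u - c').
    have := ler_normD (c - x) (x - u); rewrite (distrC u c').
    by move: b1 b2 h2; clear; lra.
  have ck : `|k c| <= (1 + 3 * B * e) * `|k c'|.
    have := ler_normD (k c - k c') (k c'); rewrite subrK => h.
    have h4 : `|k c - k c'| <= B * (3 * e).
      by apply: le_trans (kB _ _) _; rewrite ler_wpM2l// ltW.
    have e0 : 0 <= e by apply: le_trans h1.
    have : 0 <= B * (3 * e) * (`|k c'| - 1).
      by rewrite mulr_ge0 ?mulr_ge0 ?(ltW B0)//; have := kl c'; lra.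
    by lra.
  rewrite !normrM.
  have -> : (1 + 3 * B * e) * (`|k c'| * `|u - v|) * `|x - x'| =
    (1 + 3 * B * e) * `|k c'| * (`|x - x'| * `|u - v|) by ring.
  by rewrite -[leLHS]mulrA; apply: ler_wpM2r => //; exact: mulr_ge0.
pose S n := \sum_(i < n) (3 * B * d) * q ^+ (0 + i).
have C0 : 0 <= 3 * B * d by rewrite !mulr_ge0// ltW.
exists (expR (3 * B * d / (1 - q))); first exact: expR_gt0.
move=> n x x' u v xx xu uv.
suff H : `|iter n psi x - iter n psi x'| * `|u - v| <=
      expR (S n) * `|iter n psi u - iter n psi v| * `|x - x'|.
  apply: le_trans H _; rewrite !ler_wpM2r// ler_expR.
  by have := geometric_tail 0 n C0 q01; rewrite expr0 mulr1.
have [->|uv0] := eqVneq u v.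
  by rewrite !subrr normr0 mulr0 mulr0 mul0r.
elim: n => [|n IH]; first by rewrite /S big_ord0 expR0 mul1r mulrC.
have contr := fun n x y => @iter_contraction R psi q n x y q0 psiL.
have dn w w' : `|w - w'| <= d -> `|iter n.+1 psi w - iter n.+1 psi w'| <= d * q ^+ n.
  move=> h; apply: le_trans (contr _ _ _) _; rewrite mulrC.
  apply: ler_pM => //; first by rewrite exprn_ge0.
  by apply: ler_wiXn2l => //; exact: ltW.
(* The step is used with the two pairs exchanged, since [psi] inverts the
   ratios. *)
have := step _ _ _ _ _ (dn _ _ uv) (_ : `|iter n.+1 psi u - iter n.+1 psi x| <= _) (dn _ _ xx).
rewrite distrC => /(_ (dn _ _ xu)); rewrite !iterS !Fpsi -!iterS => ST.
have Nuv : 0 < `|iter n psi u - iter n psi v|.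
  rewrite normr_gt0 subr_eq0; apply: contra uv0 => /eqP.
  by elim: (n) => [/eqP //|m IHm]; rewrite !iterS => /(congr1 F); rewrite !Fpsi.
have SE : S n.+1 = S n + 3 * B * d * q ^+ n by rewrite /S big_ord_recr add0n.
have exp1 : 1 + 3 * B * (d * q ^+ n) <= expR (3 * B * d * q ^+ n).
  by rewrite mulrA; exact: expR_ge1Dx.
rewrite SE expRD -(ler_pM2l Nuv).
set X := `|iter n.+1 psi x - _| in ST *; set V := `|iter n.+1 psi u - _| in ST *.
set a := `|iter n psi u - _| in ST IH Nuv *; set b := `|iter n psi x - _| in ST IH.
have V0 : 0 <= V by exact: normr_ge0.
apply: (@le_trans _ _ ((1 + 3 * B * (d * q ^+ n)) * b * V * `|u - v|)).
  by rewrite [leLHS]mulrA; apply: ler_wpM2r.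
have -> : (1 + 3 * B * (d * q ^+ n)) * b * V * `|u - v| =
  (1 + 3 * B * (d * q ^+ n)) * (V * (b * `|u - v|)) by ring.
have -> : a * (expR (S n) * expR (3 * B * d * q ^+ n) * V * `|x - x'|) =
  expR (3 * B * d * q ^+ n) * (V * (expR (S n) * a * `|x - x'|)) by ring.
apply: ler_pM => //.
- by rewrite addr_ge0// !mulr_ge0 ?exprn_ge0// ltW.
- by rewrite !mulr_ge0// normr_ge0.
- by rewrite ler_wpM2l.
Qed.

(** * Holomorphic inverse branches and the candidate solution *)

Lemma cexp_near1 (R : realType) (k : R) : 0 < k -> exists2 r, 0 < r &
  forall z w : R[i], cabs z <= r -> cabs w <= r ->
    cabs (cexp z - cexp w) <= (1 + k) * cabs (z - w).
Proof.
move=> k0; have [r r0 Hr] := cdiff_cont (cexp_cdiff (0 : R[i])) k0.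
exists (r / 2); first by lra.
move=> z w zr wr.
apply: (mean_value_bound (midconvex_ball (c := 0) (r := r / 2)));
  rewrite /= ?subr0//; first by move=> u; exact: closed_cball.
move=> u; rewrite subr0 => ur; exists (cexp u); first exact: cexp_deriv.
have := Hr u; rewrite subr0 cexp0 => /(_ ltac:(lra)) h.
by have := cabsD (cexp u - 1) 1; rewrite subrK cabs1; lra.
Qed.

(** Near [psi x] the holomorphic extension of [tau] is close to a linear map of
    slope larger than [1], so that [tau w = expi x * cexp ('i * z)] has a unique
    solution [w] near [psi x], which contracts distances. By uniqueness it is
    the value of [psi] when [z] is real. *)
Lemma inverse_branches (R : realType) (tau : R -> R[i]) (psi : R -> R) (rho lam : R) :
  0 < rho -> 1 < lam -> (forall y, extends_at tau rho y) ->
  (forall y d, rderiv_at tau y d -> lam <= cabs d) ->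
  (forall x, tau (psi x) = expi x) ->
  (forall x y, `|psi x - psi y| <= lam^-1 * `|x - y|) ->
  exists (r q : R) (Psi : R -> R[i] -> R[i]), [/\ 0 < r, r <= rho, 0 <= q < 1,
    lam^-1 <= q & forall x,
    [/\ forall z w, cabs z < r -> cabs w < r ->
          cabs (Psi x z - Psi x w) <= q * cabs (z - w),
        forall z, cabs z < r -> cdiff (Psi x) z &
        forall s : R, `|s| < r -> Psi x s%:C = (psi (x + s) - psi x)%:C]].
Proof.
move=> r0 l1 Te lamP tpsi psiL.
(* With this [k], the bound [1 + k] on the slope of the exponential stays below
   the bound [lam - k] on that of the extension of [tau]. *)
pose k := (lam - 1) / 4; have k0 : 0 < k by rewrite /k; lra.
have lk : lam = 1 + 4 * k by rewrite /k; lra.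
pose rho0 := Num.min rho (k * rho).
have rho00 : 0 < rho0 by rewrite lt_min r0 mulr_gt0.
have : rho0 <= rho0 by []. rewrite {2}/rho0 le_min => /andP[rr rk].
have [r2 r20 Hcexp] := cexp_near1 k0.
pose r := Num.min r2 rho0; have rpos : 0 < r by rewrite lt_min r20.
have : r <= r by []. rewrite {2}/r le_min => /andP[rr2 rr0].
pose q := (1 + k) / (lam - k).
have lk0 : 0 < lam - k by lra.
have q01 : 0 <= q < 1.
  by rewrite divr_ge0 ?ltr_pdivrMr//=; lra.
have lq : lam^-1 <= q.
  rewrite /q ler_pdivlMr// mulrC ler_pdivrMr; last by lra.
  by rewrite lk; have := mulr_ge0 (ltW k0) (ltW k0); lra.
suff ex x : exists P : R[i] -> R[i], [/\ forall z w, cabs z < r -> cabs w < r ->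
          cabs (P z - P w) <= q * cabs (z - w),
        forall z, cabs z < r -> cdiff P z &
        forall s : R, `|s| < r -> P s%:C = (psi (x + s) - psi x)%:C].
  by have [Psi HPsi] := choice ex; exists r, q, Psi; split => //; exact: le_trans rr.
have [t [t1 t2 t3 t4]] := Te (psi x).
have [a Ha] := t1 0 ltac:(by rewrite cabs0 ltW).
have la : lam <= cabs a.
  apply: (lamP (psi x)); rewrite -[psi x]addr0.
  by apply: (extension_rderiv t4) => //; rewrite normr0.
have strict : forall z w : R[i], cabs z <= rho0 -> cabs w <= rho0 ->
    cabs (t z - t w - a * (z - w)) <= k * cabs (z - w).
  move=> z w zr wr.
  apply: (@strict_derivative _ t 0 a rho0 k); rewrite ?subr0 ?(ltW k0)//.
  move=> u; rewrite subr0 => ur; have [d Hd] := t1 u (le_trans ur rr).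
  exists d => //; apply: le_trans (t3 u 0 d a (le_trans ur rr) _ Hd Ha) _.
    by rewrite cabs0 ltW.
  by rewrite subr0 mulrC ler_pdivrMr//; apply: le_trans ur rk.
have low : forall z w : R[i], cabs z <= rho0 -> cabs w <= rho0 ->
    (lam - k) * cabs (z - w) <= cabs (t z - t w).
  move=> z w zr wr; apply: le_trans (strict_lower (strict z w zr wr)).
  by rewrite ler_wpM2r ?cabs_ge0//; lra.
have t0 : t 0 = expi x by rewrite (t4 0) ?normr0 ?ltW// addr0.
have N0 : cabs (0 : R[i]) <= rho0 by rewrite cabs0 ltW.
pose v z := expi x * cexp ('i%C * z).
have vL z w : cabs z < r -> cabs w < r -> cabs (v z - v w) <= (1 + k) * cabs (z - w).
  move=> zr wr; rewrite /v -mulrBr cabsM cabs_expi mul1r.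
  have := Hcexp ('i%C * z) ('i%C * w); rewrite -mulrBr !cabsM !cabsi !mul1r.
  by apply; lra.
have v0 : v 0 = t 0 by rewrite /v mulr0 cexp0 mulr1 t0.
have vt z : cabs z < r -> cabs (v z - t 0) <= (1 + k) * cabs z.
  by move=> zr; rewrite -v0 -{2}[z]subr0; apply: vL => //; rewrite cabs0.
have exs u : exists w, cabs (u - t 0) <= (lam - k) * rho0 -> cabs w <= rho0 /\ t w = u.
  have [h|] := pselect (cabs (u - t 0) <= (lam - k) * rho0); last by exists 0.
  have [||w w1 w2] := local_surjective rho00 (ltW k0) _ strict (v := u).
  - by lra.
  - by apply: le_trans h _; rewrite ler_wpM2r ?(ltW rho00)//; lra.
  - by exists w.
have [s Hs] := choice exs.
have vin z : cabs z < r -> cabs (v z - t 0) <= (lam - k) * rho0.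
  move=> zr; apply: le_trans (vt z zr) _; apply: ler_pM; rewrite ?cabs_ge0//; lra.
have sL u w : cabs (u - t 0) <= (lam - k) * rho0 -> cabs (w - t 0) <= (lam - k) * rho0 ->
    (lam - k) * cabs (s u - s w) <= cabs (u - w).
  by move=> /Hs[u1 u2] /Hs[w1 w2]; have := low _ _ u1 w1; rewrite u2 w2.
have st0 : s (t 0) = 0.
  have [h1 h2] := Hs (t 0) ltac:(rewrite subrr cabs0; apply: mulr_ge0; lra).
  have := low _ _ h1 N0; rewrite h2 subrr subr0 cabs0 pmulr_rle0// => h.
  by apply: cabs0_eq0; apply/eqP; rewrite eq_le h cabs_ge0.
have PL z w : cabs z < r -> cabs w < r -> cabs (s (v z) - s (v w)) <= q * cabs (z - w).
  move=> zr wr; have := le_trans (sL _ _ (vin z zr) (vin w wr)) (vL z w zr wr).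
  by rewrite /q mulrAC ler_pdivlMr// mulrC.
exists (fun z => s (v z)); split => //.
- move=> z zr; apply: cdiff_comp.
    apply: cdiffM; first exact: cdiff_cst.
    apply: (@cdiff_comp _ (fun w => 'i%C * w) (@cexp R)); last exact: cexp_cdiff.
    by apply: cdiffM; [exact: cdiff_cst | exact: cdiff_id].
  have d0 : 0 < (lam - k) * rho0 - cabs (v z - t 0).
    rewrite subr_gt0; apply: le_lt_trans (vt z zr) _.
    apply: (@le_lt_trans _ _ ((lam - k) * cabs z)).
      by rewrite ler_wpM2r ?cabs_ge0//; lra.
    by rewrite ltr_pM2l//; lra.
  have near u : cabs (u - v z) < (lam - k) * rho0 - cabs (v z - t 0) ->
      cabs (u - t 0) <= (lam - k) * rho0.
    by have := cabs_tri (v z) u (t 0); lra.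
  apply: (cdiff_inverse d0 lk0 (t := t)).
  + by move=> w /near/Hs[].
  + by move=> w /near wr; apply: sL => //; exact: vin.
  + have [h1 h2] := Hs _ (vin z zr).
    have h3 : cabs (s (v z)) < rho0.
      have := PL z 0 zr; rewrite v0 st0 !subr0 cabs0 => /(_ rpos) h.
      apply: le_lt_trans h _; have : q * cabs z <= 1 * cabs z.
        by apply: ler_wpM2r; [exact: cabs_ge0 | lra].
      by lra.
    exists (rho0 - cabs (s (v z))); first by lra.
    move=> w wr; apply: low => //.
    by have := cabs_tri (s (v z)) w 0; rewrite !subr0; lra.
  + by have [h1 h2] := Hs _ (vin z zr); apply: t1; lra.
- move=> u ur; set d := psi (x + u) - psi x.
  have ud : `|d| <= rho0.
    apply: le_trans (psiL _ _) _; rewrite (_ : x + u - x = u); last by ring.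
    have l0 : lam^-1 <= 1 by rewrite invf_le1; lra.
    have : lam^-1 * `|u| <= 1 * `|u| by apply: ler_wpM2r.
    by lra.
  have Nu : cabs u%:C < r by rewrite cabs_real.
  have [h1 h2] := Hs _ (vin _ Nu).
  have td : t d%:C = v u%:C.
    rewrite t4; last by lra.
    rewrite /d (_ : psi x + (psi (x + u) - psi x) = psi (x + u)); last by ring.
    by rewrite tpsi /v cexp_i expiD.
  have := low _ _ h1 (_ : cabs d%:C <= rho0); rewrite h2 td subrr cabs0 cabs_real.
  move=> /(_ ud); rewrite pmulr_rle0// => h.
  by apply/eqP; rewrite -subr_eq0; apply/eqP/cabs0_eq0/eqP; rewrite eq_le h cabs_ge0.
Qed.

(** Holomorphic backward orbits contract, so that the terms of the series have
    geometrically decreasing Lipschitz constants; subtracting [phi p], the limit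
    of the terms, makes the series converge. *)
Lemma transfer_sum (R : realType) (phi : R -> R[i]) (psi : R -> R) (p rho r q : R)
    (Psi : R -> R[i] -> R[i]) :
  0 < rho -> (forall y, extends_at phi rho y) -> 0 < r -> r <= rho -> 0 <= q < 1 ->
  (forall x y, `|psi x - psi y| <= q * `|x - y|) -> psi p = p ->
  (forall x, [/\ forall z w, cabs z < r -> cabs w < r ->
          cabs (Psi x z - Psi x w) <= q * cabs (z - w),
        forall z, cabs z < r -> cdiff (Psi x) z &
        forall s : R, `|s| < r -> Psi x s%:C = (psi (x + s) - psi x)%:C]) ->
  exists (G : R -> R[i] -> R[i]) (C : R), [/\ 
    forall x z, cabs z < r -> cdiff (G x) z,
    forall x (s : R), `|s| < r -> G x s%:C = G (x + s) 0,
    forall x, sums_to (fun n => phi (iter n.+1 psi x) - phi p) (G x 0) &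
    forall x y, `|x - y| < r -> cabs (G x 0 - G y 0) <= C * `|x - y|].
Proof.
move=> rho0 phie r0 rrho q01 psiL pp HPsi; have [q0 q1] := andP q01.
have [dphi [d1 d2 _]] := extends_rderiv rho0 phie.
have phiL := rderiv_lip d1 d2.
have rV : 0 < rho^-1 by rewrite invr_gt0.
have [t Ht] := choice phie.
have tL x z w : cabs z <= rho -> cabs w <= rho ->
    cabs (t x z - t x w) <= rho^-1 * cabs (z - w).
  move=> zr wr; have [t1 t2 _ _] := Ht x.
  apply: (mean_value_bound (midconvex_ball (c := 0) (r := rho)));
    rewrite /= ?subr0//; first by move=> u; exact: closed_cball.
  by move=> u; rewrite subr0 => ur; have [d Hd] := t1 u ur; exists d => //; exact: (t2 u).
(* [Phi x n] extends [iter n psi] near [x], in coordinates centred at [x] and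
   [iter n psi x]. *)
pose Phi x := fix Phi n z : R[i] := if n is n'.+1 then Psi (iter n' psi x) (Phi n' z) else z.
have Psi0 x : Psi x 0 = 0.
  have [_ _ h] := HPsi x; have := h 0; rewrite normr0 => /(_ r0).
  by rewrite addr0 subrr.
have Phi0 x n : Phi x n 0 = 0 by elim: n => [//|n IH] /=; rewrite IH.
have PhiL x n z w : cabs z < r -> cabs w < r ->
    [/\ cabs (Phi x n z) < r, cabs (Phi x n w) < r &
    cabs (Phi x n z - Phi x n w) <= q ^+ n * cabs (z - w)].
  move=> zr wr; elim: n => [|n [IH1 IH2 IH3]]; first by rewrite expr0 mul1r.
  have [h1 _ _] := HPsi (iter n psi x).
  have contr u : cabs u < r -> cabs (Psi (iter n psi x) u) < r.
    move=> ur; have := h1 u 0 ur; rewrite Psi0 cabs0 !subr0 => /(_ r0) h.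
    apply: le_lt_trans h _; apply: le_lt_trans ur; rewrite ler_piMl ?cabs_ge0//.
    exact: ltW.
  split; [exact: contr | exact: contr |].
  apply: le_trans (h1 _ _ IH1 IH2) _.
  by rewrite exprS -mulrA ler_wpM2l.
have Phid x n z : cabs z < r -> cdiff (Phi x n) z.
  move=> zr; elim: n => [|n IH]; first exact: cdiff_id.
  apply: (@cdiff_comp _ (Phi x n) (Psi (iter n psi x))) => //.
  by have [_ h _] := HPsi (iter n psi x); apply: h; have [] := PhiL x n z z zr zr.
have Phir x n (s : R) : `|s| < r -> Phi x n s%:C = (iter n psi (x + s) - iter n psi x)%:C.
  move=> sr; elim: n => [|n IH] /=; first by congr (_%:C); ring.
  rewrite IH; have [_ _ h] := HPsi (iter n psi x); rewrite h.
    by congr ((psi _ - _)%:C); ring.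
  apply: le_lt_trans (iter_contraction n _ _ q0 psiL) _.
  rewrite (_ : x + s - x = s); last by ring.
  by apply: le_lt_trans sr; rewrite ler_piMl// exprn_ile1// ltW.
pose u x n z := t (iter n.+1 psi x) (Phi x n.+1 z) - phi p.
have iterp n : iter n psi p = p by elim: n => [//|n IH]; rewrite iterS IH.
have te x : t x 0 = phi x.
  by have [_ _ _ h] := Ht x; rewrite (h 0) ?normr0 ?ltW// addr0.
have u0 x n : u x n 0 = phi (iter n.+1 psi x) - phi p by rewrite /u Phi0 te.
have PhiLe x n z w : cabs z < r -> cabs w < r ->
    cabs (Phi x n.+1 z - Phi x n.+1 w) <= q ^+ n * cabs (z - w).
  move=> zr wr; have [_ _ h] := PhiL x n.+1 z w zr wr; apply: le_trans h _.
  by rewrite ler_wpM2r ?cabs_ge0// exprS ler_piMl ?exprn_ge0// ltW.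
have uL x n z w : cabs z < r -> cabs w < r ->
    cabs (u x n z - u x n w) <= rho^-1 * q ^+ n * cabs (z - w).
  move=> zr wr; rewrite /u opprB addrA subrK.
  have [h1 h2 _] := PhiL x n.+1 z w zr wr.
  apply: le_trans (tL _ _ _ _ _) _; [exact: ltW (lt_le_trans h1 rrho) |
    exact: ltW (lt_le_trans h2 rrho) |].
  by rewrite -mulrA ler_wpM2l ?(ltW rV)//; exact: PhiLe.
have u0b x n : cabs (u x n 0) <= (2 * rho^-1 * `|x - p|) * q ^+ n.
  rewrite u0 -(congr1 phi (iterp n.+1)); apply: le_trans (phiL _ _) _; rewrite -[leRHS]mulrA.
  apply: ler_wpM2l; first by rewrite mulr_ge0// ltW.
  apply: le_trans (iter_contraction n.+1 _ _ q0 psiL) _; rewrite mulrC.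
  by apply: ler_wpM2l => //; rewrite exprS ler_piMl ?exprn_ge0// ltW.
have exG x : exists g : R[i] -> R[i], forall z, cabs z < r -> sums_to (fun n => u x n z) (g z).
  have exl z : exists l, cabs z < r -> sums_to (fun n => u x n z) l.
    have [zr|] := pselect (cabs z < r); last by exists 0.
    have [|l Hl] := @geometric_sums_to _ (fun n => u x n z)
        (2 * rho^-1 * `|x - p| + rho^-1 * cabs z) q q01; last by exists l.
    move=> n; have := uL x n z 0 zr; rewrite cabs0 subr0 => /(_ r0) h.
    have := cabsD (u x n z - u x n 0) (u x n 0); rewrite subrK => h'.
    by apply: le_trans h' _; have := u0b x n; lra.
  by have [g Hg] := choice exl; exists g.
have [G HG] := choice exG.
have HG0 x : sums_to (fun n => phi (iter n.+1 psi x) - phi p) (G x 0).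
  move=> e e0; have [n N] := HG x 0 ltac:(by rewrite cabs0) e e0; exists n => m /N.
  by under eq_bigr => i _ do rewrite u0.
have Greal x (s : R) : `|s| < r -> G x s%:C = G (x + s) 0.
  move=> sr; have Ns : cabs s%:C < r by rewrite cabs_real.
  apply: sums_to_uniq (HG0 (x + s)) => e e0; have [n N] := HG x _ Ns e e0.
  exists n => m /N; under eq_bigr => i _.
    rewrite /u Phir//; have [_ _ _ h] := Ht (iter i.+1 psi x); rewrite h; last first.
      apply: le_trans (iter_contraction i.+1 _ _ q0 psiL) _.
      rewrite (_ : x + s - x = s); last by ring.
      apply: (@le_trans _ _ `|s|); last by lra.
      by rewrite ler_piMl// exprn_ile1// ltW.
    rewrite (_ : iter i.+1 psi x + _ = iter i.+1 psi (x + s)); last by ring.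
    over.
  by [].
exists G, (rho^-1 / (1 - q)); split => //.
- move=> x z zr; apply: (@sums_to_cdiff _ (u x) (G x) z (r - cabs z) rho^-1 q).
  + by rewrite subr_gt0.
  + exact: ltW.
  + by [].
  + by move=> k w wr; apply: uL => //; have := cabs_tri z w 0; rewrite !subr0; lra.
  + move=> k; rewrite /u; apply: cdiffB; last exact: cdiff_cst.
    apply: (@cdiff_comp _ (Phi x k.+1) (t (iter k.+1 psi x))); first exact: Phid.
    have [h _ _ _] := Ht (iter k.+1 psi x); apply: h.
    by have [h1 _ _] := PhiL x k.+1 z z zr zr; lra.
  + by move=> w wr; apply: HG; have := cabs_tri z w 0; rewrite !subr0; lra.
- move=> x y xy; have -> : G x 0 = G y (x - y)%:C.
    by rewrite Greal//; congr (G _ 0); ring.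
  have Nxy : cabs (x - y)%:C < r by rewrite cabs_real.
  have N0 : cabs (0 : R[i]) < r by rewrite cabs0.
  have := @sums_to_lip _ (u y) (G y) (x - y)%:C 0 rho^-1 q (ltW rV) q01.
  rewrite subr0 cabs_real; apply; [|exact: HG|exact: HG].
  by move=> k; have := uL y k _ _ Nxy N0; rewrite subr0 cabs_real.
Qed.

(** * Null sets and Lebesgue measure on the line *)

Lemma diameter_measure (R : realType) (S : set R) (d : R) : measurable S -> 0 <= d ->
  (forall x y, S x -> S y -> `|x - y| <= d) ->
  (@lebesgue_measure R S <= d%:E)%E.
Proof.
move=> mS d0 Sd; have [->|/set0P[x0 Sx0]] := eqVneq S set0.
  by rewrite measure0 lee_fin.
have sub : S `<=` `[inf S, sup S].
  move=> x Sx /=; rewrite in_itv /=; apply/andP; split.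
    apply: ge_inf => //; exists (x0 - d) => y Sy.
    by have := Sd _ _ Sx0 Sy; rewrite ler_norml => /andP[]; lra.
  apply: ub_le_sup => //; exists (x0 + d) => y Sy.
  by have := Sd _ _ Sx0 Sy; rewrite ler_norml => /andP[]; lra.
have len : sup S <= inf S + d.
  apply: ge_sup; first by exists x0.
  move=> x Sx; rewrite -lerBlDr; apply: lb_le_inf; first by exists x0.
  by move=> y Sy; have := Sd _ _ Sx Sy; rewrite ler_norml => /andP[]; lra.
apply: (@le_trans _ _ (@lebesgue_measure R `[inf S, sup S])).
  by apply: le_measure => //; rewrite ?inE.
by rewrite lebesgue_measure_itv /=; case: ifPn => _; rewrite -?EFinN -?EFinD lee_fin; lra.
Qed.

(** A measure is determined on Borel sets by covers by intervals, so it suffices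
    to bound the preimage of an interval, whose diameter is controlled. *)
Lemma expanding_preimage (R : realType) (phi : R -> R) (I A : set R) (L : R) :
  0 < L -> measurable I -> continuous phi -> measurable A ->
  (forall x y, I x -> I y -> `|x - y| <= L * `|phi x - phi y|) ->
  (@lebesgue_measure R (I `&` phi @^-1` A) <= L%:E * @lebesgue_measure R A)%E.
Proof.
move=> L0 mI phic mA HL; set mu := @lebesgue_measure R.
have mphi : measurable_fun setT phi by exact: continuous_measurable_fun.
have mpre B : measurable B -> measurable (I `&` phi @^-1` B).
  by move=> mB; apply: measurableI => //; rewrite -[X in measurable X]setTI; exact: mphi.
rewrite -lee_pdivrMl//.
rewrite {2}/mu /lebesgue_measure/= /lebesgue_stieltjes_measure/= /measure_extension/=.
apply: le_ereal_inf_tmp => _ [J [mJ AJ] <-].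
rewrite lee_pdivrMl// -nneseriesZl; last by [].
apply: (@le_trans _ _ (\sum_(k <oo) mu (I `&` phi @^-1` (J k)))%E).
  apply: measure_sigma_subadditive.
  - move=> k; apply: mpre; exact: sub_sigma_algebra.
  - exact: mpre.
  - move=> x [Ix /AJ[k _ Jk]]; exists k => //.
apply: lee_nneseries => // k _.
have /ocitvP[->|[[a b] /= ab ->]] := mJ k.
  rewrite preimage_set0 setI0 measure0 mule0.
  by rewrite [X in (X <= _)%E](measure0 (@lebesgue_measure R)).
rewrite wlength_itv_bnd ?(ltW ab)//= -EFinM; apply: diameter_measure.
- by apply: mpre.
- by rewrite mulr_ge0 ?subr_ge0 ?(ltW ab) ?(ltW L0).
- move=> x y [Ix Jx] [Iy Jy]; move: Jx Jy; rewrite /preimage /= !in_itv /=.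
  move=> /andP[x1 x2] /andP[y1 y2].
  apply: le_trans (HL x y Ix Iy) _; rewrite ler_wpM2l ?(ltW L0)//.
  by rewrite ler_norml; lra.
Qed.

Definition lebesgue_null (R : realType) (A : set R) : Prop :=
  (@lebesgue_measure R).-negligible A.

Lemma lebesgue_nullS (R : realType) (B A : set R) :
  A `<=` B -> lebesgue_null B -> lebesgue_null A.
Proof. by rewrite /lebesgue_null => AB; apply: negligibleS. Qed.

Lemma lebesgue_null_bigcup (R : realType) (F : nat -> set R) :
  (forall n, lebesgue_null (F n)) -> lebesgue_null (\bigcup_n F n).
Proof. by rewrite /lebesgue_null => nF; apply: negligible_bigcup. Qed.

Lemma lebesgue_nullU (R : realType) (A B : set R) :
  lebesgue_null A -> lebesgue_null B -> lebesgue_null (A `|` B).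
Proof. by rewrite /lebesgue_null => nA nB; apply: negligibleU. Qed.

Lemma lebesgue_null0 (R : realType) : lebesgue_null (set0 : set R).
Proof. by rewrite /lebesgue_null; apply: negligible_set0. Qed.

Lemma null_preimage (R : realType) (phi : R -> R) (N : set R) (L : R) :
  0 < L -> continuous phi -> (forall x y, `|x - y| <= L * `|phi x - phi y|) ->
  lebesgue_null N -> lebesgue_null (phi @^-1` N).
Proof.
move=> L0 phic HL [M [mM M0 NM]].
have mphi : measurable_fun setT phi by exact: continuous_measurable_fun.
exists (phi @^-1` M); split; last by move=> x /NM.
  by rewrite -[X in measurable X]setTI; exact: mphi.
apply/eqP; rewrite eq_le measure_ge0 andbT.
have := @expanding_preimage _ phi setT M L L0 measurableT phic mM (fun x y _ _ => HL x y).
by rewrite setTI M0 mule0.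
Qed.

Lemma uniform_probE (R : realType) (A : set R) : measurable A ->
  uniform_prob (twopi_gt0 R) A =
  ((pi *+ 2)^-1%:E * @lebesgue_measure R (A `&` `[0%R, (pi *+ 2)%R]))%E.
Proof.
move=> mA; rewrite /uniform_prob /= integral_uniform_pdf.
rewrite (eq_integral (fun=> (pi *+ 2)^-1%:E)); last first.
  move=> x; rewrite inE /= in_itv /= /uniform_pdf => -[_ ->].
  by rewrite subr0.
by rewrite integral_cst//; exact: measurableI.
Qed.

Lemma measurable_expi_preimage (R : realType) (A : set R[i]) : measurable A ->
  measurable ((@expi R) @^-1` A : set R).
Proof.
by move=> mA; rewrite -[X in measurable X]setTI; exact: (@measurable_expi R).
Qed.

Lemma null_periodic (R : realType) (A : set R) : measurable A ->
  (forall x, A (x + pi *+ 2) = A x) ->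
  @lebesgue_measure R (A `&` `[0, pi *+ 2]) = 0%E -> lebesgue_null A.
Proof.
move=> mA Aper A0; have p0 := twopi_gt0 R; set B := A `&` _ in A0.
have mB : measurable B by apply: measurableI.
pose shift n (x : R) := x - ((if @unpickle int n is Some j then j else 0)%:~R * (pi *+ 2)).
apply: (@lebesgue_nullS _ (\bigcup_n (shift n @^-1` B))).
  move=> x Ax; pose j := Num.floor (x / (pi *+ 2)).
  exists (pickle j) => //; rewrite /shift /preimage /= pickleK; split.
    by rewrite -mulNr -mulrNz (periodic_int Aper).
  have /andP[j1 j2] := floor_itv (x / (pi *+ 2)).
  move: j1 j2; rewrite -/j /= in_itv /= ler_pdivlMr// ltr_pdivrMr//.
  by rewrite intrD mulrDl mul1r; lra.
apply: lebesgue_null_bigcup => n; apply: (@null_preimage _ _ _ 1) => //.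
- by apply: (@lip_continuous _ _ 1) => x y; rewrite /shift opprB addrA subrK mul1r.
- by move=> x y; rewrite /shift opprB addrA subrK mul1r.
- by exists B; split.
Qed.

Lemma circle_null_pullback (R : realType) (N : set R[i]) :
  (circle_measure R).-negligible N -> lebesgue_null ((@expi R) @^-1` N).
Proof.
move=> [A [mA A0 NA]]; apply: (@lebesgue_nullS _ ((@expi R) @^-1` A)).
  by move=> x /NA.
have mE := measurable_expi_preimage mA.
apply: null_periodic => //; first by move=> x; rewrite /preimage /= expi_periodic.
have : uniform_prob (twopi_gt0 R) ((@expi R) @^-1` A) = 0%E := A0.
rewrite uniform_probE// => /eqP; rewrite mule_eq0 => /orP[|/eqP //].
by rewrite eqe invr_eq0 gt_eqF// twopi_gt0.
Qed.

(** The exceptional set on the circle is covered, up to small measure, by the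
    complements of images of compact sets, which are Borel. *)
Lemma circle_ae_of_line (R : realType) (P : set R[i]) :
  lebesgue_null [set x : R | ~ P (expi x)] ->
  {ae circle_measure R, forall z, unit_circle z -> P z}.
Proof.
move=> [M [mM M0 PM]].
have outer n : exists V : set R, [/\ open V, M `<=` V &
    (@lebesgue_measure R V <= (n.+1%:R^-1)%:E)%E].
  have [||V [oV MV VM]] := @lebesgue_regularity_outer R M (n.+1%:R^-1) mM.
  - by rewrite [X in (X < _)%E]M0.
  - by rewrite invr_gt0.
  exists V; split => //; apply: le_trans (ltW VM).
  rewrite -{1}(setDKU MV) -[leRHS]adde0 -[X in (_ <= _ + X)%E]M0.
  apply: measureU2 => //; apply: measurableD => //; exact: open_measurable.
have [V HV] := choice outer.
pose K n := `[0, (pi *+ 2 : R)] `\` V n.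
have cK n : compact (K n).
  apply: (@subclosed_compact _ _ `[0, (pi *+ 2 : R)]); last exact: subDsetl.
    by apply: closedI; [exact: interval_closed | apply: open_closedC; have [] := HV n].
  exact: segment_compact.
pose A := \bigcap_n ~` ((@expi R) @` (K n)).
have mn n : measurable (~` ((@expi R) @` (K n))).
  apply: sub_sigma_algebra; apply: closed_openC; apply: compact_closed.
    exact: norm_hausdorff.
  apply: continuous_compact => //; apply: continuous_subspaceT.
  exact: continuous_expi.
have mA : measurable A by exact: bigcapT_measurable.
exists A; split => //.
- have mE := measurable_expi_preimage mA.
  change (uniform_prob (twopi_gt0 R) ((@expi R) @^-1` A) = 0%E).
  rewrite uniform_probE//; suff -> :
    @lebesgue_measure R ((@expi R) @^-1` A `&` `[0, pi *+ 2]) = 0%E by rewrite mule0.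
  apply/eqP; rewrite eq_le measure_ge0 andbT; apply/lee_addgt0Pr => e e0; rewrite add0e.
  have [n ne] : exists n, (n.+1%:R^-1 : R) < e.
    exists (Num.truncn e^-1); rewrite -[ltRHS]invrK ltf_pV2 ?posrE ?invr_gt0//.
    exact: truncnS_gt.
  have [oV MV VM] := HV n.
  apply: (@le_trans _ _ (@lebesgue_measure R (V n))).
    apply: le_measure; rewrite ?inE//; first exact: measurableI.
      exact: open_measurable.
    move=> x [Ax xI]; apply: contrapT => Vx; apply: (Ax n) => //.
    by exists x => //; split.
  by apply: le_trans VM _; rewrite lee_fin ltW.
- move=> z /= /not_implyP[zc nPz] n _ [x [xI xV] xz].
  apply: xV; have [_ MV _] := HV n; apply: MV; apply: PM.
  by rewrite /= xz.
Qed.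

(** The sets of the circle that become Borel on the line up to a null set form a
    sigma-algebra, which contains the Borel and the negligible sets. *)
Lemma circle_borel_pullback (R : realType) (E : set R[i]) :
  (completed_algebra_gen (circle_measure R)).-sigma.-measurable E ->
  exists B N : set R, [/\ measurable B, lebesgue_null N &
    forall x, ~ N x -> (E (expi x) <-> B x)].
Proof.
pose S := [set E : set R[i] | exists B N : set R, [/\ measurable B, lebesgue_null N &
    forall x, ~ N x -> (E (expi x) <-> B x)]].
suff: (completed_algebra_gen (circle_measure R)).-sigma.-measurable `<=` S by exact.
apply: smallest_sub; last first.
  move=> _ [A mA [N nN <-]]; exists ((@expi R) @^-1` A), ((@expi R) @^-1` N).
  split; [exact: measurable_expi_preimage | exact: circle_null_pullback |].
  by move=> x Nx; split => [[//|/Nx]|Ax]; [| left].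
split.
- by exists set0, set0; split => //; exact: lebesgue_null0.
- move=> E' [B [N [mB nN H]]]; exists (~` B), N; split => //.
    exact: measurableC.
  by move=> x Nx; rewrite setTD; split=> h /(H _ Nx).
- move=> F HF; have [B HB] := choice HF; have [N HN] := choice HB.
  exists (\bigcup_n B n), (\bigcup_n N n); split.
  + by apply: bigcupT_measurable => n; have [] := HN n.
  + by apply: lebesgue_null_bigcup => n; have [] := HN n.
  + move=> x Nx; have hx n : F n (expi x) <-> B n x.
      by have [_ _ h] := HN n; apply: h => h'; apply: Nx; exists n.
    by split=> -[n _ /hx h]; exists n.
Qed.

Lemma not_null_line (R : realType) : ~ lebesgue_null [set: R].
Proof.
move=> [M [_ M0 TM]].
have : @lebesgue_measure R [set` `]-oo, +oo[] = 0%E.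
  rewrite (_ : [set` _] = M); first exact: M0.
  by rewrite set_itvNyy; apply/seteqP; split.
by rewrite lebesgue_measure_itv.
Qed.

(** Some set of positive measure carries values of [h] that are close to each
    other, since countably many small discs cover the plane. *)
Lemma almost_constant_set (R : realType) (h : R[i] -> R[i]) (eps : R) :
  circle_measurable h -> 0 < eps ->
  exists E : set R, [/\ measurable E, (0 < @lebesgue_measure R E)%E &
    forall x y, E x -> E y -> cabs (h (expi x) - h (expi y)) <= eps].
Proof.
move=> /circle_measurableP mh e0.
pose d := eps / 4; have d0 : 0 < d by rewrite /d; lra.
pose c (j : int * int) : R[i] := (j.1%:~R * d) +i* (j.2%:~R * d).
pose Q k := [set z : R[i] | cabs (z - c (odflt (0, 0) (unpickle k))) < eps / 2].
have oQ k : open (Q k).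
  rewrite openE => z /= zQ; apply/nbhs_cabs.
  exists (eps / 2 - cabs (z - c (odflt (0, 0) (unpickle k)))); first by rewrite subr_gt0.
  by move=> w wz; rewrite /Q /=; have := cabs_tri z w (c (odflt (0, 0) (unpickle k))); lra.
have pull k : exists B N : set R, [/\ measurable B, lebesgue_null N &
    forall x, ~ N x -> (Q k (h (expi x)) <-> B x)].
  have [|B [N [mB nN H]]] := @circle_borel_pullback R (@unit_circle R `&` h @^-1` (Q k)).
    by apply: mh; exact: sub_sigma_algebra.
  exists B, N; split => // x /H[h1 h2]; split => [Qx|/h2[]//].
  by apply: h1; split => //; exact: expi_circle.
have [B HB] := choice pull; have [N HN] := choice HB.
have cover x : exists k, Q k (h (expi x)).
  set z := h _; pose j := (Num.floor (Re z / d), Num.floor (Im z / d)).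
  exists (pickle j); rewrite /Q /= pickleK /=.
  have fl (u : R) : 0 <= u - (Num.floor (u / d))%:~R * d < d.
    have /andP[j1 j2] := floor_itv (u / d).
    move: j1 j2; rewrite ler_pdivlMr// ltr_pdivrMr// intrD mulrDl mul1r; lra.
  apply: le_lt_trans (cabs_le_ReIm _) _; rewrite !raddfB /=.
  have /andP[a1 a2] := fl (Re z); have /andP[b1 b2] := fl (Im z).
  by rewrite !ger0_norm//; rewrite /d in a2 b2 *; lra.
have [k Bk] : exists k, ~ lebesgue_null (B k).
  apply: contrapT => /forallNP nB; apply: (@not_null_line R).
  apply: (@lebesgue_nullS _ (\bigcup_k (B k `|` N k))).
    move=> x _; have [k Qk] := cover x; exists k => //.
    have [Nx|Nx] := pselect (N k x); first by right.
    by left; have [_ _ H] := HN k; apply/H.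
  apply: lebesgue_null_bigcup => k; apply: lebesgue_nullU.
    by apply: contrapT; exact: nB.
  by have [] := HN k.
have [mB [M [mM M0 NM]] H] := HN k.
exists (B k `\` M); split.
- exact: measurableD.
- rewrite lt0e measure_ge0 andbT; apply/eqP => BM0; apply: Bk.
  apply: (@lebesgue_nullS _ ((B k `\` M) `|` M)).
    by move=> x Bx; have [|] := pselect (M x); [right | left].
  apply: lebesgue_nullU; [exists (B k `\` M) | exists M]; split => //.
  exact: measurableD.
- move=> x y [Bx Mx] [By My].
  have Qx : Q k (h (expi x)) by apply/H => // /NM.
  have Qy : Q k (h (expi y)) by apply/H => // /NM.
  move: Qx Qy; rewrite /Q /=; set w := c _ => Qx Qy.
  have := cabs_tri w (h (expi x)) (h (expi y)).
  by rewrite (cabsC w); lra.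
Qed.

Lemma density_point (R : realType) (E : set R) (eta : R) :
  measurable E -> (0 < @lebesgue_measure R E)%E -> 0 < eta ->
  exists2 y, E y & exists2 r0, 0 < r0 & forall r, 0 < r -> r < r0 ->
    (@lebesgue_measure R (ball y r `\` E) <= (eta * (2 * r))%:E)%E.
Proof.
move=> mE E0 eta0; have [M [mM M0 HM]] := lebesgue_density mE.
have [y Ey My] : exists2 y, E y & ~ M y.
  apply: contrapT => H; have EM : E `<=` M.
    by move=> y Ey; apply: contrapT => My; apply: H; exists y.
  have := le_measure (@lebesgue_measure R) (mem_set mE) (mem_set mM) EM.
  by move=> /(lt_le_trans E0); rewrite [X in (_ < X)%E]M0 ltxx.
exists y => //.
have : (@lebesgue_measure R (E `&` ball y r) * (@lebesgue_measure R (ball y r))^-1)%E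
    @[r --> 0^'+] --> (\1_E y)%:E by apply: contrapT => /HM.
rewrite indicE mem_set//= => dens.
have {dens} : \forall r \near (0 : R)^'+, ((1 - eta)%:E <
    @lebesgue_measure R (E `&` ball y r) * (@lebesgue_measure R (ball y r))^-1)%E.
  apply: (dens [set z | ((1 - eta)%:E < z)%E]).
  apply: open_nbhs_nbhs; split; first exact: open_ereal_gt_ereal.
  by rewrite /= lte_fin; lra.
move=> [r0 /= r00 Hr]; exists r0 => // r rpos rr0.
have := Hr r; rewrite /= sub0r normrN gtr0_norm// => /(_ rr0 rpos).
set muE := @lebesgue_measure R (E `&` ball y r).
have mball : measurable (ball y r) by exact: measurable_ball.
have muB : @lebesgue_measure R (ball y r) = (r *+ 2)%:E by rewrite lebesgue_measure_ball// ltW.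
rewrite muB => dens.
have split_ball : (r *+ 2)%:E = (@lebesgue_measure R (ball y r `\` E) + muE)%E.
  by rewrite -muB (measureDI (@lebesgue_measure R) mball mE) [ball y r `&` E]setIC.
have fE : muE \is a fin_num.
  rewrite ge0_fin_numE ?measure_ge0//; apply: (@le_lt_trans _ _ (r *+ 2)%:E); last exact: ltry.
  by rewrite split_ball leeDr// measure_ge0.
have fD : @lebesgue_measure R (ball y r `\` E) \is a fin_num.
  rewrite ge0_fin_numE ?measure_ge0//; apply: (@le_lt_trans _ _ (r *+ 2)%:E); last exact: ltry.
  by rewrite split_ball leeDl// measure_ge0.
move: dens split_ball; rewrite -(fineK fE) -(fineK fD) inver gt_eqF; last first.
  by rewrite mulrn_wgt0.
set a := fine _; set b := fine _ => h1 h2.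
move: h1; rewrite -EFinM lte_fin ltr_pdivlMr ?mulrn_wgt0// => h1.
have := congr1 fine h2; rewrite -EFinD /= => {}h2.
by rewrite lee_fin; move: h1 h2; rewrite -mulr_natr; lra.
Qed.

(** * Rigidity of measurable solutions *)

Lemma null_iter_preimage (R : realType) (psi F : R -> R) (B : R) (N : set R) :
  0 < B -> cancel psi F -> (forall x y, `|F x - F y| <= B * `|x - y|) ->
  continuous psi -> lebesgue_null N ->
  lebesgue_null [set x | exists n, N (iter n psi x)].
Proof.
move=> B0 psiK FB psic nN.
have citer n : continuous (iter n psi).
  elim: n => [|n IH] x; first exact: cvg_id.
  have := @continuous_comp _ _ _ (iter n psi) psi x (IH x) (psic _).
  exact.
apply: (@lebesgue_nullS _ (\bigcup_n (iter n psi @^-1` N))).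
  by move=> x [n Nn]; exists n.
apply: lebesgue_null_bigcup => n; apply: (@null_preimage _ _ _ (B ^+ n)) => //.
  exact: exprn_gt0.
move=> x y; elim: n => [|n IH]; first by rewrite expr0 mul1r.
apply: le_trans IH _; rewrite exprSr -mulrA; apply: ler_wpM2l.
  by rewrite exprn_ge0// ltW.
by rewrite !iterS -{1}(psiK (iter n psi x)) -{1}(psiK (iter n psi y)).
Qed.

Lemma coboundary_iter (R : realType) (H phi : R -> R[i]) (psi F : R -> R)
    (N : set R) (x : R) n :
  cancel psi F -> (forall x, ~ N x -> phi x = H (F x) - H x) ->
  ~ (exists n, N (iter n psi x)) ->
  H x = H (iter n psi x) + \sum_(k < n) phi (iter k.+1 psi x).
Proof.
move=> psiK HN Nx; elim: n => [|n IH]; first by rewrite big_ord0 addr0.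
rewrite big_ord_recr /= IH HN ?psiK; last by move=> h; apply: Nx; exists n.+1.
by rewrite /=; ring.
Qed.

Lemma lip_sum (R : realType) (phi : R -> R[i]) (psi : R -> R) (L q x y : R) n :
  0 <= L -> 0 <= q < 1 -> (forall x y, cabs (phi x - phi y) <= L * `|x - y|) ->
  (forall x y, `|psi x - psi y| <= q * `|x - y|) ->
  cabs (\sum_(k < n) phi (iter k.+1 psi x) - \sum_(k < n) phi (iter k.+1 psi y)) <=
    L / (1 - q) * `|x - y|.
Proof.
move=> L0 q01 phiL psiL; have [q0 q1] := andP q01; rewrite -sumrB.
apply: le_trans (cabs_sum _) _.
have -> : L / (1 - q) * `|x - y| = (L * `|x - y|) / (1 - q) * q ^+ 0.
  by rewrite expr0; ring.
apply: le_trans (geometric_tail 0 n _ q01); last by rewrite mulr_ge0.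
apply: ler_sum => k _; apply: le_trans (phiL _ _) _; rewrite add0n -[leRHS]mulrA.
apply: ler_wpM2l => //; apply: le_trans (iter_contraction k.+1 _ _ q0 psiL) _.
rewrite mulrC; apply: ler_wpM2l => //.
by rewrite exprS ler_piMl ?exprn_ge0// ltW.
Qed.

(** Near a density point of a set where [h] is almost constant, [iter n psi]
    maps a whole period into a small interval in which that set has almost full
    proportion. Bounded distortion keeps this proportion when going back to
    the period, and the cocycle equation changes [h] only by a function that is
    Lipschitz uniformly in [n]. *)
Lemma approximate_lipschitz (R : realType) (h : R[i] -> R[i]) (phi : R -> R[i])
    (psi F : R -> R) (L q D p : R) (N : set R) (eps eta : R) :
  circle_measurable h -> 0 <= L -> 0 <= q < 1 -> 0 < D ->
  (forall x y, cabs (phi x - phi y) <= L * `|x - y|) ->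
  (forall x y, `|psi x - psi y| <= q * `|x - y|) -> cancel psi F -> cancel F psi ->
  (forall n x x' u v, `|x - x'| <= pi *+ 2 -> `|x - u| <= pi *+ 2 ->
    `|u - v| <= pi *+ 2 ->
    `|iter n psi x - iter n psi x'| * `|u - v| <=
      D * `|iter n psi u - iter n psi v| * `|x - x'|) ->
  (forall x n, ~ N x ->
    h (expi x) = h (expi (iter n psi x)) + \sum_(k < n) phi (iter k.+1 psi x)) ->
  0 < eps -> 0 < eta ->
  exists B : set R, [/\ measurable B, (@lebesgue_measure R B <= eta%:E)%E &
    forall x y, `|x - p| <= pi -> `|y - p| <= pi -> ~ B x -> ~ B y ->
      (forall j : int, ~ N (x + j%:~R * (pi *+ 2))) ->
      (forall j : int, ~ N (y + j%:~R * (pi *+ 2))) ->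
      cabs (h (expi x) - h (expi y)) <= eps + L / (1 - q) * `|x - y|].
Proof.
move=> mh L0 q01 D0 phiL psiL psiK FK dist cob eps0 eta0.
have [q0 q1] := andP q01; have p0 := twopi_gt0 R; set P := pi *+ 2 in p0 dist *.
have PE : P = 2 * pi by rewrite /P mulr2n; ring.
have [E [mE E0 Eh]] := almost_constant_set mh eps0.
(* The ball below has radius [2 * D * l], where [l] is the length of the image of
   the period, and the distortion multiplies measures by at most [D * P / l]. *)
pose eta' := eta / (4 * P * D ^+ 2).
have eta'0 : 0 < eta' by rewrite divr_gt0// !mulr_gt0// exprn_gt0.
have [y0 Ey0 [r0 r00 dens]] := density_point mE E0 eta'0.
have [n Hn] := @exp_small _ q (r0 / (2 * D * P)) q01
  ltac:(by rewrite divr_gt0// !mulr_gt0).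
rewrite ltr_pdivlMr ?mulr_gt0// in Hn.
pose Y := iter n F y0.
have psiY : iter n psi Y = y0.
  rewrite /Y; elim: (n) => [//|m IH]; rewrite iterSr iterS FK; exact: IH.
(* The translate of the period about [p] that contains [Y]. *)
pose j := Num.floor ((Y - (p - pi)) / P).
pose a := p - pi + j%:~R * P; pose b := a + P.
have YI : a <= Y <= b.
  have /andP[j1 j2] := floor_itv ((Y - (p - pi)) / P).
  move: j1 j2; rewrite -/j ler_pdivlMr// ltr_pdivrMr// intrD mulrDl mul1r /b /a.
  by move=> *; apply/andP; split; lra.
pose T n := iter n psi; pose l := `|T n a - T n b|.
have ab : `|a - b| = P by rewrite /b opprD addNKr normrN gtr0_norm.
have l0 : 0 < l.
  rewrite normr_gt0 subr_eq0; apply/eqP => E1.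
  have Tinj m x y : T m x = T m y -> x = y.
    by elim: m => [//|m IH]; rewrite /T !iterS => /(congr1 F); rewrite !psiK; exact: IH.
  by have := Tinj _ _ _ E1; rewrite /b; lra.
have lq : l <= q ^+ n * P by rewrite -ab; exact: iter_contraction.
have inI X X' : a <= X <= b -> a <= X' <= b -> `|X - X'| <= P.
  by rewrite /b ler_norml => /andP[? ?] /andP[? ?]; apply/andP; split; lra.
have aI : a <= a <= b by rewrite /b lexx /=; lra.
have bI : a <= b <= b by rewrite /b lexx andbT; lra.
have up X X' : a <= X <= b -> a <= X' <= b -> `|T n X - T n X'| <= D * l.
  move=> XI XI'; have := dist n X X' a b (inI _ _ XI XI') (inI _ _ XI aI) (inI _ _ aI bI).
  rewrite ab => h1; rewrite -(ler_pM2r p0); apply: le_trans h1 _.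
  by rewrite ler_wpM2l ?inI// mulr_ge0// ltW.
pose Lc := D * P / l.
have Lc0 : 0 < Lc by rewrite divr_gt0// mulr_gt0.
have lowT X X' : a <= X <= b -> a <= X' <= b -> `|X - X'| <= Lc * `|T n X - T n X'|.
  move=> XI XI'; have := dist n a b X X' (inI _ _ aI bI) (inI _ _ aI XI) (inI _ _ XI XI').
  rewrite ab mulrC -ler_pdivlMr// => h1; apply: le_trans h1 _.
  by rewrite /Lc le_eqVlt; apply/orP; left; apply/eqP; rewrite /T; ring.
pose r := 2 * D * l; have rpos : 0 < r by rewrite !mulr_gt0.
have rr0 : r < r0.
  apply: le_lt_trans Hn; rewrite /r.
  have -> : q ^+ n * (2 * D * P) = 2 * D * (q ^+ n * P) by ring.
  by apply: ler_wpM2l => //; rewrite mulr_ge0// ltW.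
have psic : continuous psi by exact: lip_continuous psiL.
pose Tj : R -> R := fun x => T n (x + j%:~R * P).
have Tc : continuous Tj.
  apply: (@lip_continuous _ _ (q ^+ n)) => x y.
  apply: le_trans (iter_contraction n _ _ q0 psiL) _.
  by rewrite opprD addrACA subrr addr0.
pose W : set R := [set` `[p - pi, p + pi]].
have WI x : W x -> a <= x + j%:~R * P <= b.
  by rewrite /W /= in_itv /= /b /a PE => /andP[? ?]; apply/andP; split; lra.
pose B := W `&` Tj @^-1` (ball y0 r `\` E).
have mbE : measurable (ball y0 r `\` E) by apply: measurableD => //; exact: measurable_ball.
have mT : measurable_fun setT Tj.
  exact: continuous_measurable_fun.
have mW : measurable W by exact: measurable_itv.
have expW x y : W x -> W y -> `|x - y| <= Lc * `|Tj x - Tj y|.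
  move=> Wx Wy; have := lowT _ _ (WI x Wx) (WI y Wy).
  by rewrite opprD addrACA subrr addr0.
exists B; split.
- apply: measurableI => //; rewrite -[X in measurable X]setTI; exact: mT.
- apply: le_trans (expanding_preimage Lc0 mW Tc mbE expW) _.
  apply: (@le_trans _ _ (Lc%:E * (eta' * (2 * r))%:E)%E).
    by apply: lee_wpmul2l; [rewrite lee_fin ltW | exact: dens].
  rewrite -EFinM lee_fin /Lc /r /eta' le_eqVlt; apply/orP; left; apply/eqP.
  have E1 (l' D' P' e' : R) : l' != 0 -> D' != 0 -> P' != 0 ->
      D' * P' / l' * (e' / (4 * P' * D' ^+ 2) * (2 * (2 * D' * l'))) = e'.
    by move=> h1 h2 h3; field; rewrite h1 h2 h3.
  by apply: E1; rewrite gt_eqF.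
- have good x : `|x - p| <= pi -> ~ B x -> E (T n (x + j%:~R * P)).
    move=> xp Bx; apply: contrapT => Ex; apply: Bx.
    have Wx : W x by move: xp; rewrite /W /= in_itv /= ler_norml; lra.
    split=> //; split => //; rewrite /ball /= -psiY.
    apply: le_lt_trans (up _ _ YI (WI x Wx)) _; rewrite /r.
    have : 0 < D * l by rewrite mulr_gt0.
    by lra.
  move=> x y xp yp /(good x xp) Ex /(good y yp) Ey /(_ j) Nx /(_ j) Ny.
  have hper z : h (expi (z + j%:~R * P)) = h (expi z).
    exact: (periodic_int (f := fun z => h (expi z)) (fun z => congr1 h (expi_periodic z))).
  rewrite -(hper x) -(hper y) (cob _ n Nx) (cob _ n Ny).
  set X := x + _ in Ex Nx *; set X' := y + _ in Ey Ny *.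
  have XX : X - X' = x - y by rewrite /X /X'; ring.
  have := Eh _ _ Ex Ey; have := lip_sum X X' n L0 q01 phiL psiL.
  rewrite XX /T => h1 h2.
  set s := \sum_(k < n) _ in h1 *; set s' := \sum_(k < n) _ in h1 *.
  have -> : h (expi (iter n psi X)) + s - (h (expi (iter n psi X')) + s') =
    (h (expi (iter n psi X)) - h (expi (iter n psi X'))) + (s - s') by ring.
  by apply: le_trans (cabsD _ _) _; exact: lerD.
Qed.

(** Let the errors and the measures of the exceptional sets be summable: almost
    every point lies in finitely many of these sets. *)
Lemma lipschitz_window (R : realType) (h : R[i] -> R[i]) (phi : R -> R[i])
    (psi F : R -> R) (L q D p : R) (N : set R) :
  circle_measurable h -> 0 <= L -> 0 <= q < 1 -> 0 < D ->
  (forall x y, cabs (phi x - phi y) <= L * `|x - y|) ->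
  (forall x y, `|psi x - psi y| <= q * `|x - y|) -> cancel psi F -> cancel F psi ->
  (forall n x x' u v, `|x - x'| <= pi *+ 2 -> `|x - u| <= pi *+ 2 ->
    `|u - v| <= pi *+ 2 ->
    `|iter n psi x - iter n psi x'| * `|u - v| <=
      D * `|iter n psi u - iter n psi v| * `|x - x'|) ->
  lebesgue_null N ->
  (forall x n, ~ N x ->
    h (expi x) = h (expi (iter n psi x)) + \sum_(k < n) phi (iter k.+1 psi x)) ->
  exists2 M : set R, lebesgue_null M &
    forall x y, `|x - p| <= pi -> `|y - p| <= pi -> ~ M x -> ~ M y ->
      cabs (h (expi x) - h (expi y)) <= L / (1 - q) * `|x - y|.
Proof.
move=> mh L0 q01 D0 phiL psiL psiK FK dist nN cob.
pose e m : R := 1 / (2 ^ m.+1)%:R.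
have e0 m : 0 < e m by rewrite divr_gt0// ltr0n expn_gt0.
have [B HB] := choice (fun m => approximate_lipschitz p mh L0 q01 D0 phiL psiL
  psiK FK dist cob (e0 m) (e0 m)).
pose N2 := [set x : R | exists j : int, N (x + j%:~R * (pi *+ 2))].
have nN2 : lebesgue_null N2.
  pose sh n (x : R) := x + (odflt 0 (@unpickle int n))%:~R * (pi *+ 2).
  apply: (@lebesgue_nullS _ (\bigcup_n (sh n @^-1` N))).
    by move=> x [j Nj]; exists (pickle j) => //; rewrite /sh /preimage /= pickleK.
  have shE n x y : sh n x - sh n y = x - y by rewrite /sh; ring.
  apply: lebesgue_null_bigcup => n; apply: (@null_preimage _ _ _ 1) => //.
    by apply: (@lip_continuous _ _ 1) => x y; rewrite shE mul1r.
  by move=> x y; rewrite shE mul1r.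
have nls : lebesgue_null (lim_sup_set B).
  exists (lim_sup_set B); split => //.
    apply: bigcapT_measurable => n; apply: bigcup_measurable => m _.
    by have [] := HB m.
  apply: (@lim_sup_set_cvg0 _ _ _ (@lebesgue_measure R)).
    by move=> m; have [] := HB m.
  apply: (@le_lt_trans _ _ (\sum_(m <oo) (e m)%:E)%E).
    by apply: lee_nneseries => // m _; have [] := HB m.
  by apply: le_lt_trans (@epsilon_trick0 R 1 xpredT ler01) _; rewrite ltry.
exists (N2 `|` lim_sup_set B); first by apply: (lebesgue_nullU nN2 nls).
move=> x y xp yp Mx My.
have out z : ~ (N2 `|` lim_sup_set B) z ->
    exists m0, forall m, (m0 <= m)%N -> ~ B m z.
  move=> Mz; apply: contrapT => H; apply: Mz; right => n _.
  apply: contrapT => H'; apply: H; exists n => m nm Bm; apply: H'.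
  by exists m.
have [m1 Hm1] := out x Mx; have [m2 Hm2] := out y My.
apply/ler_addgt0Pr => d d0.
have [m3 Hm3] := @exp_small _ (2^-1) d ltac:(lra) d0.
pose m := maxn m3 (maxn m1 m2).
have [_ _ H] := HB m.
have em : e m <= d.
  apply: le_trans (ltW Hm3); rewrite /e div1r natrX -exprVn.
  by apply: ler_wiXn2l; [lra | lra | rewrite leqW// leq_maxl].
apply: le_trans (H x y xp yp _ _ _ _) _.
- by apply: Hm1; rewrite /m !leq_max leqnn orbT.
- by apply: Hm2; rewrite /m !leq_max leqnn !orbT.
- by move=> j Nj; apply: Mx; left; exists j.
- by move=> j Nj; apply: My; left; exists j.
- by rewrite addrC lerD2l.
Qed.

(** Along the backward orbits, which all tend to the fixed point [p], the
    increments of [h] tend to [0]; hence the increments of [h] are given by the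
    same series as those of [g]. *)
Lemma rigidity (R : realType) (h : R[i] -> R[i]) (phi g : R -> R[i])
    (psi F : R -> R) (L B q D p : R) (N : set R) :
  circle_measurable h -> 0 <= L -> 0 < B -> 0 <= q < 1 -> 0 < D ->
  (forall x y, cabs (phi x - phi y) <= L * `|x - y|) ->
  (forall x y, `|psi x - psi y| <= q * `|x - y|) -> cancel psi F -> cancel F psi ->
  (forall x y, `|F x - F y| <= B * `|x - y|) ->
  (forall n x x' u v, `|x - x'| <= pi *+ 2 -> `|x - u| <= pi *+ 2 ->
    `|u - v| <= pi *+ 2 ->
    `|iter n psi x - iter n psi x'| * `|u - v| <=
      D * `|iter n psi u - iter n psi v| * `|x - x'|) ->
  psi p = p -> lebesgue_null N ->
  (forall x, ~ N x -> phi x = h (expi (F x)) - h (expi x)) ->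
  (forall x, sums_to (fun n => phi (iter n.+1 psi x) - phi p) (g x)) ->
  exists c, lebesgue_null [set x | ~ (h (expi x) = g x + c)].
Proof.
move=> mh L0 B0 q01 D0 phiL psiL psiK FK FB dist pp nN hN gs.
have [q0 q1] := andP q01.
have psic : continuous psi by exact: lip_continuous psiL.
pose N1 := [set x | exists n, N (iter n psi x)].
have nN1 : lebesgue_null N1 by exact: (null_iter_preimage B0 psiK FB psic nN).
have cob x n : ~ N1 x ->
    h (expi x) = h (expi (iter n psi x)) + \sum_(k < n) phi (iter k.+1 psi x).
  move=> Nx; exact: (coboundary_iter (H := fun x => h (expi x)) n psiK hN Nx).
have [M nM HM] := lipschitz_window p mh L0 q01 D0 phiL psiL psiK FK dist nN1 cob.
pose M1 := [set x | exists n, M (iter n psi x)].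
have nM1 : lebesgue_null M1 by exact: (null_iter_preimage B0 psiK FB psic nM).
have key x y : ~ (N1 `|` M1) x -> ~ (N1 `|` M1) y ->
    h (expi x) - g x = h (expi y) - g y.
  move=> Nx Ny; apply/eqP; rewrite -subr_eq0; apply/eqP; apply: cabs_small0 => e e0.
  have pi0 : 0 < pi :> R by exact: pi_gt0.
  set K := L / (1 - q) in HM; have K0 : 0 <= K by rewrite divr_ge0//; lra.
  pose A := `|x - p| + `|y - p| + 1.
  have [x0 y0] : 0 <= `|x - p| /\ 0 <= `|y - p| by [].
  have A0 : 0 < A by rewrite /A; lra.
  have KA : 0 < K * A + 1 by rewrite ltr_wpDl// mulr_ge0// ltW.
  pose s := Num.min (pi / A) (e / 2 / (K * A + 1)).
  have s0 : 0 < s by rewrite lt_min !divr_gt0.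
  have [n1 Hn1] := exp_small q01 s0.
  have e4 : 0 < e / 4 by lra.
  have [n2 Hn2] := gs x _ e4; have [n3 Hn3] := gs y _ e4.
  pose n := maxn n1 (maxn n2 n3).
  have qn : q ^+ n < s.
    by apply: le_lt_trans Hn1; apply: ler_wiXn2l => //; [exact: ltW | exact: leq_maxl].
  have qn0 : 0 <= q ^+ n by rewrite exprn_ge0.
  move: qn; rewrite lt_min !ltr_pdivlMr// => /andP[qn1 qn2].
  have iterp : iter n psi p = p by elim: (n) => [//|k IH]; rewrite iterS IH.
  have itp z : `|z - p| <= A -> `|iter n psi z - p| <= q ^+ n * A.
    move=> zA; rewrite -{1}iterp; apply: le_trans (iter_contraction n _ _ q0 psiL) _.
    exact: ler_wpM2l.
  have hx := itp x ltac:(rewrite /A; lra); have hy := itp y ltac:(rewrite /A; lra).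
  have Hxy : cabs (h (expi (iter n psi x)) - h (expi (iter n psi y))) <= e / 2.
    apply: le_trans (HM _ _ _ _ _ _) _; [lra | lra | | |].
    - by move=> Mn; apply: Nx; right; exists n.
    - by move=> Mn; apply: Ny; right; exists n.
    - have xy : `|iter n psi x - iter n psi y| <= q ^+ n * A.
        apply: le_trans (iter_contraction n _ _ q0 psiL) _; apply: ler_wpM2l => //.
        have -> : x - y = (x - p) - (y - p) by ring.
        by apply: le_trans (ler_normB _ _) _; rewrite /A; lra.
      by have := ler_wpM2l K0 xy; lra.
  have := Hn2 n; have := Hn3 n.
  rewrite !leq_max !leqnn !orbT => /(_ isT) h3 /(_ isT) h2.
  rewrite (cob x n); last by move=> ?; apply: Nx; left.
  rewrite (cob y n); last by move=> ?; apply: Ny; left.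
  move: h2 h3; rewrite !sumrB.
  set sx := \sum_(k < n) phi (iter k.+1 psi x); set sy := \sum_(k < n) phi (iter k.+1 psi y).
  set sp := \sum_(k < n) phi p => h2 h3.
  set X := h _ in Hxy *; set Y := h _ in Hxy *.
  have -> : X + sx - g x - (Y + sy - g y) = (X - Y) +
     ((sx - sp - g x) - (sy - sp - g y)) by ring.
  apply: le_trans (cabsD _ _) _; apply: le_trans (lerD Hxy (cabsB _ _)) _.
  by lra.
have [y Ny] : exists y, ~ (N1 `|` M1) y.
  apply: contrapT => H; apply: (@not_null_line R).
  apply: (@lebesgue_nullS _ (N1 `|` M1)); last exact: lebesgue_nullU.
  by move=> y _; apply: contrapT => Ny; apply: H; exists y.
exists (h (expi y) - g y).
apply: (@lebesgue_nullS _ (N1 `|` M1)); last exact: lebesgue_nullU.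
move=> x /= Hx; apply: contrapT => Nx; apply: Hx.
by rewrite -(key x y Nx Ny) addrC subrK.
Qed.

Lemma null_dense (R : realType) (N : set R) (x r : R) :
  lebesgue_null N -> 0 < r -> exists2 z, `|z - x| < r & ~ N z.
Proof.
move=> [M [mM M0 NM]] r0; apply: contrapT => H.
have BM : ball x r `<=` M.
  move=> z xz; apply: NM; apply: contrapT => Nz; apply: H; exists z => //.
  by rewrite distrC.
have mB : measurable (ball x r) by exact: measurable_ball.
have := le_measure (@lebesgue_measure R) (mem_set mB) (mem_set mM) BM.
rewrite [X in (_ <= X)%E]M0 [X in (X <= _)%E](lebesgue_measure_ball x (ltW r0)) lee_fin.
by rewrite leNgt mulrn_wgt0.
Qed.

(** The function [g] is continuous, and so is determined by [H] almost
    everywhere. *)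
Lemma periodic_of_ae (R : realType) (H g : R -> R[i]) (c : R[i]) (C r P : R) :
  0 < r -> (forall x, H (x + P) = H x) ->
  (forall x y, `|x - y| < r -> cabs (g x - g y) <= C * `|x - y|) ->
  lebesgue_null [set x | ~ (H x = g x + c)] -> forall x, g (x + P) = g x.
Proof.
move=> r0 HP gL nH x; apply/eqP; rewrite -subr_eq0; apply/eqP; apply: cabs_small0 => e e0.
have C0 : 0 < `|C| + 1 by rewrite ltr_wpDl.
pose s := Num.min r (e / (2 * (`|C| + 1))).
have s0 : 0 < s by rewrite lt_min r0 divr_gt0// mulr_gt0.
have nU : lebesgue_null ([set x | ~ (H x = g x + c)] `|`
    (fun x => x + P) @^-1` [set x | ~ (H x = g x + c)]).
  have shE x' y' : x' + P - (y' + P) = x' - y' by ring.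
  apply: lebesgue_nullU => //; apply: (@null_preimage _ _ _ 1) => //.
    by apply: (@lip_continuous _ _ 1) => x' y'; rewrite shE mul1r.
  by move=> x' y'; rewrite shE mul1r.
have [z zx Nz] := null_dense x nU s0.
have h1 : H z = g z + c by apply: contrapT => h; apply: Nz; left.
have h2 : H (z + P) = g (z + P) + c by apply: contrapT => h; apply: Nz; right.
have gz : g (z + P) = g z.
  by apply: (addIr c); rewrite -h1 -h2 HP.
move: zx; rewrite lt_min => /andP[zr ze].
have b1 : cabs (g z - g x) <= C * `|z - x| by exact: gL.
have b2 : cabs (g (z + P) - g (x + P)) <= C * `|z - x|.
  by rewrite (_ : z - x = z + P - (x + P)); [apply: gL; rewrite (_ : _ - _ = z - x) | ring]; [|ring].
have b3 : C * `|z - x| <= e / 2.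
  apply: (@le_trans _ _ ((`|C| + 1) * `|z - x|)).
    by apply: ler_wpM2r => //; apply: le_trans (ler_norm C) _; rewrite lerDl.
  rewrite ltr_pdivlMr ?mulr_gt0// in ze; lra.
have -> : g (x + P) - g x = (g z - g x) - (g (z + P) - g (x + P)).
  by rewrite gz; ring.
by apply: le_trans (cabsB _ _) _; lra.
Qed.

(** * Gluing *)

Lemma open_annulus (R : realType) (a b : R) : open [set z : R[i] | a < cabs z < b].
Proof.
rewrite openE => z /= /andP[az zb]; apply/nbhs_cabs.
exists (Num.min (cabs z - a) (b - cabs z)); first by rewrite lt_min !subr_gt0 az.
move=> w; rewrite lt_min => /andP[w1 w2].
have := cabs_tri w z 0; have := cabs_tri z w 0; rewrite !subr0 (cabsC z w).
by move=> h1 h2; apply/andP; split; lra.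
Qed.

Lemma cdiff_translate (R : realType) (f : R[i] -> R[i]) (a z : R[i]) :
  cdiff f (z + a) -> cdiff (fun w => f (w + a)) z.
Proof. by move=> [d Hd]; exists d; apply/cderiv_shift. Qed.

(** The germs [G x], placed at the points [expi x] of the circle by means of the
    exponential, agree on the circle; by unique continuation they agree
    wherever they meet, and so define a function on an annulus. *)
Lemma glue (R : realType) (G : R -> R[i] -> R[i]) (r : R) :
  0 < r -> (forall x z, cabs z < r -> cdiff (G x) z) ->
  (forall x (s : R), `|s| < r -> G x s%:C = G (x + s) 0) ->
  (forall x y, expi x = expi y -> G x 0 = G y 0) ->
  exists (V : set R[i]) (g : R[i] -> R[i]), [/\ open V, @unit_circle R `<=` V,
    forall z, V z -> cdiff g z & forall x, g (expi x) = G x 0].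
Proof.
move=> r0 Gd Gr Gp.
have exarg (z : R[i]) : exists x, z != 0 -> z = (cabs z)%:C * expi x.
  have [->|z0] := eqVneq z 0; first by exists 0.
  have [x Hx] : exists x, expi x = z / (cabs z)%:C.
    apply: expi_surj; rewrite cabsM cabsV cabs_real ger0_norm ?cabs_ge0//.
    by rewrite divff// gt_eqF// cabs_gt0.
  exists x => _; rewrite Hx mulrC divfK//.
  by rewrite -cabs_gt0 cabs_real normr_gt0 gt_eqF// cabs_gt0.
have [arg Harg] := choice exarg.
pose e := r / 8; have e0 : 0 < e by rewrite /e; lra.
have r2 : r / 2 < r by lra.
have e_r u : u < e -> u < r by rewrite /e; lra.
have e_r2 u : u < e -> 3 * u < r / 2 by rewrite /e; lra.
have half_half u v : u < r / 2 -> v < r / 2 -> u + v < r by lra.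
pose V := [set z : R[i] | expR (- e) < cabs z < expR e].
pose g z := G (arg z) (0 +i* (- ln (cabs z))).
have V0 z : V z -> z != 0.
  by move=> /andP[h _]; rewrite -cabs_gt0; apply: lt_trans h; exact: expR_gt0.
have Vln z : V z -> `|ln (cabs z)| < e.
  move=> Vz; have z0 : 0 < cabs z by rewrite cabs_gt0 V0.
  have /andP[h1 h2] := Vz; rewrite ltr_norml.
  by rewrite -ltr_expR -[X in _ && X]ltr_expR !lnK ?posrE// h1 h2.
exists V, g; split.
- exact: open_annulus.
- move=> z; rewrite /unit_circle /V /= normE => h.
  have -> : cabs z = 1 by have := congr1 (@complex.Re R) h.
  by rewrite -[X in _ < X < _]expR0 !ltr_expR; apply/andP; split; lra.
- move=> z1 Vz1; have z10 := V0 _ Vz1.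
  have [d [L [d0 Lexp Ld L2 Lr]]] := local_log (ltac:(lra) : 0 < r / 2).
  have [d2 d20 HV] : exists2 d2 : R, 0 < d2 & forall w, cabs (w - z1) < d2 -> V w.
    by apply/nbhs_cabs; apply: open_nbhs_nbhs; split => //; exact: open_annulus.
  have c1 : 0 < cabs z1 by rewrite cabs_gt0.
  set t1 := ln (cabs z1); set th := arg z1.
  have z1E : z1 = cexp (t1 +i* th).
    by rewrite /cexp /= lnK ?posrE//; exact: Harg.
  have near w : cabs (w - z1) < d * cabs z1 -> cabs (w / z1 - 1) < d.
    have -> : w / z1 - 1 = (w - z1) / z1 by field.
    by rewrite cabsM cabsV ltr_pdivrMr.
  (* In the coordinate [lam w], the point [w] is [cexp (lam w)] times [z1]; its
     real part is the increment of [ln (cabs w)], its imaginary part that of the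
     argument. *)
  pose lam w := L (w / z1).
  pose k w := G th (- 'i%C * lam w + (0 +i* (- t1))).
  apply: (@cdiff_near _ k _ _ (Num.min d2 (d * cabs z1))).
  + by rewrite lt_min d20 mulr_gt0.
  + move=> w; rewrite lt_min => /andP[/HV Vw /near wd].
    have w0 := V0 _ Vw; have cw : 0 < cabs w by rewrite cabs_gt0.
    have wE : w = cexp (lam w + (t1 +i* th)).
      by rewrite cexpD -z1E /lam Lexp// divfK.
    have lr := Lr _ wd; rewrite -/(lam w) in lr.
    have lnw : ln (cabs w) = Re (lam w) + t1.
      rewrite {1}wE /cexp cabsM cabs_expi mulr1 cabs_real ger0_norm ?expR_ge0//.
      by rewrite expRK raddfD.
    have argw : expi (arg w) = expi (th + Im (lam w)).
      have cE : cabs w = expR (Re (lam w) + t1) by rewrite -lnw lnK ?posrE.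
      have := Harg w w0; rewrite {1}wE cE /cexp !raddfD /= => /mulfI h.
      rewrite -h 1?addrC//.
      by rewrite -cabs_gt0 cabs_real normr_gt0 gt_eqF// expR_gt0.
    have ImL : `|Im (lam w)| < r / 2 by exact: le_lt_trans (Im_le_cabs _) lr.
    pose D z := G th (z + (Im (lam w))%:C) - G (arg w) z.
    have D0 : D (0 +i* (- ln (cabs w))) = 0.
      apply: (@vanish_near_axis _ D (r / 2)).
      * move=> z zr; apply: (@cdiffB _ (fun z => G th (z + (Im (lam w))%:C))); last exact: Gd (lt_trans zr r2).
        apply: cdiff_translate; apply: Gd; apply: le_lt_trans (cabsD _ _) _; rewrite cabs_real.
        exact: half_half.
      * move=> s sr; have sL : `|s + Im (lam w)| < r.
          by apply: le_lt_trans (ler_normD _ _) _; exact: half_half.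
        rewrite /D -rmorphD (Gr th _ sL) (Gr (arg w) _ (lt_trans sr r2)).
        apply/eqP; rewrite subr_eq0; apply/eqP; apply: Gp.
        by rewrite (expiD (arg w)) argw -expiD; congr expi; ring.
      * by rewrite normrN; apply: e_r2; exact: Vln.
    rewrite /g /k; move/eqP: D0; rewrite /D subr_eq0 => /eqP <-.
    congr (G th _); rewrite lnw; apply/eqP; case: (lam w) => a b.
    by rewrite eq_complex /=; apply/andP; split; apply/eqP; ring.
  + have L1 : L 1 = 0.
      apply: cabs0_eq0; apply/eqP; rewrite eq_le cabs_ge0 andbT.
      by have := L2 1; rewrite subrr cabs0 mulr0; apply.
    have dz : z1 / z1 = 1 by rewrite divff.
    rewrite /k; apply: (@cdiff_comp _ (fun w => - 'i%C * lam w + (0 +i* (- t1))) (G th)).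
      apply: cdiffD; last exact: cdiff_cst.
      apply: cdiffM; first exact: cdiff_cst.
      apply: (@cdiff_comp _ (fun w => w / z1) L).
        by apply: cdiffM; [exact: cdiff_id | exact: cdiff_cst].
      by apply: Ld; rewrite dz subrr cabs0.
    apply: Gd; rewrite /lam dz L1 mulr0 add0r.
    rewrite (_ : 0 +i* (- t1) = - ('i%C * t1%:C)); last first.
      by apply/eqP; rewrite eq_complex /=; apply/andP; split; apply/eqP; ring.
    rewrite cabsN cabsM cabsi mul1r cabs_real.
    by apply: e_r; exact: Vln.
- move=> x; rewrite /g cabs_expi ln1 oppr0.
  apply: Gp; have := Harg (expi x); rewrite cabs_expi mul1r => h.
  by rewrite -h// -cabs_gt0 cabs_expi.
Qed.

(** Compose [f] with the exponential. *)
Lemma observable_extends (R : realType) (U : set R[i]) (f : R[i] -> R[i]) :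
  open U -> @unit_circle R `<=` U -> holomorphic_on U f ->
  exists2 rho, 0 < rho & forall y, extends_at (fun x => f (expi x)) rho y.
Proof.
move=> oU cU fU; apply: extends_uniform; first by move=> x; rewrite expi_periodic.
move=> y; pose v (z : R[i]) := expi y * cexp ('i%C * z).
have vd z : cdiff v z.
  apply: cdiffM; first exact: cdiff_cst.
  apply: (@cdiff_comp _ (fun w => 'i%C * w) (@cexp R)); last exact: cexp_cdiff.
  by apply: cdiffM; [exact: cdiff_cst | exact: cdiff_id].
have v0 : v 0 = expi y by rewrite /v mulr0 cexp0 mulr1.
have Uy : U (expi y) by apply: cU; exact: expi_circle.
have fd w : U w -> cdiff f w by move=> /fU/derivable_cdiff.
have [d1 d10 H1] : exists2 d1 : R, 0 < d1 & forall w, cabs (w - expi y) < d1 -> U w.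
  by apply/nbhs_cabs; exact: open_nbhs_nbhs.
have [d2 d20 H2] := cdiff_cont (fd _ Uy) ltr01.
have d0 : 0 < Num.min d1 d2 by rewrite lt_min d10.
have [r r0 Hr] := cdiff_cont (vd 0) d0.
have near z : cabs z < r -> cabs (v z - expi y) < d1 /\ cabs (v z - expi y) < d2.
  by move=> zr; apply/andP; rewrite -lt_min -v0; apply: Hr; rewrite subr0.
apply: (@holomorphic_extends_at _ _ y (fun z => f (v z)) r (cabs (f (expi y)) + 1)) => //.
- move=> z /near[/H1 Uz _]; apply: (@cdiff_comp _ v f); first exact: vd.
  exact: fd.
- move=> z /near[_ /H2 h]; have := cabsD (f (v z) - f (expi y)) (f (expi y)).
  by rewrite subrK; lra.
- by move=> s _; rewrite /v cexp_i -expiD.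
Qed.

Unset Implicit Arguments.

Theorem theorem3p3 (R : realType) (T : R[i] -> R[i]) (U : set R[i])
    (f h : R[i] -> R[i]) :
  (forall z, unit_circle z -> unit_circle (T z)) ->
  circle_analytic T ->
  1 < inf [set circle_speed T z | z in @unit_circle R] ->
  open U -> @unit_circle R `<=` U ->
  holomorphic_on U f ->
  circle_measurable h ->
  {ae circle_measure R, forall z, unit_circle z -> f z = h (T z) - h z} ->
  exists (V : set R[i]) (g : R[i] -> R[i]),
    [/\ open V, @unit_circle R `<=` V, holomorphic_on V g &
        {ae circle_measure R, forall z, unit_circle z -> g z = h z}].
Proof.
move=> Tc Ta Tinf oU cU fU mh fae.
have [rT rT0 Te] := circle_analytic_extends Ta.
have [rf rf0 fe] := observable_extends oU cU fU.
pose phi x := f (expi x).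
have [F [k [lam [B [l1 B0 Fexp Fd [kl kB kL dl]]]]]] := lift_exists Tc Tinf rT0 Te.
have [psi [psiK FK psiL]] := expanding_inverse l1 Fd kl kL.
have l0 : 0 < lam by lra.
have p0 : 0 <= pi *+ 2 :> R by exact: ltW (twopi_gt0 R).
have [D D0 dist] := bounded_distortion l1 B0 p0 Fd kl kL psiK psiL.
pose rho := Num.min rT rf; have rho0 : 0 < rho by rewrite lt_min rT0.
have Te' y : extends_at (fun x => T (expi x)) rho y.
  by apply: extends_at_le (Te y); rewrite // ge_min lexx.
have fe' y : extends_at phi rho y.
  by apply: extends_at_le (fe y); rewrite // ge_min lexx orbT.
have tpsi x : T (expi (psi x)) = expi x by rewrite -Fexp psiK.
have [r [q [Psi [r0 rr q01 lq HPsi]]]] := inverse_branches rho0 l1 Te' dl tpsi psiL.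
have psiq x y : `|psi x - psi y| <= q * `|x - y|.
  by apply: le_trans (psiL x y) _; rewrite ler_wpM2r.
have [p pp] := contraction_fixpoint q01 psiq.
have [G [C [Gd Gr Gs GL]]] := transfer_sum rho0 fe' r0 rr q01 psiq pp HPsi.
have [dphi [d1 d2 _]] := extends_rderiv rho0 fe'.
have phiL := rderiv_lip d1 d2.
have FB x y : `|F x - F y| <= B * `|x - y|.
  have [c [_ _ ->]] := mean_value y x Fd.
  by rewrite normrM ler_wpM2r.
pose N := (@expi R) @^-1` (~` [set z | unit_circle z -> f z = h (T z) - h z]).
have nN : lebesgue_null N by exact: circle_null_pullback.
have hN x : ~ N x -> phi x = h (expi (F x)) - h (expi x).
  by move=> /contrapT H; rewrite Fexp; apply: H; exact: expi_circle.
have L0 : 0 <= 2 * rho^-1 by rewrite mulr_ge0// invr_ge0 ltW.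
have [c hG] := rigidity mh L0 B0 q01 D0 phiL psiq psiK FK FB dist pp nN hN Gs.
have Gp x y : expi x = expi y -> G x 0 = G y 0.
  move=> xy; rewrite -[y](subrK x) addrC; apply/esym.
  apply: (periodic_of_ae (H := fun x => h (expi x)) r0 _ GL hG) => z.
  suff -> : expi (z + (y - x)) = expi z by [].
  rewrite expiD [X in _ * X](_ : _ = 1) ?mulr1//.
  by rewrite expiD -xy -expiD subrr expi0.
have [V [g [oV cV gd gE]]] := glue r0 Gd Gr Gp.
exists V, (fun z => g z + c); split => //.
  move=> z Vz; apply/derivable_cdiff; apply: cdiffD; first exact: gd.
  exact: cdiff_cst.
apply: circle_ae_of_line; apply: lebesgue_nullS hG => x /=.
by rewrite gE => H E; apply: H.
Qed.
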